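(* Let $1\le m<n$ and let $\mu, \nu$ be finite nonzero Borel measures on $\mathbb{R}^n$ with compact support such that $I_m(\mu)<\infty$ and $I_{m}(\nu)<\infty$. Then $$\int_{G(n,m)}\int_V P_{V\sharp}\mu(v)\, P_{V\sharp}\nu(v)\, d\mathcal H^mv\,d\gamma_{n,m}V>0$$ and $$\gamma_{n,m}\left(\{V\in G(n,m): \mathcal H^m\left(P_V(\operatorname{spt}\mu)\cap P_V(\operatorname{spt}\nu)\right)>0\}\right)>0.$$
   Context: For a Borel measure $\mu$ on $\mathbb{R}^n$, $I_s(\mu)=\iint|x-y|^{-s}\,d\mu x\,d\mu y$ is its $s$-energy and $\operatorname{spt}\mu$ its support. $G(n,m)$ is the Grassmannian of $m$-dimensional linear subspaces of $\mathbb{R}^n$, $\gamma_{n,m}$ its orthogonally invariant Borel probability measure, $P_V$ the orthogonal projection onto $V$, and $\mathcal H^m$ the $m$-dimensional Hausdorff (Lebesgue) measure on $V$. If $I_m(\mu)<\infty$, then for $\gamma_{n,m}$ almost all $V$ the image measure $P_{V\sharp}\mu$ is absolutely continuous with respect to $\mathcal H^m$ on $V$ with density in $L^2(V)$; this density is also denoted $P_{V\sharp}\mu$. *)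

(* Defs.v *)
From HB Require Import structures.
From mathcomp Require Import all_boot all_order all_algebra.
From mathcomp Require Import all_classical all_reals all_analysis.
Set Implicit Arguments. Unset Strict Implicit. Unset Printing Implicit Defensive.
Import Order.TTheory GRing.Theory Num.Theory.
Import numFieldNormedType.Exports.
Local Open Scope classical_set_scope.
Local Open Scope ring_scope.

Section Defs.
Variable R : realType.

Definition Rn (n : nat) := g_sigma_algebraType (@open 'rV[R]_n).
(* n x n real matrices with their Borel sigma-algebra; G(n,m) is modelled as
   the (closed) set of orthogonal projection matrices of rank m. *)
Definition Mn (n : nat) := g_sigma_algebraType (@open 'M[R]_n).

Definition eucl n (x : 'rV[R]_n) : R := Num.sqrt (\sum_i x ord0 i ^+ 2).

Definition riesz_kernel n (s : nat) (x y : 'rV[R]_n) : \bar R :=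
  if x == y then +oo%E else ((eucl (x - y))^-1 ^+ s)%:E.

Definition energy n (mu : set (Rn n) -> \bar R) (s : nat) : \bar R :=
  (\int[mu]_x \int[mu]_y riesz_kernel s x y)%E.

Definition spt n (mu : set (Rn n) -> \bar R) : set 'rV[R]_n :=
  [set x : 'rV[R]_n | forall r : R, 0 < r -> (0 < mu [set y | (eucl (y - x) < r)%R])%E].

Fixpoint ball_volume (k : nat) : R :=
  match k with
  | 0%N => 1
  | 1%N => 2
  | k'.+2 => (2 * pi / k'.+2%:R) * ball_volume k'
  end.

(* diameter (Euclidean), with diam set0 = 0 *)
Definition diam n (E : set 'rV[R]_n) : \bar R :=
  ereal_sup ([set 0%E] `|` [set (eucl (x - y))%:E | x in E & y in E]).

Definition hausdorff_delta n (m : nat) (delta : R) (A : set 'rV[R]_n) : \bar R :=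
  ereal_inf [set (\sum_(0 <= i <oo)
                   ((ball_volume m * (fine (diam (E i)) / 2) ^+ m)%:E))%E
            | E in [set E : nat -> set 'rV[R]_n |
                    A `<=` \bigcup_i E i /\ forall i, (diam (E i) <= delta%:E)%E]].

(* m-dimensional Hausdorff measure on R^n (normalised so that it agrees with
   Lebesgue measure on m-dimensional affine subspaces) *)
Definition hausdorff n (m : nat) (A : set (Rn n)) : \bar R :=
  ereal_sup [set hausdorff_delta m delta A | delta in [set d : R | 0 < d]].

(* P is the orthogonal projection onto an m-dimensional linear subspace *)
Definition grassmannian n (m : nat) : set 'M[R]_n :=
  [set P | P^T = P /\ P *m P = P /\ \rank P = m].

Definition subspace_of n (P : 'M[R]_n) : set (Rn n) := [set v | v *m P = v].
Definition projV n (P : 'M[R]_n) (x : 'rV[R]_n) : 'rV[R]_n := x *m P.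

(* gamma is an orthogonally invariant Borel probability measure on G(n,m)
   (unique: it is gamma_{n,m}) *)
Definition grassmann_measure n (m : nat) (gamma : set (Mn n) -> \bar R) :=
  gamma setT = 1%E /\ gamma (grassmannian m) = 1%E /\
  forall Q : 'M[R]_n, Q *m Q^T = 1%:M ->
    forall A : set (Mn n), measurable A ->
      gamma ((fun P : Mn n => Q^T *m P *m Q) @^-1` A) = gamma A.

Definition is_proj_density n (m : nat) (mu : set (Rn n) -> \bar R)
    (P : 'M[R]_n) (h : 'rV[R]_n -> R) :=
  measurable_fun [set: Rn n] (h : Rn n -> R) /\
  forall A : set (Rn n), measurable A ->
    mu (projV P @^-1` A) =
      (\int[hausdorff m]_(v in A `&` subspace_of P) (h v)%:E)%E.

End Defs.

(* Main.v *)
(** Write F_k(P) for k^m times the (mu x nu)-measure of the pairs (x, y) with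
    |P(x - y)| < 1/k.  By orthogonal invariance gamma{P : |Pz| < d} is comparable to
    (d/|z|)^m, so the integral of F_k over G(n,m) is bounded below, and for mu = nu it
    is at most a constant times the m-energy.  In terms of the densities f and g of the
    projections, F_k(P) is a double integral of f(u) g(v) over nearby u, v in V.  For
    mu = nu and almost every P, Fatou's lemma bounds lim inf F_k(P), which dominates the
    L^2 norm of f; for f and g in L^2, polarisation bounds lim sup F_k(P) by a
    constant times the integral of f g, and Schur's test bounds F_k(P) by an integrable
    function of P.  If lim sup F_k vanished almost everywhere, dominated
    convergence would contradict the lower bound; so the integral of f g is positive on a
    set of P of positive measure.  As f and g vanish almost everywhere off the
    projected supports, these supports meet in positive measure for such P. *)

Require Import Defs.
From HB Require Import structures.
From mathcomp Require Import all_boot all_order all_algebra.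
From mathcomp Require Import all_classical all_reals all_analysis.
From mathcomp Require Import measurable_realfun ring lra zify.
Set Implicit Arguments. Unset Strict Implicit. Unset Printing Implicit Defensive.
Import Order.TTheory GRing.Theory Num.Theory.
Import numFieldNormedType.Exports.
Local Open Scope classical_set_scope.
Local Open Scope ring_scope.

(** * Euclidean norm and Borel sets *)

(** What shapes the argument is how little is known of the objects. [gamma] is given by invariance
    alone, with no coordinates on the Grassmannian, so both of its bounds come from counting integer
    points that a single projection shortens. The Hausdorff measure [kappa] of the unit ball of V is
    never computed: only 0 < [kappa] <= C matters, with C uniform in P. No differentiation theorem
    for measures on V is invoked; polarisation makes up for it, because Schur's upper bound for the
    form of f + g and the asymptotic lower bounds for the forms of f and of g carry the same
    constant [kappa], so that subtraction isolates the mixed form. The densities are chosen for each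
    P separately, with no measurability in P, so the integral of f g over V is not a known
    measurable function of P. The estimates over the Grassmannian therefore use functions built from
    the F_k, which are measurable in P, and the integral of f g enters only through its lower bound
    lim sup F_k / (2 C). *)

Section eucl.
Variables (R : realType).
Implicit Types n : nat.

Lemma eucl_ge0 n (x : 'rV[R]_n) : 0 <= eucl x.
Proof. exact: sqrtr_ge0. Qed.

Lemma sqr_eucl n (x : 'rV[R]_n) : eucl x ^+ 2 = \sum_i x ord0 i ^+ 2.
Proof. by rewrite sqr_sqrtr// sumr_ge0// => i _; exact: sqr_ge0. Qed.

Lemma eucl_rowP n (x : 'rV[R]_n) : eucl x ^+ 2 = (x *m x^T) ord0 ord0.
Proof. by rewrite sqr_eucl mxE; apply: eq_bigr => i _; rewrite mxE expr2. Qed.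

Lemma eucl_eq0 n (x : 'rV[R]_n) : (eucl x == 0) = (x == 0).
Proof.
rewrite -sqrf_eq0 sqr_eucl psumr_eq0; last by move=> i _; exact: sqr_ge0.
apply/allP/eqP => [h|-> i _]; last by rewrite mxE expr0n/=.
apply/rowP => i; rewrite mxE; apply/eqP; rewrite -sqrf_eq0.
by apply: (h i); rewrite mem_index_enum.
Qed.

Lemma eucl0 n : eucl (0 : 'rV[R]_n) = 0.
Proof. by apply/eqP; rewrite eucl_eq0. Qed.

Lemma eucl_gt0 n (x : 'rV[R]_n) : (0 < eucl x) = (x != 0).
Proof. by rewrite lt_neqAle eucl_ge0 andbT eq_sym eucl_eq0. Qed.

Lemma euclZ n (a : R) (x : 'rV[R]_n) : eucl (a *: x) = `|a| * eucl x.
Proof.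
rewrite /eucl -sqrtr_sqr -sqrtrM ?sqr_ge0//; congr Num.sqrt.
by rewrite mulr_sumr; apply: eq_bigr => i _; rewrite mxE exprMn.
Qed.

Lemma euclN n (x : 'rV[R]_n) : eucl (- x) = eucl x.
Proof. by rewrite -scaleN1r euclZ normrN1 mul1r. Qed.

Lemma eucl_sym n (x y : 'rV[R]_n) : eucl (x - y) = eucl (y - x).
Proof. by rewrite -euclN opprB. Qed.

(** Lagrange's identity: the sum over all i, j of the squared 2 x 2 minors is twice the defect of
    the inequality. *)
Lemma cauchy_schwarz_sum (I : finType) (a b : I -> R) :
  (\sum_i a i * b i) ^+ 2 <= (\sum_i a i ^+ 2) * (\sum_i b i ^+ 2).
Proof.
have H : 0 <= \sum_i \sum_j (a i * b j - a j * b i) ^+ 2.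
  by apply: sumr_ge0 => i _; apply: sumr_ge0 => j _; exact: sqr_ge0.
pose A := \sum_i a i ^+ 2; pose B := \sum_i b i ^+ 2; pose S := \sum_i a i * b i.
suff E : \sum_i \sum_j (a i * b j - a j * b i) ^+ 2 = (A * B - S ^+ 2) *+ 2.
  by move: H; rewrite E pmulrn_lge0// subr_ge0.
have E1 i : \sum_j (a i * b j - a j * b i) ^+ 2 =
    a i ^+ 2 * B + (b i ^+ 2 * A - (a i * b i) * (S *+ 2)).
  rewrite -sumrMnl !mulr_sumr -sumrB -big_split/=.
  by apply: eq_bigr => j _; ring.
under eq_bigr do rewrite E1.
rewrite big_split/= sumrB -!mulr_suml -/A -/B -/S.
by rewrite expr2 (mulrC B) addrA -mulr2n mulrnAr mulrnBl.
Qed.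

Lemma ler_euclD n (x y : 'rV[R]_n) : eucl (x + y) <= eucl x + eucl y.
Proof.
rewrite -ler_sqr ?nnegrE ?addr_ge0 ?eucl_ge0//.
rewrite sqrrD !sqr_eucl.
have -> : \sum_i (x + y) ord0 i ^+ 2 = \sum_i x ord0 i ^+ 2 +
   (\sum_i x ord0 i * y ord0 i) *+ 2 + \sum_i y ord0 i ^+ 2.
  by rewrite -sumrMnl -!big_split/=; apply: eq_bigr => i _; rewrite mxE sqrrD.
rewrite lerD2r lerD2l lerMn2r/=.
apply: (le_trans (ler_norm _)).
rewrite -ler_sqr ?nnegrE ?mulr_ge0 ?eucl_ge0// real_normK ?num_real//.
by rewrite exprMn !sqr_eucl; exact: cauchy_schwarz_sum.
Qed.

Lemma ler_eucl_distD n (z x y : 'rV[R]_n) :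
  eucl (x - y) <= eucl (x - z) + eucl (z - y).
Proof. by rewrite -[x - y](subrKA z); exact: ler_euclD. Qed.

Lemma ler_coord_eucl n (x : 'rV[R]_n) i : `|x ord0 i| <= eucl x.
Proof.
rewrite -ler_sqr ?nnegrE ?eucl_ge0// real_normK ?num_real// sqr_eucl.
by rewrite (bigD1 i)//= lerDl sumr_ge0// => j _; exact: sqr_ge0.
Qed.

Lemma ler_eucl_sum n (x : 'rV[R]_n) : eucl x <= \sum_i `|x ord0 i|.
Proof.
have s0 (r : seq 'I_n) : 0 <= \sum_(i <- r) `|x ord0 i| by apply: sumr_ge0.
rewrite -ler_sqr ?nnegrE ?eucl_ge0// sqr_eucl.
elim: (index_enum _) => [|i s ih]; first by rewrite !big_nil expr0n.
rewrite !big_cons sqrrD real_normK ?num_real// -addrA lerD2l (le_trans ih)// lerDr.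
by rewrite mulrn_wge0// mulr_ge0.
Qed.

Lemma ler_eucl_bound n (x : 'rV[R]_n) (b : R) :
  (forall i, `|x ord0 i| <= b) -> eucl x <= n%:R * b.
Proof.
move=> h; apply: (le_trans (ler_eucl_sum x)); apply: (le_trans (ler_sum _ (fun i _ => h i))).
by rewrite sumr_const card_ord mulr_natl.
Qed.

(** The topology of ['rV[R]_n] is that of the sup norm. Dividing the radius by n + 1 rather than n
    keeps the inequality strict and covers n = 0. *)
Lemma open_euclP n (A : set 'rV[R]_n) :
  open A <-> forall x, A x -> exists2 r : R, 0 < r & forall y, eucl (y - x) < r -> A y.
Proof.
split=> [oA x Ax|h].
  have /nbhs_ballP[r /= r0 hr] : nbhs x A by apply: open_nbhs_nbhs.
  exists r => // y yx; apply: hr; split => // i j; rewrite /ball/= (ord1 i).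
  have -> : x 0 j - y 0 j = - (y - x) 0 j by rewrite !mxE opprB.
  by rewrite normrN; exact: le_lt_trans (ler_coord_eucl _ _) yx.
rewrite openE => x Ax; have [r r0 hr] := h x Ax.
apply/nbhs_ballP; exists (r / n.+1%:R); first by rewrite /= divr_gt0.
move=> y [_ yx]; apply: hr.
have : eucl (y - x) <= n%:R * (r / n.+1%:R).
  apply: ler_eucl_bound => i; have := yx ord0 i; rewrite /ball/= !mxE distrC.
  exact: ltW.
move=> /le_lt_trans; apply.
rewrite mulrCA -[ltRHS]mulr1 ltr_pM2l// ltr_pdivrMr// mul1r ltr_nat//.
Qed.

Lemma open_eucl_ball n (x : 'rV[R]_n) r : open [set y | eucl (y - x) < r].
Proof.
apply/open_euclP => y /= yr; exists (r - eucl (y - x)); first by rewrite subr_gt0.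
move=> z; rewrite ltrBrDr; apply: le_lt_trans.
exact: ler_eucl_distD.
Qed.

End eucl.

Section measurability.
Variables (R : realType).
Implicit Types n : nat.

Lemma measurable_coord a b (i : 'I_a) (j : 'I_b) :
  measurable_fun [set: g_sigma_algebraType (@open 'M[R]_(a, b))]
    (fun M : g_sigma_algebraType (@open 'M[R]_(a, b)) => (M : 'M[R]_(a, b)) i j : R).
Proof.
apply: (measurability _ (RGenOInfty.measurableE R)) => _ [_ [c ->] <-].
rewrite setTI; apply: sub_sigma_algebra.
rewrite openE => M /=; rewrite in_itv/= andbT => cM.
apply/nbhs_ballP; exists (M i j - c); first by rewrite /= subr_gt0.
move=> N [_ /(_ i j)]; rewrite /ball/= in_itv/= andbT => h.
by move: (le_lt_trans (ler_norm _) h); rewrite ltrD2l ltrN2.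
Qed.

Lemma measurable_row n (j : 'I_n) :
  measurable_fun [set: Rn R n] (fun x : Rn R n => (x : 'rV[R]_n) ord0 j : R).
Proof. exact: measurable_coord. Qed.

Lemma measurable_mat n (i j : 'I_n) :
  measurable_fun [set: Mn R n] (fun x : Mn R n => (x : 'M[R]_n) i j : R).
Proof. exact: measurable_coord. Qed.

(** A coordinatewise criterion on an arbitrary domain: on products it avoids comparing the product
    sigma-algebra with the Borel sets of the product space. *)
Lemma measurable_eucl d (T : measurableType d) n (F : T -> 'rV[R]_n) :
  (forall i, measurable_fun setT (fun t => F t ord0 i)) ->
  measurable_fun setT (fun t => eucl (F t)).
Proof.
move=> h; apply: (measurableT_comp (continuous_measurable_fun (@sqrt_continuous R))).
by apply: measurable_sum => i; apply: measurable_funX.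
Qed.

Lemma measurable_open n (A : set 'rV[R]_n) : open A -> measurable (A : set (Rn R n)).
Proof. by move=> oA; exact: sub_sigma_algebra. Qed.

Lemma measurable_closed n (A : set 'rV[R]_n) : closed A -> measurable (A : set (Rn R n)).
Proof. by rewrite -openC => /measurable_open/measurableC; rewrite setCK. Qed.

Lemma measurable_lipschitz n k (F : 'rV[R]_n -> 'rV[R]_k) (L : R) :
  (forall x y, eucl (F x - F y) <= L * eucl (x - y)) ->
  measurable_fun [set: Rn R n] (F : Rn R n -> Rn R k).
Proof.
move=> hF; apply: (@measurability _ _ (Rn R n) (Rn R k) _ _ (@open 'rV[R]_k)) => //.
move=> _ [B oB <-]; rewrite setTI; apply: measurable_open.
apply/open_euclP => x Bx; have [r r0 hr] := (open_euclP B).1 oB _ Bx.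
exists (r / (`|L| + 1)); first by rewrite divr_gt0// ltr_pwDr.
move=> y; rewrite ltr_pdivlMr ?ltr_pwDr// => h; apply: hr; apply: le_lt_trans h.
rewrite (le_trans (hF _ _))// mulrC ler_wpM2l ?eucl_ge0//.
by rewrite (le_trans (ler_norm _))// lerDl.
Qed.

End measurability.

(** * Hausdorff measure is a Borel measure *)

Section metric_outer_measure.
Local Open Scope ereal_scope.
Variables (R : realType) (T : Type) (mu : {outer_measure set T -> \bar R}).
Variable U : (set T)^nat.
Hypothesis ndU : forall k, U k `<=` U k.+1.
Hypothesis addU : forall k A B, A `<=` U k -> B `<=` ~` U k.+1 ->
  mu A + mu B <= mu (A `|` B).

Let ndU_add i j : U i `<=` U (i + j)%N.
Proof.
elim: j => [|j ih]; first by rewrite addn0.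
by rewrite addnS; exact: subset_trans ih (@ndU _).
Qed.

(* With d_j = mu (X `&` (U_{j+1} \ U_j)) and a_j = mu (X `&` U_j), separation
   gives a_j + d_{j+1} <= a_{j+2}, which telescopes to the convergence of
   the series of the d_j. *)
Lemma caratheodory_bigcup_separated : mu.-caratheodory (\bigcup_k U k).
Proof.
apply: le_caratheodory_measurable => X.
have [->|Xoo] := eqVneq (mu X) +oo; first by rewrite leey.
have Xfin A : A `<=` X -> mu A \is a fin_num.
  move=> AX; rewrite ge0_fin_numE ?outer_measure_ge0//.
  by rewrite (le_lt_trans (le_outer_measure mu _ _ AX))// ltey.
pose D j := X `&` (U j.+1 `\` U j).
pose a j := mu (X `&` U j); pose d j := mu (D j).
have d0 j : 0 <= d j by exact: outer_measure_ge0.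
have a0 j : 0 <= a j by exact: outer_measure_ge0.
have aX j : a j <= mu X by apply: le_outer_measure => x [].
have ad j : a j + d j.+1 <= a j.+2.
  apply: le_trans (_ : mu ((X `&` U j) `|` D j.+1) <= _).
    by apply: (@addU j) => [x []|x [_ []]].
  apply: le_outer_measure => x [[Xx Ux]|[Xx [Ux _]]]; split => //.
  by apply: ndU; exact: ndU.
(* Even and odd indices telescope separately, whence the two boundary terms. *)
have dsum N : \sum_(j < N) d j.+1 <= a N.+1 + a N.
  elim: N => [|N ih]; first by rewrite big_ord0 adde_ge0.
  rewrite big_ord_recr/=; apply: le_trans (leeD ih (lexx _)) _.
  by rewrite -addeA [leRHS]addeC leeD2l.
have dcvg : \sum_(j <oo) d j < +oo.
  apply: le_lt_trans (_ : d 0%N + (mu X + mu X) < +oo); last first.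
    by rewrite ltey_eq !fin_numD !Xfin//; apply: subIsetl.
  apply: lime_le; first exact: is_cvg_nneseries.
  apply: nearW => -[|N]; rewrite big_mkord; first by rewrite big_ord0 !adde_ge0// outer_measure_ge0.
  rewrite big_ord_recl leeD2l//; apply: le_trans (dsum N) _.
  exact: leeD.
have XU k : mu (X `&` \bigcup_k U k) <= a k + \sum_(k <= j <oo) d j.
  (* A point of the union outside [U k] lies in the layer through which it first enters the
     sequence, and that layer has index at least [k]. *)
  have sub : X `&` \bigcup_k U k `<=` (X `&` U k) `|` \bigcup_(n in ~` `I_k) D n.
    move=> x [Xx [n _ Un]]; have [Ukx|nUkx] := pselect (U k x); [by left|right].
    have H : exists n, `[< U n x >] by exists n; apply/asboolP.
    case: (ex_minnP H) => -[|p] /asboolP Up hp.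
      by exfalso; apply: nUkx; have := @ndU_add 0 k _ Up.
    exists p.
      move=> /= pk; apply: nUkx; have := @ndU_add p.+1 (k - p.+1) _ Up.
      by rewrite subnKC.
    split => //; split => // Upx.
    by have /hp : `[< U p x >]; [exact/asboolP|rewrite ltnn].
  apply: le_trans (le_outer_measure mu _ _ sub) _.
  apply: le_trans (outer_measureU2 mu _ _) _.
  by apply: leeD => //; exact: outer_measure_sigma_subadditive_tail.
have tail : \sum_(k <= j <oo) d j @[k --> \oo] --> 0.
  by apply: nneseries_tail_cvg.
have key k : mu (X `&` \bigcup_k U k) + mu (X `&` ~` \bigcup_k U k) <=
    mu X + \sum_(k <= j <oo) d j.
  apply: le_trans (leeD (XU k) (lexx _)) _.
  rewrite addeAC leeD2r//; apply: le_trans (_ : mu ((X `&` U k) `|` (X `&` ~` \bigcup_k U k)) <= _).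
    by apply: (@addU k) => [x []//|x [_ nU] Ux]; apply: nU; exists k.+1.
  by apply: le_outer_measure => x [[]|[]].
have lim : mu X + \sum_(k <= j <oo) d j @[k --> \oo] --> mu X + 0.
  apply: cvgeD; [|exact: cvg_cst|exact: tail].
  by apply: fin_num_adde_defr; exact: Xfin.
by rewrite -[leRHS]adde0; apply: cvge_ge lim; exact: nearW.
Qed.

End metric_outer_measure.

Section diam.
Variable R : realType.
Implicit Types n : nat.
Local Open Scope ereal_scope.

Lemma diam_ge0 n (E : set 'rV[R]_n) : 0 <= diam E.
Proof. by apply: ereal_sup_ubound; left. Qed.

Lemma diam_le n (E : set 'rV[R]_n) (d : \bar R) : 0 <= d ->
  (forall x y, E x -> E y -> (eucl (x - y))%:E <= d) -> diam E <= d.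
Proof. by move=> d0 h; apply: ge_ereal_sup => _ [->//|[x Ex] [y Ey] <-]; exact: h. Qed.

Lemma eucl_le_diam n (E : set 'rV[R]_n) x y : E x -> E y -> (eucl (x - y))%:E <= diam E.
Proof. by move=> Ex Ey; apply: ereal_sup_ubound; right; exists x => //; exists y. Qed.

Lemma diam0 n : diam (set0 : set 'rV[R]_n) = 0.
Proof. by apply/eqP; rewrite eq_le diam_ge0 andbT; exact: diam_le. Qed.

Lemma le_diam n (E F : set 'rV[R]_n) : E `<=` F -> diam E <= diam F.
Proof.
by move=> EF; apply: diam_le (diam_ge0 _) _ => x y /EF Fx /EF Fy; exact: eucl_le_diam.
Qed.

Lemma diam_image n k (F : 'rV[R]_n -> 'rV[R]_k) (L : R) (E : set 'rV[R]_n) :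
  (0 < L)%R -> (forall x y, (eucl (F x - F y) <= L * eucl (x - y))%R) ->
  diam (F @` E) <= L%:E * diam E.
Proof.
move=> L0 hF; apply: diam_le; first by rewrite mule_ge0 ?diam_ge0// lee_fin ltW.
move=> _ _ [x Ex <-] [y Ey <-].
apply: le_trans (_ : L%:E * (eucl (x - y))%:E <= _); first by rewrite -EFinM lee_fin.
by rewrite lee_pmul2l//; exact: eucl_le_diam.
Qed.

Lemma diam_fin n (E : set 'rV[R]_n) (d : R) : diam E <= d%:E -> diam E \is a fin_num.
Proof. by move=> h; rewrite ge0_fin_numE ?diam_ge0// (le_lt_trans h)// ltry. Qed.

End diam.

Section hausdorff_measure.
Variable R : realType.
Implicit Types n m : nat.
Local Open Scope ereal_scope.

Lemma ball_volume_gt0 m : (0 < ball_volume R m)%R.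
Proof.
suff: (0 < ball_volume R m)%R /\ (0 < ball_volume R m.+1)%R by case.
elim: m => [|m [h1 h2]]; first by rewrite /=.
split=> //=; rewrite mulr_gt0// divr_gt0// mulr_gt0//; exact: pi_gt0.
Qed.

(** Sets wider than [d] cost [+oo], so the mesh condition moves from the covers into the cost, and
    [hausdorff_delta] becomes an instance of [mu_ext]. *)
Definition hcost n m (d : R) (E : set 'rV[R]_n) : \bar R :=
  if diam E <= d%:E then (ball_volume R m * (fine (diam E) / 2) ^+ m)%:E else +oo.

Lemma hcost_ge0 n m d (E : set 'rV[R]_n) : 0 <= hcost m d E.
Proof.
rewrite /hcost; case: ifP => // _; rewrite lee_fin.
apply: mulr_ge0; first exact: ltW (ball_volume_gt0 _).
by rewrite exprn_ge0// divr_ge0// fine_ge0// diam_ge0.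
Qed.

(** From here on the dimension is written [m.+1]: with exponent 0 the empty set would cost 1. *)
Lemma hcost0 n m d : (0 < d)%R -> hcost m.+1 d (set0 : set 'rV[R]_n) = 0.
Proof.
by move=> d0; rewrite /hcost diam0 lee_fin ltW//= mul0r exprS mul0r mulr0.
Qed.

Lemma le_hcost n m d (E F : set 'rV[R]_n) : E `<=` F -> hcost m d E <= hcost m d F.
Proof.
move=> EF; rewrite {2}/hcost; case: ifP => Fd; last by rewrite leey.
rewrite /hcost (le_trans (le_diam EF) Fd) lee_fin ler_pM2l ?ball_volume_gt0//.
rewrite lerXn2r ?nnegrE ?divr_ge0 ?fine_ge0 ?diam_ge0// ler_pM2r ?invr_gt0//.
by rewrite fine_le ?le_diam// (@diam_fin _ _ _ d)//; exact: le_trans (le_diam EF) Fd.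
Qed.

(* Every set is declared measurable, so that [mu_ext] takes its infimum over
   arbitrary countable covers. *)
Definition fullset n := g_sigma_algebraType (@setT (set 'rV[R]_n)).

Lemma hausdorff_deltaE n m d : hausdorff_delta m.+1 d =
  mu_ext (hcost m.+1 d : set (fullset n) -> \bar R).
Proof.
apply/funext => A; apply/eqP; rewrite eq_le; apply/andP; split.
- apply: le_ereal_inf_tmp => _ [E [mE AE] <-].
  have [Ed|/existsNP[i /negP/negbTE nEd]] := pselect (forall i, diam (E i) <= d%:E).
    rewrite (eq_eseriesr (g := fun i => (ball_volume R m.+1 * (fine (diam (E i)) / 2) ^+ m.+1)%:E)).
      by apply: ereal_inf_lbound; exists E.
    by move=> i _; rewrite /hcost Ed.
  rewrite (eseries_pinfty _ (k := i)) ?leey//; last by rewrite /hcost nEd.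
  by move=> k _; rewrite -ltNye (lt_le_trans _ (hcost_ge0 _ _ _)).
- apply: le_ereal_inf_tmp => _ [E [AE Ed] <-].
  rewrite (eq_eseriesr (g := fun i => hcost m.+1 d (E i))).
    apply: ereal_inf_lbound; exists E => //; split => // i.
    exact: sub_sigma_algebra.
  by move=> i _; rewrite /hcost Ed.
Qed.

Lemma hausdorff_delta0 n m d : (0 < d)%R -> hausdorff_delta m.+1 d (set0 : set 'rV[R]_n) = 0.
Proof.
by move=> d0; rewrite hausdorff_deltaE; apply: mu_ext0; [exact: hcost0|exact: hcost_ge0].
Qed.

Lemma hausdorff_delta_ge0 n m d (A : set 'rV[R]_n) : 0 <= hausdorff_delta m.+1 d A.
Proof. by rewrite hausdorff_deltaE; apply: mu_ext_ge0; exact: hcost_ge0. Qed.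

Lemma le_hausdorff_delta n m d (A B : set 'rV[R]_n) : A `<=` B ->
  hausdorff_delta m.+1 d A <= hausdorff_delta m.+1 d B.
Proof. by move=> AB; rewrite hausdorff_deltaE; exact: le_mu_ext. Qed.

Lemma hausdorff_delta_sigma_subadditive n m d :
  sigma_subadditive (hausdorff_delta m.+1 d : set 'rV[R]_n -> _).
Proof.
rewrite hausdorff_deltaE => F.
exact: (@mu_ext_sigma_subadditive _ (fullset n) R (hcost m.+1 d) (@hcost_ge0 n _ _) F).
Qed.

Lemma hausdorff_delta_le_hcost n m d (E : set 'rV[R]_n) : (0 < d)%R ->
  hausdorff_delta m.+1 d E <= hcost m.+1 d E.
Proof.
move=> d0; rewrite hausdorff_deltaE.
apply: ereal_inf_lbound; exists (fun i => if i == 0%N then E : set (fullset n) else set0).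
  by split=> [[|i]|x Ex]; [exact: sub_sigma_algebra|exact: sub_sigma_algebra|exists 0%N].
rewrite nneseries_recl//; last by move=> *; exact: hcost_ge0.
by rewrite eseries_cond/= eseries0 ?adde0// => -[|]//= k _ _; exact: hcost0.
Qed.

Lemma hausdorff_delta_le n m d (A : set 'rV[R]_n) : (0 < d)%R ->
  hausdorff_delta m d A <= hausdorff m A.
Proof. by move=> d0; apply: ereal_sup_ubound; exists d. Qed.

Lemma hausdorff_le n m (A : set 'rV[R]_n) (c : \bar R) :
  (forall d, (0 < d)%R -> hausdorff_delta m d A <= c) -> hausdorff m A <= c.
Proof. by move=> h; apply: ge_ereal_sup => _ [d d0 <-]; exact: h. Qed.

Lemma hausdorff_set0 n m : hausdorff m.+1 (set0 : set 'rV[R]_n) = 0.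
Proof.
apply/eqP; rewrite eq_le; apply/andP; split.
  by apply: hausdorff_le => d d0; rewrite hausdorff_delta0.
by apply: le_trans (hausdorff_delta_le _ _ (@ltr01 R)); rewrite hausdorff_delta0.
Qed.

Lemma hausdorff_ge0 n m (A : set 'rV[R]_n) : 0 <= hausdorff m.+1 A.
Proof.
by apply: le_trans (hausdorff_delta_le _ _ (@ltr01 R)); exact: hausdorff_delta_ge0.
Qed.

Lemma le_hausdorff n m : {homo (hausdorff m.+1 : set 'rV[R]_n -> _) : A B / A `<=` B >-> A <= B}.
Proof.
move=> A B AB; apply: hausdorff_le => d d0.
exact: le_trans (le_hausdorff_delta _ _ AB) (hausdorff_delta_le _ _ d0).
Qed.

Lemma hausdorff_sigma_subadditive n m :
  sigma_subadditive (hausdorff m.+1 : set 'rV[R]_n -> _).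
Proof.
move=> F; apply: hausdorff_le => d d0.
apply: le_trans (@hausdorff_delta_sigma_subadditive n m d F) _.
apply: lee_nneseries => [i _ _|i _]; first exact: hausdorff_delta_ge0.
exact: hausdorff_delta_le.
Qed.

HB.instance Definition _ n m := isOuterMeasure.Build R 'rV[R]_n (@hausdorff R n m.+1)
  (hausdorff_set0 n m) (@hausdorff_ge0 n m) (@le_hausdorff n m)
  (@hausdorff_sigma_subadditive n m).

End hausdorff_measure.

Section hausdorff_borel.
Variable R : realType.
Implicit Types n m : nat.
Local Open Scope ereal_scope.

Lemma hausdorff_delta_anti n m (d d' : R) (A : set 'rV[R]_n) : (d <= d')%R ->
  hausdorff_delta m.+1 d' A <= hausdorff_delta m.+1 d A.
Proof.
move=> dd'; rewrite !hausdorff_deltaE.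
apply: le_ereal_inf_tmp => _ [E EA <-].
apply: (@le_trans _ _ (\sum_(k <oo) hcost m.+1 d' (E k))).
  by apply: ereal_inf_lbound; exists E.
apply: lee_nneseries => [i _ _|i _]; first exact: hcost_ge0.
rewrite /hcost; case: (boolP (_ <= d%:E)) => h; last by rewrite leey.
by rewrite (le_trans h)// lee_fin.
Qed.

(** A set of diameter at most d < r cannot meet both [A] and [B], so each member of a cover of the
    union pays for one of the two only. *)
Lemma hausdorff_delta_metric n m (A B : set 'rV[R]_n) (r d : R) : (0 < d < r)%R ->
  (forall a b, A a -> B b -> (r <= eucl (a - b))%R) ->
  hausdorff_delta m.+1 d A + hausdorff_delta m.+1 d B <= hausdorff_delta m.+1 d (A `|` B).
Proof.
move=> /andP[d0 dr] hr; rewrite !hausdorff_deltaE.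
apply: le_ereal_inf_tmp => _ [E [mE ABE] <-].
have sub (X : set 'rV[R]_n) : X `<=` A `|` B ->
    mu_ext (hcost m.+1 d : set (fullset R n) -> _) X <=
    \sum_(i <oo) hcost m.+1 d (E i `&` X).
  move=> XAB; apply: ereal_inf_lbound; exists (fun i => E i `&` X) => //; split.
    by move=> i; exact: sub_sigma_algebra.
  by move=> x Xx; have [i _ Eix] := ABE _ (XAB _ Xx); exists i.
apply: le_trans (leeD (sub A (@subsetUl _ _ _)) (sub B (@subsetUr _ _ _))) _.
have h0 (X : nat -> set 'rV[R]_n) i : (0 <= i)%N -> true -> 0 <= hcost m.+1 d (X i).
  by move=> _ _; exact: hcost_ge0.
rewrite -nneseriesD; [|exact: (h0 (fun i => E i `&` A))|exact: (h0 (fun i => E i `&` B))].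
apply: lee_nneseries => [i _ _|i _]; first by apply: adde_ge0; exact: hcost_ge0.
have [Ed|] := boolP (diam (E i) <= d%:E); last first.
  by rewrite {3}/hcost => /negbTE ->; rewrite leey.
have [->|/set0P[a [Ea Aa]]] := eqVneq (E i `&` A) set0.
  rewrite [X in X + _](_ : _ = 0) ?add0e; last exact: hcost0.
  by apply: le_hcost; exact: subIsetl.
have [->|/set0P[b [Eb Bb]]] := eqVneq (E i `&` B) set0.
  rewrite [X in _ + X](_ : _ = 0) ?adde0; last exact: hcost0.
  by apply: le_hcost; exact: subIsetl.
have := le_trans (eucl_le_diam Ea Eb) Ed; rewrite lee_fin => /le_lt_trans/(_ dr).
by rewrite ltNge hr.
Qed.

Lemma hausdorff_metric n m (A B : set 'rV[R]_n) (r : R) : (0 < r)%R ->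
  (forall a b, A a -> B b -> (r <= eucl (a - b))%R) ->
  hausdorff m.+1 A + hausdorff m.+1 B <= hausdorff m.+1 (A `|` B).
Proof.
move=> r0 hr; set c := leRHS.
have [->|coo] := eqVneq c +oo; first by rewrite leey.
have fin (X : \bar R) : 0 <= X -> X <= c -> X \is a fin_num.
  by move=> X0 Xc; rewrite ge0_fin_numE// (le_lt_trans Xc)// ltey.
(* The scales for [A] and [B] are independent, so that the two suprema can be taken one after the
   other; a common smaller scale below [r] serves both. *)
have key d1 d2 : (0 < d1)%R -> (0 < d2)%R ->
    hausdorff_delta m.+1 d1 A + hausdorff_delta m.+1 d2 B <= c.
  move=> d10 d20; pose d : R := Num.min (r / 2)%R (Num.min d1 d2).
  have d0 : (0 < d)%R by rewrite !lt_min d10 d20 divr_gt0.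
  have dr : (d < r)%R.
    by rewrite gt_min ltr_pdivrMr// mulr_natr mulr2n ltrDl r0.
  apply: (@le_trans _ _ (hausdorff_delta m.+1 d A + hausdorff_delta m.+1 d B)).
    by apply: leeD; apply: hausdorff_delta_anti; rewrite !ge_min lexx ?orbT.
  apply: le_trans (hausdorff_delta_le _ _ d0).
  by apply: (@hausdorff_delta_metric _ _ _ _ r); rewrite ?d0.
have Hc (X : set 'rV[R]_n) : X `<=` A `|` B -> hausdorff m.+1 X \is a fin_num.
  by move=> XAB; apply: fin; [exact: hausdorff_ge0|exact: le_hausdorff].
have Hdc d (X : set 'rV[R]_n) : (0 < d)%R -> X `<=` A `|` B ->
    hausdorff_delta m.+1 d X \is a fin_num.
  move=> d0 XAB; apply: fin; first exact: hausdorff_delta_ge0.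
  exact: le_trans (hausdorff_delta_le _ _ d0) (le_hausdorff m XAB).
have sA : A `<=` A `|` B by exact: subsetUl.
have sB : B `<=` A `|` B by exact: subsetUr.
rewrite -leeBrDr ?Hc//; apply: hausdorff_le => d1 d10.
rewrite leeBrDr ?Hc// addeC -leeBrDr ?Hdc//; apply: hausdorff_le => d2 d20.
by rewrite leeBrDr ?Hdc// addeC; exact: key.
Qed.

(** The complement of [C] is exhausted by the sets of points at distance at least 1/(k+1) from [C].
    Each of them keeps the distance 1/(k+1) - 1/(k+2) from the complement of the next, as
    [caratheodory_bigcup_separated] requires. *)
Lemma closed_caratheodory n m (C : set 'rV[R]_n) : closed C ->
  (@hausdorff R n m.+1).-caratheodory C.
Proof.
move=> cC; rewrite -(setCK C); apply: caratheodory_measurable_setC.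
pose U k := [set x : 'rV[R]_n | forall c, C c -> (k.+1%:R^-1 <= eucl (x - c))%R].
have -> : ~` C = \bigcup_k U k.
  apply/seteqP; split=> [x nCx|x [k _ Ux] Cx]; last first.
    by have := Ux _ Cx; rewrite subrr eucl0 leNgt invr_gt0 ltr0Sn.
  have [r r0 hr] := (open_euclP (~` C)).1 (closed_openC cC) _ nCx.
  exists (Num.truncn r^-1) => // c Cc; rewrite leNgt; apply/negP => h.
  apply: (hr c) => //; rewrite eucl_sym (lt_le_trans h)//.
  by rewrite invf_ple ?posrE ?ltr0Sn// ltW// truncnS_gt.
apply: caratheodory_bigcup_separated => [k x Ux c Cc|k A B AU BU].
  by apply: le_trans (Ux _ Cc); rewrite lef_pV2 ?posrE ?ltr0Sn// ler_nat.
apply: (@hausdorff_metric _ _ _ _ (k.+1%:R^-1 - k.+2%:R^-1)%R).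
  by rewrite subr_gt0 ltf_pV2 ?posrE ?ltr0Sn// ltr_nat.
move=> a b /AU Ua /BU /existsNP[c /not_implyP[Cc /negP]]; rewrite -ltNge => h.
rewrite lerBlDr (le_trans (Ua _ Cc))// (le_trans (ler_eucl_distD b a c))//.
by rewrite lerD2l ltW.
Qed.

Lemma measurable_caratheodory n m (A : set (Rn R n)) : measurable A ->
  (@hausdorff R n m.+1).-caratheodory A.
Proof.
apply: smallest_sub => [|B oB].
  split; first exact: caratheodory_measurable_set0.
    by move=> B mB; rewrite setTD; exact: caratheodory_measurable_setC.
  exact: caratheodory_measurable_bigcup.
rewrite -(setCK B); apply: caratheodory_measurable_setC.
by apply: closed_caratheodory; exact: open_closedC.
Qed.

Lemma hausdorff_sigma_additive n m :
  semi_sigma_additive (@hausdorff R n m.+1 : set (Rn R n) -> _).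
Proof.
move=> F mF tF mUF.
apply: (@caratheodory_measure_sigma_additive R 'rV[R]_n (@hausdorff R n m.+1)) => //.
  by move=> i; exact: measurable_caratheodory.
exact: measurable_caratheodory.
Qed.

HB.instance Definition _ n m := isMeasure.Build _ (Rn R n) R (@hausdorff R n m.+1)
  (@hausdorff_set0 R n m) (@hausdorff_ge0 R n m) (@hausdorff_sigma_additive n m).

(** The images of a cover of mesh d / L form a cover of mesh d, each diameter growing by a factor of
    at most L. *)
Lemma hausdorff_lipschitz n k m (F : 'rV[R]_n -> 'rV[R]_k) (L : R) (A : set 'rV[R]_n) :
  (0 < L)%R -> (forall x y, (eucl (F x - F y) <= L * eucl (x - y))%R) ->
  hausdorff m.+1 (F @` A) <= (L ^+ m.+1)%:E * hausdorff m.+1 A.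
Proof.
move=> L0 hF; apply: hausdorff_le => d d0.
have dL0 : (0 < d / L)%R by rewrite divr_gt0.
apply: (@le_trans _ _ ((L ^+ m.+1)%:E * hausdorff_delta m.+1 (d / L) A)); last first.
  by rewrite lee_pmul2l ?lte_fin ?exprn_gt0//; exact: hausdorff_delta_le.
rewrite !hausdorff_deltaE -lee_pdivrMl ?exprn_gt0//.
apply: le_ereal_inf_tmp => _ [E [mE AE] <-].
rewrite lee_pdivrMl ?exprn_gt0// -nneseriesZl; last by move=> *; exact: hcost_ge0.
apply: (@le_trans _ _ (\sum_(i <oo) hcost m.+1 d (F @` (E i)))).
  apply: ereal_inf_lbound; exists (fun i => F @` (E i)) => //; split.
    by move=> i; exact: sub_sigma_algebra.
  by move=> _ [x /AE[i _ Eix] <-]; exists i => //; exists x.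
apply: lee_nneseries => [i _ _|i _]; first exact: hcost_ge0.
rewrite {2}/hcost; case: ifPn => h; last by rewrite gt0_muley ?leey// lte_fin exprn_gt0.
have DF := diam_image (E i) L0 hF.
have DE := diam_fin h.
have DFd : diam (F @` E i) <= d%:E.
  apply: (le_trans DF); rewrite -(fineK DE) -EFinM lee_fin.
  by move: h; rewrite -{1}(fineK DE) lee_fin ler_pdivlMr// mulrC.
rewrite /hcost DFd lee_fin mulrCA ler_pM2l ?ball_volume_gt0//.
rewrite -exprMn lerXn2r ?nnegrE ?mulr_ge0 ?divr_ge0 ?fine_ge0 ?diam_ge0 ?(ltW L0)//.
rewrite mulrA ler_pM2r ?invr_gt0//.
by move: DF; rewrite -{1}(fineK (diam_fin DFd)) -{1}(fineK DE) -EFinM lee_fin.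
Qed.

End hausdorff_borel.

(** * Orthogonal projections and lattice points *)

Section projections.
Variable R : realType.
Implicit Types n m : nat.

(** The cofactors along row [k] do not involve that row, so they are those of the identity matrix.
    This is the form of Cramer's rule used in [proj_factor]. *)
Lemma det_row_substitution m (M : 'M[R]_m) (k : 'I_m) :
  (forall i j, i != k -> M i j = (i == j)%:R) -> \det M = M k k.
Proof.
move=> hM; rewrite (expand_det_row _ k).
have cof j : cofactor M k j = (j == k)%:R.
  have -> : cofactor M k j = cofactor 1%:M k j.
    rewrite /cofactor; congr (_ * \det _); apply/matrixP => a b.
    by rewrite !mxE hM ?mxE// eq_sym neq_lift.
  have := mul_mx_adj (1%:M : 'M[R]_m); rewrite det1 mul1mx => /matrixP/(_ j k).
  by rewrite !mxE.
by rewrite (bigD1 k)//= cof eqxx mulr1 big1 ?addr0// => j /negbTE jk; rewrite cof jk mulr0.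
Qed.

(** With P = L Q of full rank, L Q L Q = L Q; cancelling L on the left and Q on the right leaves Q L
    = 1. *)
Lemma idempotent_base n (P : 'M[R]_n) : P *m P = P ->
  row_base P *m col_base P = 1%:M.
Proof.
move=> PP; have /row_freeP[B RB] := row_base_free P.
have /row_fullP[D DL] := col_base_full P.
have gen r (L : 'M[R]_(n, r)) (Q : 'M[R]_(r, n)) B' D' : Q *m B' = 1%:M -> D' *m L = 1%:M ->
    (L *m Q) *m (L *m Q) = L *m Q -> Q *m L = 1%:M.
  move=> QB DL' /(congr1 (fun X => D' *m X *m B')).
  by rewrite !mulmxA DL' mul1mx -!mulmxA QB mulmx1.
by apply: gen RB DL _; rewrite mulmx_base.
Qed.

(** This turns the rank condition into a polynomial one in the entries, from which [grassmannian] is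
    seen to be measurable. *)
Lemma mxtrace_idempotent n (P : 'M[R]_n) : P *m P = P -> \tr P = (\rank P)%:R.
Proof.
move=> PP; rewrite -{1}(mulmx_base P) mxtrace_mulC idempotent_base//.
by rewrite mxtrace_scalar.
Qed.

(** The diagonal entry P_ii is the sum of the squares of row i. It thus dominates its own square,
    hence is at most 1, and it dominates the square of every entry of the row. *)
Lemma proj_coef_le1 n (P : 'M[R]_n) : P^T = P -> P *m P = P ->
  forall i j, `|P i j| <= 1.
Proof.
move=> PT PP i j.
have E : P i i = \sum_k P i k ^+ 2.
  rewrite -{1}PP mxE; apply: eq_bigr => k _; rewrite expr2.
  by rewrite -{2}PT mxE.
have sq k : P i k ^+ 2 <= P i i.
  by rewrite E (bigD1 k)//= lerDl sumr_ge0// => l _; exact: sqr_ge0.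
have Pii1 : P i i <= 1.
  have := sq i; have : 0 <= P i i by rewrite E sumr_ge0// => l _; exact: sqr_ge0.
  rewrite le_eqVlt => /predU1P[<-//|Pi0].
  by rewrite expr2 -{3}(mulr1 (P i i)) ler_pM2l.
have := le_trans (sq j) Pii1.
by rewrite -real_normK ?num_real// -{1}(expr1n R 2) ler_sqr ?nnegrE.
Qed.

(* The rows [s] carry an m x m minor of maximal modulus of a basis of the
   column space; by Cramer's rule every other row is a combination of them
   with coefficients in [-1, 1]. *)
Lemma proj_factor n (P : 'M[R]_n) : P *m P = P ->
  exists (s : 'I_(\rank P) -> 'I_n) (A : 'M[R]_(n, \rank P)),
  [/\ injective s, rowsub s A = 1%:M, P = A *m rowsub s P, P *m A = A &
      forall i j, `|A i j| <= 1].
Proof.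
move=> PP; set m := \rank P; pose L := col_base P.
pose F (s : {ffun 'I_m -> 'I_n}) := `|\det (rowsub s L)|.
pose s0 := [ffun i => fullrankfun (col_base_full P) i].
have [s _ smax] := @arg_maxP _ _ _ s0 xpredT F isT.
have Fs : 0 < F s.
  apply: lt_le_trans (smax s0 isT); rewrite normr_gt0 -unitfE -unitmxE.
  rewrite (_ : rowsub _ _ = rowsub (fullrankfun (col_base_full P)) L).
    exact: fullrowsub_unit.
  by apply/matrixP => i j; rewrite !mxE ffunE.
have su : rowsub s L \in unitmx by rewrite unitmxE unitfE -normr_gt0.
pose A := L *m invmx (rowsub s L).
have sA : rowsub s A = 1%:M by rewrite -mul_rowsub_mx mulmxV.
have PL : P *m L = L.
  by rewrite -[X in X *m _](mulmx_base P) -mulmxA idempotent_base// mulmx1.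
have AL : L = A *m rowsub s L by rewrite -mulmxA mulVmx// mulmx1.
exists s, A; split => //.
- move=> i j sij; apply/eqP; have /matrixP sAE := sA.
  have := sAE i j; have := sAE j j; rewrite !mxE sij eqxx => ->.
  by case: eqP => // _ /eqP; rewrite oner_eq0.
- by rewrite -[LHS](mulmx_base P) -/L [X in X *m _]AL -mulmxA mul_rowsub_mx mulmx_base.
- by rewrite /A mulmxA PL.
(* Exchanging row [k] of the minor for row [i] of [L] multiplies its determinant by [A i k], and the
   modulus was maximal. *)
move=> i k; pose s' := [ffun l => if l == k then i else s l].
have E : rowsub s' L = rowsub s' A *m rowsub s L by rewrite mul_rowsub_mx -AL.
have : F s' <= F s by exact: smax.
rewrite /F E det_mulmx normrM ger_pMl// (det_row_substitution (k := k)) => [|a b ak].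
  by rewrite mxE ffunE eqxx.
rewrite mxE ffunE (negbTE ak); move: sA => /matrixP/(_ a b).
by rewrite !mxE.
Qed.

End projections.

(** * Counting lattice points that a projection nearly annihilates *)

Section lattice_count.
Variable R : realType.
Implicit Types n m : nat.

Lemma mulmx_bound p q (x : 'rV[R]_p) (M : 'M[R]_(p, q)) (b : R) :
  (forall i, `|x ord0 i| <= b) -> (forall i j, `|M i j| <= 1) ->
  forall j, `|(x *m M) ord0 j| <= p%:R * b.
Proof.
move=> xb M1 j; rewrite mxE (le_trans (ler_norm_sum _ _ _))//.
apply: (@le_trans _ _ (\sum_(i < p) b)).
  apply: ler_sum => i _; rewrite normrM -[leRHS]mulr1.
  by apply: ler_pM; rewrite ?xb ?M1.
by rewrite sumr_const card_ord mulr_natl.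
Qed.

Lemma eqn_mod_small (M a b : nat) : (0 < M)%N -> `|a%:R - b%:R| < M%:R :> R ->
  a = b %[mod M] -> a = b.
Proof.
move=> M0; wlog ab : a b / (b <= a)%N.
  move=> h; case: (leqP b a) => [ba|/ltnW ab]; first exact: h.
  by rewrite distrC => /h{}h /esym/h{}h; rewrite h.
rewrite -natrB// ger0_norm// ltr_nat => abM /eqP; rewrite eqn_mod_dvd// => Mab.
apply/eqP; rewrite eqn_leq ab andbT -subn_eq0.
by case: posnP Mab => [->|ab0] //; rewrite gtnNdvd.
Qed.

Lemma card_codomC n m (s : 'I_m -> 'I_n) : injective s ->
  #|[predC codom s]| = (n - m)%N.
Proof.
move=> sinj; have := cardC (mem (codom s)); rewrite card_codom// !card_ord => E.
by rewrite -[X in (X - m)%N]E addKn.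
Qed.

Lemma codom_coef n m (s : 'I_m -> 'I_n) (A : 'M[R]_(n, m)) (d : 'I_n -> R) :
  injective s -> rowsub s A = 1%:M -> (forall i, i \notin codom s -> d i = 0) ->
  forall k, \sum_i d i * A i k = d (s k).
Proof.
move=> sinj sA d0 k; rewrite (bigD1 (s k))//= big1 => [|i isk].
  by move: sA => /matrixP/(_ k k); rewrite !mxE eqxx => ->; rewrite addr0 mulr1.
have [/codomP[l il]|/d0->] := boolP (i \in codom s); last by rewrite mul0r.
move: sA isk => /matrixP/(_ l k); rewrite il !mxE => ->.
by rewrite (inj_eq sinj) => /negbTE ->; rewrite mulr0.
Qed.

(** A point is determined by its coordinates off [s] together with the residues mod [M] of those on
    [s]. If two points share these data, their difference is supported on [s], where [A] is the
    identity, so its coordinates are both divisible by [M] and smaller than [M] in modulus. *)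
Lemma card_lattice_near n m (s : 'I_m -> 'I_n) (A : 'M[R]_(n, m)) (N M : nat) :
  injective s -> rowsub s A = 1%:M -> (0 < M)%N ->
  (#|[set w : {ffun 'I_n -> 'I_N.+1} |
      [forall k, (`|\sum_i (w i)%:R * A i k| < M%:R / 2 :> R)%R]]%SET| <=
   N.+1 ^ (n - m) * M ^ m)%N.
Proof.
move=> sinj sA M0; case: M M0 => // M _; set S := [set _ | _]%SET.
pose off (w : {ffun 'I_n -> 'I_N.+1}) := [ffun i => if i \in codom s then ord0 else w i].
pose res (w : {ffun 'I_n -> 'I_N.+1}) : {ffun 'I_m -> 'I_M.+1} :=
  [ffun k => inord (w (s k) %% M.+1)].
pose T w := (off w, res w).
have Tinj : {in S &, injective T}.
  move=> w w'; rewrite !inE => /forallP wS /forallP w'S [/ffunP eoff /ffunP eres].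
  have eqoff i : i \notin codom s -> w i = w' i.
    by move=> /negbTE ni; have := eoff i; rewrite !ffunE ni.
  have eqmod k : w (s k) = w' (s k) %[mod M.+1].
    have := eres k; rewrite !ffunE => /(congr1 val)/=.
    by rewrite !inordK ?ltn_pmod.
  have eqs k : w (s k) = w' (s k) :> nat.
    apply: (@eqn_mod_small M.+1) => //.
    pose d i : R := (w i)%:R - (w' i)%:R.
    have -> : (w (s k))%:R - (w' (s k))%:R = \sum_i d i * A i k.
      by rewrite (codom_coef sinj sA)// => i /eqoff wi; rewrite /d wi subrr.
    have -> : \sum_i d i * A i k = \sum_i (w i)%:R * A i k - \sum_i (w' i)%:R * A i k.
      by rewrite -sumrB; apply: eq_bigr => i _; rewrite mulrBl.
    apply: le_lt_trans (ler_normB _ _) _.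
    by rewrite [ltRHS](splitr M.+1%:R) ltrD.
  apply/ffunP => i; have [/codomP[k ->]|/eqoff//] := boolP (i \in codom s).
  by apply: val_inj; exact: eqs.
rewrite -(card_in_imset Tinj).
have -> : (N.+1 ^ (n - m) * M.+1 ^ m)%N =
    #|[predX pffun_on (ord0 : 'I_N.+1) [predC codom s] predT & {ffun 'I_m -> 'I_M.+1}]|.
  by rewrite cardX card_pffun_on card_codomC// card_ffun !card_ord.
apply: subset_leq_card; apply/fintype.subsetP => _ /imsetP[w wS ->].
rewrite !inE andbT; apply/pffun_onP; split => //.
apply/fintype.subsetP => i; rewrite !inE ffunE.
by case: ifP => //; rewrite eqxx.
Qed.

(** The coordinates off [s] range freely over the N integers from N to 2N - 1; those on [s] are then
    chosen by rounding so that the product with [A] falls into [0, 1]. All coordinates are at most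
    2nN + 1 = L in modulus, and since m < n one of the free ones makes the point long. *)
Lemma card_lattice_kernel n m (s : 'I_m -> 'I_n) (A : 'M[R]_(n, m)) (N L : nat) :
  (m < n)%N -> injective s -> rowsub s A = 1%:M -> (forall i j, `|A i j| <= 1) ->
  (0 < N)%N -> L = (n * (N * 2)).+1 ->
  (N ^ (n - m) <= #|[set w : {ffun 'I_n -> 'I_(L * 2).+1} |
      [forall k, (`|\sum_i ((w i)%:R - L%:R) * A i k| <= 1 :> R)%R] &&
      [exists i, (N%:R <= `|(w i)%:R - L%:R| :> R)%R]]%SET|)%N.
Proof.
move=> mn sinj sA A1; case: N => [//|N] _ hL; set S := [set _ | _]%SET.
pose out (u : {ffun 'I_n -> 'I_N.+1}) i : R :=
  if i \in codom s then 0 else (N.+1 + u i)%:R.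
pose y u i : int :=
  if [pick k | s k == i] is Some k then - Num.floor (\sum_i out u i * A i k)
  else (N.+1 + u i)%:Z.
have yin u k : y u (s k) = - Num.floor (\sum_i out u i * A i k).
  rewrite /y; case: pickP => [k' /eqP/sinj->//|/(_ k)].
  by rewrite eqxx.
have yout u i : i \notin codom s -> y u i = (N.+1 + u i)%:Z.
  move=> ni; rewrite /y; case: pickP => // k /eqP ki.
  by move: ni; rewrite -ki codom_f.
have outb u i : `|out u i| <= (N.+1 * 2)%:R.
  rewrite /out; case: ifP => _; first by rewrite normr0.
  by rewrite ger0_norm// ler_nat muln2 -addnn leq_add2l ltnW.
have yb u i : `|y u i| <= L%:Z.
  have [/codomP[k ->]|ni] := boolP (i \in codom s).
    rewrite yin normrN.
    have xb : `|\sum_i out u i * A i k| <= (n * (N.+1 * 2))%:R.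
      have := @mulmx_bound n m (\row_i out u i) A (N.+1 * 2)%:R _ A1 k.
      rewrite mxE -natrM => H; apply: le_trans (H _).
        by rewrite le_eqVlt; apply/orP; left; apply/eqP; congr `|_|; apply: eq_bigr => j _; rewrite mxE.
      by move=> j; rewrite mxE.
    move: xb; set x := \sum_(i < n) _; rewrite ler_norml => /andP[xl xu].
    rewrite ler_norml; apply/andP; split.
      by rewrite floor_ge_int hL -addn1 PoszD rmorphN rmorphD /= -!pmulrn; lra.
    by rewrite -(ler_int R) (le_trans (real_floor_le (num_real _)))// (le_trans xu)// -pmulrn ler_nat hL.
  rewrite yout// ler_norml lez_nat hL (le_trans _ (_ : 0 <= _)) ?oppr_le0//=.
  apply: leqW; apply: (@leq_trans (N.+1 * 2)); last by rewrite leq_pmull// (leq_ltn_trans _ mn).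
  by rewrite muln2 -addnn leq_add2l ltnW.
(* The shift by [L] stores the integers from -L to L as ordinals below 2L + 1. *)
pose w u : {ffun 'I_n -> 'I_(L * 2).+1} := [ffun i => inord (absz (y u i + L%:Z))].
have wE u i : (w u i)%:R - L%:R = (y u i)%:~R :> R.
  have := yb u i; rewrite ler_norml => /andP[yl yu].
  have y0 : 0 <= y u i + L%:Z by rewrite -lerBlDr sub0r.
  rewrite ffunE inordK; last by rewrite ltnS -lez_nat gez0_abs// muln2 -addnn PoszD lerD2r.
  by rewrite pmulrn gez0_abs// rmorphD/= -pmulrn addrK.
pose D := [set u in pffun_on (ord0 : 'I_N.+1) [predC codom s] predT]%SET.
have winj : {in D &, injective w}.
  move=> u v; rewrite !inE => /pffun_onP[/fintype.subsetP Du _] /pffun_onP[/fintype.subsetP Dv _] uv.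
  apply/ffunP => i; have [ic|ni] := boolP (i \in codom s).
    have z (t : {ffun 'I_n -> 'I_N.+1}) :
        {subset ord0.-support t <= [predC codom s]} -> t i = ord0.
      move=> h; apply/eqP; apply: contraT => ti.
      by have := h i; rewrite !inE ti ic => /(_ isT).
    by rewrite z// z.
  apply: val_inj; have := wE u i; rewrite uv wE => /intr_inj; rewrite !yout// => -[/eqP].
  by rewrite eqn_add2l => /eqP.
have cD : #|D| = (N.+1 ^ (n - m))%N.
  by rewrite cardsE card_pffun_on card_codomC// card_ord.
rewrite -cD -(card_in_imset winj); apply: subset_leq_card.
apply/fintype.subsetP => _ /imsetP[u uD ->]; rewrite inE; apply/andP; split.
  apply/forallP => k; under eq_bigr do rewrite wE.
  pose d i : R := if i \in codom s then (y u i)%:~R else 0.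
  have -> : \sum_i (y u i)%:~R * A i k = \sum_i d i * A i k + \sum_i out u i * A i k.
    rewrite -big_split/=; apply: eq_bigr => i _; rewrite -mulrDl /d /out.
    by case: ifPn => [_|/yout->]; rewrite ?addr0 ?add0r.
  rewrite (codom_coef sinj sA); last by move=> i /negbTE ni; rewrite /d ni.
  rewrite /d codom_f yin; set x := \sum_i _.
  rewrite rmorphN/= addrC ger0_norm ?subr_ge0 ?real_floor_le ?num_real//.
  by rewrite lerBlDl ltW// -[X in _ + X]/(1%:~R) -rmorphD/= floorD1_gt.
have [i ni] : exists i, i \notin codom s.
  apply/existsP; rewrite -negb_forall; apply/negP => /forallP h.
  have := card_codomC sinj; rewrite (@eq_card0 _ [predC codom s]).
    by move/esym/eqP; rewrite subn_eq0 leqNgt mn.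
  by move=> i; rewrite !inE h.
apply/existsP; exists i; rewrite wE yout// -pmulrn ger0_norm// ler_nat.
exact: leq_addr.
Qed.

End lattice_count.

(** * The invariant measure of the projections that shorten a vector *)

Lemma measurable_lt d (T : measurableType d) (R : realType) (f : T -> R) (c : R) :
  measurable_fun setT f -> measurable [set t | f t < c].
Proof.
move=> mf; have := mf measurableT `]-oo, c[%classic (measurable_itv _).
by rewrite setTI; congr measurable; apply/seteqP; split=> t; rewrite /= in_itv.
Qed.

Section grassmannian.
Variable R : realType.
Implicit Types n m : nat.

(** [Q] is the reflection that exchanges [z] and [z']. It makes the invariance of [gamma] usable for
    any two vectors of equal length. *)
Lemma householder n (z z' : 'rV[R]_n) : eucl z = eucl z' ->
  exists2 Q : 'M[R]_n, Q *m Q^T = 1%:M & z *m Q^T = z'.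
Proof.
move=> zz'; have [->|zNz'] := eqVneq z z'.
  by exists 1%:M; rewrite trmx1 mulmx1.
pose w := z - z'; pose a := (w *m w^T) ord0 ord0; pose c := 2 / a.
have wa : w *m w^T = a%:M by rewrite [LHS]mx11_scalar.
have a0 : a != 0.
  by rewrite /a -eucl_rowP sqrf_eq0 eucl_eq0 subr_eq0.
have ca : c * a = 2 by rewrite /c divfK.
pose Q : 'M[R]_n := 1%:M - c *: (w^T *m w).
have QT : Q^T = Q.
  by rewrite /Q linearB/= trmx1 linearZ/= trmx_mul trmxK.
(* Equal lengths enter here: the inner product of z with z - z' is half of the squared length of z -
   z'. *)
have zw : z *m w^T = (a / 2)%:M.
  rewrite [LHS]mx11_scalar; congr (_%:M).
  have e1 : (z *m z^T) ord0 ord0 = (z' *m z'^T) ord0 ord0 by rewrite -!eucl_rowP zz'.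
  have e2 : (z *m z'^T) ord0 ord0 = (z' *m z^T) ord0 ord0.
    by rewrite -[in LHS](trmxK z) -trmx_mul mxE.
  rewrite /a /w linearB/= mulmxBl !mulmxBr !mxE.
  move: e1 e2; rewrite !mxE; lra.
have XX : (c *: (w^T *m w)) *m (c *: (w^T *m w)) = 2 *: (c *: (w^T *m w)).
  rewrite -scalemxAl -scalemxAr mulmxA -(mulmxA w^T) wa mul_mx_scalar -scalemxAl.
  by rewrite !scalerA; congr (_ *: _); rewrite ca mulrC.
exists Q; rewrite QT.
  move: XX; rewrite /Q; set X := c *: _ => XX.
  rewrite mulmxBl mul1mx mulmxBr mulmx1 XX scaler_nat mulr2n opprB addrCA.
  by rewrite -[1%:M - X - X]addrA -opprD addrC subrK.
rewrite /Q mulmxBr mulmx1 -scalemxAr mulmxA zw mul_scalar_mx scalerA.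
by rewrite mulrA ca divff ?pnatr_eq0// scale1r /w opprB addrC subrK.
Qed.

Lemma eucl_orthogonal n (x : 'rV[R]_n) (Q : 'M[R]_n) : Q *m Q^T = 1%:M ->
  eucl (x *m Q) = eucl x.
Proof.
move=> QQ; apply/eqP; rewrite -(@eqrXn2 _ 2) ?eucl_ge0//.
by rewrite !eucl_rowP trmx_mul mulmxA -(mulmxA x) QQ mulmx1.
Qed.

(** One nonnegative term for each defining equation of a projection of rank [m], with the trace in
    place of the rank; measurable in the entries. *)
Definition grassmann_defect n m (P : 'M[R]_n) : R :=
  \sum_i \sum_j `|P i j - P j i| + \sum_i \sum_j `|(P *m P) i j - P i j| +
  `|\tr P - m%:R|.

Lemma grassmannianE n m : grassmannian m = [set P : 'M[R]_n | grassmann_defect m P = 0].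
Proof.
rewrite /grassmann_defect.
have s0 (F : 'I_n -> 'I_n -> R) : 0 <= \sum_i \sum_j `|F i j|.
  by apply: sumr_ge0 => i _; apply: sumr_ge0.
have sP (F : 'I_n -> 'I_n -> R) : \sum_i \sum_j `|F i j| = 0 -> forall i j, F i j = 0.
  move=> /psumr_eq0P h i j; have {}h : forall i, true -> \sum_j `|F i j| = 0.
    by apply: h => k _; exact: sumr_ge0.
  have /psumr_eq0P {}h := h i isT; apply/eqP; rewrite -normr_eq0; apply/eqP.
  exact: h.
apply/seteqP; split=> P /=.
  move=> [PT [PP Pm]]; rewrite mxtrace_idempotent// Pm subrr normr0 addr0.
  rewrite !big1 ?addr0// => i _; rewrite big1// => j _.
    by rewrite PP subrr normr0.
  by rewrite -{2}PT mxE subrr normr0.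
move=> /eqP; rewrite !paddr_eq0 ?addr_ge0 ?s0// => /andP[/andP[/eqP h1 /eqP h2] /eqP h3].
have PP : P *m P = P.
  by apply/matrixP => i j; apply/eqP; rewrite -subr_eq0 (sP _ h2).
split; last split => //.
  apply/matrixP => i j; rewrite mxE; apply/eqP.
  by rewrite -subr_eq0 (sP _ h1).
move: h3; rewrite mxtrace_idempotent// => /normr0_eq0/eqP.
by rewrite subr_eq0 eqr_nat => /eqP.
Qed.

Lemma measurable_grassmannian n m : measurable (grassmannian m : set (Mn R n)).
Proof.
rewrite grassmannianE.
have mf : measurable_fun [set: Mn R n] (@grassmann_defect n m : Mn R n -> R).
  apply: measurable_funD; first apply: measurable_funD.
  - apply: measurable_sum => i; apply: measurable_sum => j.
    apply: measurableT_comp => //.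
    by apply: measurable_funB; exact: measurable_mat.
  - apply: measurable_sum => i; apply: measurable_sum => j.
    apply: measurableT_comp => //; apply: measurable_funB; last exact: measurable_mat.
    under eq_fun do rewrite mxE.
    by apply: measurable_sum => k; apply: measurable_funM; exact: measurable_mat.
  - apply: measurableT_comp => //; apply: measurable_funB => //.
    by apply: measurable_sum => k; exact: measurable_mat.
have := mf measurableT [set 0] (measurable_set1 _).
by rewrite setTI.
Qed.

Lemma grassmannian_factor n m (P : 'M[R]_n) : grassmannian m P ->
  exists (s : 'I_m -> 'I_n) (A : 'M[R]_(n, m)),
  [/\ injective s, rowsub s A = 1%:M, P = A *m rowsub s P, P *m A = A &
      forall i j, `|A i j| <= 1].
Proof. by move=> [_ [PP <-]]; exact: proj_factor. Qed.

End grassmannian.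

Section double_counting.
Local Open Scope ereal_scope.
Context d (T : measurableType d) (R : realType) (mu : {measure set T -> \bar R}).
Variables (I : finType) (A : I -> set T) (G : set T).
Hypotheses (mA : forall i, measurable (A i)) (mG : measurable G).

Let sum_measureE : \sum_i mu (A i `&` G) =
  \int[mu]_(t in G) (#|[set i | t \in A i]%SET|%:R)%:E.
Proof.
under eq_bigr do rewrite -integral_indic//.
rewrite -ge0_integral_sum//; last first.
  by move=> i; apply/measurable_EFinP; exact: measurable_indic.
apply: eq_integral => t _; rewrite sumEFin; congr EFin.
rewrite -sum1_card natr_sum [RHS]big_mkcond/=; apply: eq_bigr => i _.
by rewrite inE indicE; case: ifP.
Qed.

Let measurable_count : measurable_fun G (fun t => (#|[set i | t \in A i]%SET|%:R)%:E : \bar R).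
Proof.
apply/measurable_EFinP.
apply: (eq_measurable_fun (fun t => \sum_i (\1_(A i) t : R))%R).
  move=> t _; rewrite -sum1_card natr_sum [RHS]big_mkcond/=; apply: eq_bigr => i _.
  by rewrite inE indicE; case: ifP.
by apply: measurable_sum => i; exact: measurable_indic.
Qed.

Lemma sum_measure_le_count (K : nat) :
  (forall t, G t -> (#|[set i | t \in A i]%SET| <= K)%N) ->
  \sum_i mu (A i `&` G) <= K%:R%:E * mu G.
Proof.
move=> h; rewrite sum_measureE -integral_cst//; apply: ge0_le_integral => //.
by move=> t Gt; rewrite lee_fin ler_nat h.
Qed.

Lemma sum_measure_ge_count (K : nat) :
  (forall t, G t -> (K <= #|[set i | t \in A i]%SET|)%N) ->
  K%:R%:E * mu G <= \sum_i mu (A i `&` G).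
Proof.
move=> h; rewrite sum_measureE -integral_cst//; apply: ge0_le_integral => //.
  by move=> t Gt; rewrite lee_fin.
by move=> t Gt; rewrite lee_fin ler_nat h.
Qed.

End double_counting.

Section gamma_bounds.
Local Open Scope ereal_scope.
Variables (R : realType) (n m : nat) (gamma : {measure set Mn R n -> \bar R}).
Hypothesis gammaP : grassmann_measure m gamma.

Definition proj_lt (z : 'rV[R]_n) (d : R) : set (Mn R n) :=
  [set P | (eucl (z *m (P : 'M[R]_n)) < d)%R].

Lemma measurable_proj_lt z d : measurable (proj_lt z d).
Proof.
apply: measurable_lt; apply: measurable_eucl => i.
under eq_fun do rewrite mxE.
by apply: measurable_sum => k; apply: measurable_funM => //; exact: measurable_mat.
Qed.
Hint Resolve measurable_proj_lt : core.

Let mG : measurable (grassmannian m : set (Mn R n)).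
Proof. exact: measurable_grassmannian. Qed.

Lemma gamma_le1 (A : set (Mn R n)) : measurable A -> gamma A <= 1.
Proof.
by move=> mA; have [<- _] := gammaP; apply: le_measure => //; rewrite ?inE//; exact: measurableT.
Qed.

Lemma gamma_grassmannianI (A : set (Mn R n)) : measurable A ->
  gamma (A `&` grassmannian m) = gamma A.
Proof.
move=> mA; have [g1 [gG _]] := gammaP.
have E : gamma setT = gamma (setT `\` grassmannian m) + gamma (setT `&` grassmannian m).
  by rewrite -measureDI.
have gC : gamma (setT `\` grassmannian m) = 0.
  move: E; rewrite setTI g1 gG; case: (gamma _) => [r| |]//= [].
  by move=> /eqP; rewrite -subr_eq subrr => /eqP <-.
rewrite (measureDI gamma mA mG) [X in X + _](_ : _ = 0) ?add0e//.
apply/eqP; rewrite eq_le measure_ge0 andbT -gC; apply: le_measure; rewrite ?inE//.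
- exact: measurableD.
- exact: measurableD.
- by apply: setSD.
Qed.

(** Only the ratio of [d] to the length of [z] matters: scale [z] to the length of [z'], reflect it
    onto [z'], and conjugate the projections by that reflection. *)
Lemma gamma_proj_lt_anti (z z' : 'rV[R]_n) (d d' : R) :
  (z != 0)%R -> (0 < d')%R -> (d * eucl z' <= d' * eucl z)%R ->
  gamma (proj_lt z d) <= gamma (proj_lt z' d').
Proof.
move=> z0 d'0 h; have [g1 [gG ginv]] := gammaP.
have [->|z'0] := eqVneq z' 0%R.
  rewrite [X in _ <= gamma X](_ : _ = setT) ?g1 ?gamma_le1//.
  by apply/seteqP; split=> P //= _; rewrite /proj_lt/= mul0mx eucl0.
pose a := (eucl z' / eucl z)%R.
have a0 : (0 < a)%R by rewrite divr_gt0 ?eucl_gt0.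
have [Q QQ Qz] : exists2 Q : 'M[R]_n, Q *m Q^T = 1%:M & (a *: z) *m Q^T = z'.
  by apply: householder; rewrite euclZ gtr0_norm// /a divfK// eucl_eq0.
have conjE (P : 'M[R]_n) : (a * eucl (z *m (Q^T *m P *m Q)))%R = eucl (z' *m P).
  by rewrite !mulmxA (eucl_orthogonal _ QQ) -Qz -!scalemxAl euclZ gtr0_norm.
rewrite -(ginv Q QQ (proj_lt z d))//.
apply: le_measure; rewrite ?inE//.
  rewrite (_ : _ @^-1` _ = proj_lt z' (a * d)%R) //.
  by apply/seteqP; split => P; rewrite /proj_lt/= -conjE ltr_pM2l.
move=> P; rewrite /proj_lt/= -(ltr_pM2l a0) conjE => /lt_le_trans; apply.
by rewrite /a mulrAC ler_pdivrMr ?eucl_gt0// mulrC.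
Qed.

Hypothesis mn : (m < n)%N.

Let n0 : (0 < n)%N. Proof. exact: leq_ltn_trans mn. Qed.

(* Double counting: by invariance each of the [N.+1 ^ n] lattice points [w] of a
   cube satisfies [gamma (proj_lt z d) <= gamma (proj_lt w n)], while a fixed
   [P] maps only about [N ^ (n - m)] of them into a bounded region. *)
Lemma gamma_proj_lt_lattice (z : 'rV[R]_n) (d : R) (N : nat) :
  (z != 0)%R -> (0 < d)%R -> (d * N.+1%:R <= eucl z)%R ->
  (N.+1 ^ n)%:R%:E * gamma (proj_lt z d) <= (N.+1 ^ (n - m) * (2 * n * n) ^ m)%:R%:E.
Proof.
move=> z0 d0 dN; have [g1 [gG ginv]] := gammaP.
pose v (w : {ffun 'I_n -> 'I_N.+1}) : 'rV[R]_n := (\row_i (w i)%:R)%R.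
apply: (@le_trans _ _ (\sum_w gamma (proj_lt (v w) n%:R `&` grassmannian m))).
  have -> : (N.+1 ^ n)%:R%:E * gamma (proj_lt z d) =
      \sum_(w : {ffun 'I_n -> 'I_N.+1}) gamma (proj_lt z d).
    by rewrite sumr_const mule_natl card_ffun !card_ord.
  apply: lee_sum => w _; rewrite gamma_grassmannianI//.
  apply: gamma_proj_lt_anti; rewrite ?ltr0n//.
  apply: (@le_trans _ _ (d * (n%:R * N.+1%:R))%R).
    rewrite ler_pM2l//; apply: ler_eucl_bound => i; rewrite mxE ger0_norm//.
    by rewrite ler_nat ltnW.
  by rewrite mulrCA ler_pM2l// ltr0n.
rewrite -[leRHS]mule1 -gG; apply: sum_measure_le_count => // P GP.
have [s [A [sinj sA PE PA A1]]] := grassmannian_factor GP.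
(* The modulus 2n^2 arises because |wP| < n and the entries of [A] are at most 1, so each coordinate
   of wPA stays below n^2, half of it. *)
apply: leq_trans (card_lattice_near N sinj sA (_ : 0 < 2 * n * n)%N); last first.
  by rewrite !muln_gt0 n0.
apply: subset_leq_card; apply/fintype.subsetP => w; rewrite !inE => vw.
apply/forallP => k.
have -> : (\sum_i (w i)%:R * A i k = (v w *m P *m A) ord0 k)%R.
  by rewrite -mulmxA PA mxE; apply: eq_bigr => i _; rewrite mxE.
have := mulmx_bound (ler_coord_eucl (v w *m P)) A1 k.
move=> /le_lt_trans; apply.
rewrite -mulnA mulnC natrM mulfK ?pnatr_eq0// natrM ltr_pM2l ?ltr0n//.
Qed.

(** For d < |z|, take N to be the integer part of |z| / d. With M = 2n^2 the lattice count gives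
    N^(n-m) M^m / N^n = (M / N)^m, and 1/N is at most 2d / |z|. *)
Lemma gamma_proj_lt_upper : exists2 C : R, (0 < C)%R &
  forall (z : 'rV[R]_n) (d : R), (z != 0)%R -> (0 < d)%R ->
    gamma (proj_lt z d) <= (C * (d / eucl z) ^+ m)%:E.
Proof.
pose M : R := (2 * n * n)%:R; have M1 : (1 <= M)%R by rewrite ler1n !muln_gt0 n0.
exists ((2 * M) ^+ m)%R; first by rewrite exprn_gt0// mulr_gt0// (lt_le_trans _ M1).
move=> z d z0 d0; have ez : (0 < eucl z)%R by rewrite eucl_gt0.
have [zd|dz] := leP (eucl z) d.
  apply: (le_trans (gamma_le1 _)) => //; rewrite lee_fin -exprMn exprn_ege1//.
  rewrite mulrA ler_pdivlMr// mul1r; apply: (le_trans zd).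
  by rewrite ler_peMl ?(ltW d0)//; move: M1; lra.
pose N := Num.truncn (eucl z / d).
have /andP[Nl Nu] : (N%:R <= eucl z / d < N.+1%:R)%R.
  by apply: truncn_itv; rewrite divr_ge0 ?ltW.
have N0 : (0 < N)%N by rewrite truncn_gt0 ler_pdivlMr// mul1r ltW.
have := @gamma_proj_lt_lattice z d N.-1 z0 d0; rewrite prednK// => /(_ _)/wrap[].
  by move: Nl; rewrite ler_pdivlMr// mulrC.
rewrite -lee_pdivlMl; last by rewrite ltr0n expn_gt0 N0.
move=> /le_trans; apply; rewrite -EFinM lee_fin natrM !natrX -/M.
rewrite mulrA [X in (X * _ <= _)%R](_ : _ = N%:R ^- m)%R; last first.
  have e : (n = m + (n - m))%N by rewrite subnKC// ltnW.
  by rewrite [in X in (X * _)%R]e exprD invfM -mulrA mulVf ?mulr1// expf_neq0// pnatr_eq0 -lt0n.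
rewrite -exprVn -!exprMn lerXn2r ?nnegrE ?mulr_ge0 ?invr_ge0 ?(ltW d0) ?(ltW ez) ?(le_trans ler01 M1)//.
have iN : (N%:R^-1 <= 2 * (d / eucl z))%R.
  rewrite -div1r ler_pdivrMr ?ltr0n// mulrA mulrAC ler_pdivlMr// mul1r.
  move: Nu; rewrite ltr_pdivrMr// => /ltW/le_trans; apply; rewrite mulrAC ler_pM2r//.
  by rewrite -natrM ler_nat mul2n -addnn -addn1 leq_add2l.
rewrite [leRHS](_ : _ = 2 * (d / eucl z) * M)%R; last by rewrite mulrAC.
by rewrite ler_pM2r ?(lt_le_trans _ M1).
Qed.

(** The reverse count: every projection nearly annihilates at least N^(n-m) points of the cube
    [-L, L]^n that are longer than N or of that length. Shorter points give no comparison with [z]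
    and receive the empty set. The bound nm + 1 comes from P = B (rowsub s P) with entries at most
    1: if the coordinates of vB are at most 1, those of vP are at most m, so |vP| <= nm. *)
Lemma gamma_proj_lt_lattice_ge (z : 'rV[R]_n) (d : R) (N L : nat) :
  (z != 0)%R -> (0 < d)%R -> (0 < N)%N -> L = (n * (N * 2)).+1 ->
  ((n * m).+1%:R * eucl z <= d * N%:R)%R ->
  (N ^ (n - m))%:R%:E <= ((L * 2).+1 ^ n)%:R%:E * gamma (proj_lt z d).
Proof.
move=> z0 d0 N0 hL dN; have [g1 [gG ginv]] := gammaP.
pose v (w : {ffun 'I_n -> 'I_(L * 2).+1}) : 'rV[R]_n := (\row_i ((w i)%:R - L%:R))%R.
pose far (w : {ffun 'I_n -> 'I_(L * 2).+1}) := [exists i, (N%:R <= `|(w i)%:R - L%:R| :> R)%R].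
pose A (w : {ffun 'I_n -> 'I_(L * 2).+1}) : set (Mn R n) :=
  if far w then proj_lt (v w) (n * m).+1%:R else set0.
have mA w : measurable (A w) by rewrite /A; case: ifP.
apply: (@le_trans _ _ (\sum_w gamma (A w `&` grassmannian m))); last first.
  have -> : ((L * 2).+1 ^ n)%:R%:E * gamma (proj_lt z d) =
      \sum_(w : {ffun 'I_n -> 'I_(L * 2).+1}) gamma (proj_lt z d).
    by rewrite sumr_const mule_natl card_ffun !card_ord.
  apply: lee_sum => w _; rewrite gamma_grassmannianI// /A; case: ifPn => [fw|_]; last first.
    by rewrite measure0.
  have vN : (N%:R <= eucl (v w))%R.
    move/existsP : fw => [i /le_trans]; apply.
    by have := ler_coord_eucl (v w) i; rewrite mxE.
  apply: gamma_proj_lt_anti => //.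
    by rewrite -eucl_eq0 gt_eqF// (lt_le_trans _ vN)// ltr0n.
  by rewrite (le_trans dN)// ler_pM2l.
rewrite -[leLHS]mule1 -gG; apply: sum_measure_ge_count => // P GP.
have [s [B [sinj sB PE PB B1]]] := grassmannian_factor GP.
have [PT [PP Pm]] := GP.
apply: leq_trans (card_lattice_kernel mn sinj sB B1 N0 hL) _.
apply: subset_leq_card; apply/fintype.subsetP => w; rewrite !inE => /andP[/forallP h fw].
rewrite /A /far fw /proj_lt/=.
have zB k : (`|(v w *m B) ord0 k| <= 1)%R.
  by rewrite mxE; apply: le_trans (h k); rewrite le_eqVlt; apply/orP; left; apply/eqP;
    congr (`| _ |)%R; apply: eq_bigr => i _; rewrite mxE.
apply: (@le_lt_trans _ _ (n%:R * (m%:R * 1))%R); last by rewrite mulr1 -natrM ltr_nat.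
apply: ler_eucl_bound => j; rewrite PE mulmxA.
apply: mulmx_bound => // a b; rewrite mxE; exact: proj_coef_le1.
Qed.

(** With e = nm + 1 and N just above e|z| / d, the count gives N^(n-m) / (7nN)^n = (7n)^(-n) N^(-m),
    and N is at most 2e|z| / d. *)
Lemma gamma_proj_lt_lower : exists2 c : R, (0 < c)%R &
  forall (z : 'rV[R]_n) (d : R), (z != 0)%R -> (0 < d)%R -> (d <= eucl z)%R ->
    (c * (d / eucl z) ^+ m)%:E <= gamma (proj_lt z d).
Proof.
pose e : R := (n * m).+1%:R; have e1 : (1 <= e)%R by rewrite ler1n.
have e0 : (0 < e)%R by rewrite ltr0n.
exists ((7 * n%:R) ^- n * (2 * e) ^- m)%R.
  by rewrite mulr_gt0// invr_gt0 exprn_gt0// mulr_gt0// ltr0n.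
move=> z d z0 d0 dz; have ez : (0 < eucl z)%R by rewrite eucl_gt0.
pose x : R := (e * eucl z / d)%R.
have x1 : (1 <= x)%R.
  by rewrite ler_pdivlMr// mul1r (le_trans dz)// ler_peMl ?(ltW ez).
pose N := (Num.truncn x).+1.
have xN : (x <= N%:R)%R by rewrite ltW// truncnS_gt.
have Nx : (N%:R <= 2 * x)%R.
  rewrite -[in leLHS]natr1 mulr_natl mulr2n lerD//.
  by rewrite truncn_le// (le_trans ler01 x1).
have N0 : (0 < N)%N by [].
have := @gamma_proj_lt_lattice_ge z d N _ z0 d0 N0 erefl.
move=> /(_ _)/wrap[]; first by move: xN; rewrite ler_pdivrMr// (mulrC N%:R)%R.
set L := (n * (N * 2)).+1 => H.
(* Here 2L + 1 = 4nN + 3, and nN >= 1. *)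
have L7 : (((L * 2).+1)%:R <= 7 * n%:R * N%:R :> R)%R.
  rewrite -!natrM ler_nat /L.
  have : (0 < n * N)%N by rewrite muln_gt0 n0.
  by rewrite -(mulnA 7%N) (mulnA n N); clear; move: (n * N)%N => y; lia.
have P0 : (0 < ((L * 2).+1 ^ n)%:R :> R)%R by rewrite ltr0n expn_gt0.
move: H; rewrite -lee_pdivrMl// => /(le_trans _); apply.
rewrite -EFinM lee_fin.
have N0R : (0 < N%:R :> R)%R by rewrite ltr0n.
apply: (@le_trans _ _ ((7 * n%:R * N%:R) ^- n * (N ^ (n - m))%:R)%R); last first.
  rewrite ler_pM2r ?ltr0n ?expn_gt0 ?N0// lef_pV2 ?posrE ?exprn_gt0 ?mulr_gt0 ?ltr0n ?expn_gt0//.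
  by rewrite natrX lerXn2r ?nnegrE ?mulr_ge0.
rewrite [in leRHS]exprMn invfM -!mulrA ler_pM2l ?invr_gt0 ?exprn_gt0 ?mulr_gt0 ?ltr0n//.
have -> : (N%:R ^- n * (N ^ (n - m))%:R = N%:R ^- m :> R)%R.
  have en : (n = m + (n - m))%N by rewrite subnKC// ltnW.
  rewrite [in X in (X * _)%R]en exprD invfM natrX -mulrA mulVf ?mulr1//.
  by rewrite expf_neq0// gt_eqF.
rewrite -!exprVn -exprMn lerXn2r ?nnegrE ?mulr_ge0 ?invr_ge0 ?mulr_ge0 ?(ltW e0) ?(ltW d0) ?(ltW ez)//.
rewrite [leLHS](_ : _ = (2 * x)^-1)%R; last first.
  by rewrite /x -invf_div -!invfM; congr (_^-1)%R; rewrite !mulrA.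
have x0 : (0 < x)%R by exact: lt_le_trans x1.
by rewrite lef_pV2 ?posrE // mulr_gt0.
Qed.

End gamma_bounds.

(** * Nearby pairs in a subspace *)

Section hausdorff_subspace.
Variable R : realType.
Implicit Types n m : nat.
Local Open Scope ereal_scope.

Lemma sigma_subadditive_fin (T : Type) (mu : set T -> \bar R) (I : finType) (F : I -> set T) :
  mu set0 = 0 -> (forall A, 0 <= mu A) -> sigma_subadditive mu ->
  mu (\bigcup_i F i) <= \sum_i mu (F i).
Proof.
move=> mu0 mu_ge0 sub; pose G j := nth set0 [seq F i | i <- enum I] j.
have -> : \bigcup_i F i = \bigcup_j G j.
  apply/seteqP; split=> x [i _ Fx].
    exists (index i (enum I)) => //.
    by rewrite /G (nth_map i) ?index_mem ?mem_enum// nth_index// mem_enum.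
  move: Fx; rewrite /G; have [ij|ij] := ltnP i (size (enum I)).
    have [j _] : exists j : I, True by case: (enum I) ij => // j; exists j.
    by rewrite (nth_map j)// => Fx; exists (nth j (enum I) i).
  by rewrite nth_default// size_map.
apply: (le_trans (sub G)); rewrite (nneseries_split _ (size (enum I))); last first.
  by move=> k _; exact: mu_ge0.
rewrite [X in _ + X]eseries0 ?adde0; last first.
  by move=> k nk _; rewrite /G nth_default// size_map.
have -> : \sum_i mu (F i) = \sum_(A <- [seq F i | i <- enum I]) mu A.
  by rewrite big_map big_enum.
by rewrite (big_nth set0) size_map.
Qed.

Definition eball n (u : 'rV[R]_n) (d : R) : set (Rn R n) :=
  [set v | (eucl ((v : 'rV[R]_n) - u) < d)%R].

Lemma measurable_eball n (u : 'rV[R]_n) d : measurable (eball u d).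
Proof. by apply: measurable_open; exact: open_eucl_ball. Qed.

(** Cut the cube into N^(m+1) cubes of diameter at most (m+1)/N <= d; their total cost does not
    depend on N. *)
Lemma hausdorff_cube m :
  hausdorff m.+1 [set x : 'rV[R]_m.+1 | forall i, (0 <= x ord0 i < 1)%R] <=
  (ball_volume R m.+1 * (m.+1%:R / 2) ^+ m.+1)%:E.
Proof.
apply: hausdorff_le => d d0.
pose N := (Num.truncn (m.+1%:R / d : R)%R).+1.
have N0 : (0 < N%:R :> R)%R by rewrite ltr0n.
have Nd : (m.+1%:R / N%:R <= d)%R.
  by rewrite ler_pdivrMr// mulrC -ler_pdivrMr// ltW// truncnS_gt.
pose Q (w : {ffun 'I_m.+1 -> 'I_N}) := [set x : 'rV[R]_m.+1 |
  forall i, ((w i)%:R <= N%:R * x ord0 i < (w i).+1%:R)%R].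
have DQ w : diam (Q w) <= (m.+1%:R / N%:R)%:E.
  apply: diam_le => [|x y Qx Qy]; rewrite lee_fin ?divr_ge0//.
  apply: ler_eucl_bound => i; rewrite !mxE.
  have /andP[x1 x2] := Qx i; have /andP[y1 y2] := Qy i.
  rewrite -(ler_pM2l N0) divff ?gt_eqF// -{1}(gtr0_norm N0) -normrM mulrBr.
  by rewrite ler_norml; move: x1 x2 y1 y2; rewrite -!natr1; lra.
have cQ w : hausdorff_delta m.+1 d (Q w) <=
    (ball_volume R m.+1 * (m.+1%:R / 2) ^+ m.+1 * N%:R ^- m.+1)%:E.
  apply: le_trans (hausdorff_delta_le_hcost _ _ d0) _.
  have Dd : diam (Q w) <= d%:E by rewrite (le_trans (DQ w)).
  rewrite /hcost Dd lee_fin -mulrA ler_pM2l ?ball_volume_gt0// -exprVn -exprMn.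
  rewrite lerXn2r ?nnegrE ?mulr_ge0 ?invr_ge0 ?fine_ge0 ?diam_ge0//.
  by rewrite mulrAC ler_pM2r ?invr_gt0// -lee_fin fineK// (diam_fin Dd).
apply: (@le_trans _ _ (hausdorff_delta m.+1 d (\bigcup_w Q w))).
  apply: le_hausdorff_delta => x Qx.
  have tr i : (Num.truncn (N%:R * x ord0 i)%R < N)%N.
    have /andP[x0 x1] := Qx i; rewrite truncn_lt_nat ?mulr_ge0//.
    by rewrite -[ltRHS]mulr1 ltr_pM2l.
  exists [ffun i => Ordinal (tr i)] => // i; rewrite ffunE /=.
  by apply: truncn_itv; have /andP[x0 x1] := Qx i; rewrite mulr_ge0.
apply: le_trans (@sigma_subadditive_fin _ _ _ _ _ _ _) _.
- exact: hausdorff_delta0.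
- exact: hausdorff_delta_ge0.
- exact: hausdorff_delta_sigma_subadditive.
apply: (le_trans (lee_sum _ (fun w _ => cQ w))).
rewrite sumEFin lee_fin sumr_const card_ffun !card_ord -[leLHS]mulr_natr natrX divfK//.
by rewrite expf_neq0// gt_eqF.
Qed.

Lemma measurable_subspace n (P : 'M[R]_n) : measurable (subspace_of P).
Proof.
have mf : measurable_fun [set: Rn R n]
    (fun v : Rn R n => eucl ((v : 'rV[R]_n) *m P - v)).
  apply: measurable_eucl => i; under eq_fun do rewrite !mxE.
  apply: measurable_funB; last exact: measurable_row.
  by apply: measurable_sum => k; apply: measurable_funM => //; exact: measurable_row.
have := mf measurableT [set 0%R] (measurable_set1 _).
rewrite setTI; congr measurable; apply/seteqP; split=> v /=.
  by move=> /eqP; rewrite eucl_eq0 subr_eq0 => /eqP.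
by move=> ->; rewrite subrr eucl0.
Qed.

(** The map v -> u + d v of V and its inverse are Lipschitz with constants d and 1/d; each yields
    one inequality. Exact scaling is thus available although the measure of the unit ball is not. *)
Lemma hausdorff_eball_scale n m (P : 'M[R]_n) (u : 'rV[R]_n) (d : R) :
  subspace_of P u -> (0 < d)%R ->
  hausdorff m.+1 (eball u d `&` subspace_of P) =
  (d ^+ m.+1)%:E * hausdorff m.+1 (eball 0%R 1%R `&` subspace_of P).
Proof.
move=> Vu d0; apply/eqP; rewrite eq_le; apply/andP; split.
- have H : hausdorff m.+1 ((fun v => u + d *: v)%R @` (eball 0%R 1%R `&` subspace_of P)) <=
      (d ^+ m.+1)%:E * hausdorff m.+1 (eball 0%R 1%R `&` subspace_of P).
    apply: hausdorff_lipschitz => // x y.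
    by rewrite opprD addrACA subrr add0r -scalerBr euclZ gtr0_norm.
  apply: le_trans H.
  apply: le_hausdorff => v [vu Vv]; exists (d^-1 *: (v - u))%R; last first.
    by rewrite scalerA divff ?gt_eqF// scale1r addrC subrK.
  split; rewrite /eball/= ?subr0 ?euclZ ?gtr0_norm ?invr_gt0//.
    by rewrite mulrC ltr_pdivrMr// mul1r.
  by rewrite /subspace_of/= -scalemxAl mulmxBl Vv Vu.
- rewrite -lee_pdivlMl ?exprn_gt0// -exprVn.
  have H : hausdorff m.+1 ((fun v => d^-1 *: (v - u))%R @` (eball u d `&` subspace_of P)) <=
      (d^-1 ^+ m.+1)%:E * hausdorff m.+1 (eball u d `&` subspace_of P).
    apply: hausdorff_lipschitz => [|x y]; first by rewrite invr_gt0.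
    by rewrite -scalerBr euclZ gtr0_norm ?invr_gt0// opprB addrA subrK.
  apply: le_trans H.
  apply: le_hausdorff => v [v1 Vv]; exists (u + d *: v)%R; last first.
    by rewrite addrC addKr scalerA mulVf ?gt_eqF// scale1r.
  split; rewrite /eball/=.
    rewrite addrC addKr euclZ gtr0_norm// -[ltRHS]mulr1 ltr_pM2l//.
    by move: v1; rewrite /eball/= subr0.
  by rewrite /subspace_of/= mulmxDl -scalemxAl Vv Vu.
Qed.

(** The unit ball of V lies in the image of the unit cube under [F], which recentres and stretches
    the cube to coordinates in (-n, n) and applies the rows [s] of P. The entries of P are at most
    1, so the Lipschitz constant is uniform in P, as the averaging over [gamma] requires. *)
Lemma hausdorff_eball_bound n m : exists2 C : R, (0 < C)%R &
  forall P : 'M[R]_n, grassmannian m.+1 P ->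
    hausdorff m.+1 (eball 0%R 1%R `&` subspace_of P) <= C%:E.
Proof.
pose L : R := (n%:R * 2 * (n%:R * m.+1%:R) + 1)%R.
have L0 : (0 < L)%R by rewrite ltr_wpDl// !mulr_ge0.
exists (L ^+ m.+1 * (ball_volume R m.+1 * (m.+1%:R / 2) ^+ m.+1))%R.
  by rewrite !mulr_gt0 ?exprn_gt0 ?ball_volume_gt0 ?divr_gt0.
move=> P GP; have [PT [PP _]] := GP.
have [s [A [sinj sA PE PA A1]]] := grassmannian_factor GP.
pose F (x : 'rV[R]_m.+1) : 'rV[R]_n :=
  (n%:R *: ((2 *: x - const_mx 1) *m rowsub s P))%R.
have FL x y : (eucl (F x - F y) <= L * eucl (x - y))%R.
  rewrite /F -scalerBr -mulmxBl opprB addrA subrK -scalerBr -scalemxAl scalerA.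
  rewrite euclZ ger0_norm ?mulr_ge0// /L mulrDl mul1r -mulrA.
  rewrite ler_wpDr ?eucl_ge0// ler_wpM2l ?mulr_ge0// -mulrA; apply: ler_eucl_bound.
  apply: mulmx_bound => [i|i j]; first exact: ler_coord_eucl.
  by rewrite mxE; exact: proj_coef_le1.
have n0 : (0 < n%:R :> R)%R by rewrite ltr0n (leq_ltn_trans _ (ltn_ord (s ord0))).
rewrite EFinM.
apply: le_trans (_ : _ <= (L ^+ m.+1)%:E * hausdorff m.+1 [set x : 'rV[R]_m.+1 | forall i, (0 <= x ord0 i < 1)%R]) _; last first.
  by rewrite lee_pmul2l ?lte_fin ?exprn_gt0//; exact: hausdorff_cube.
have H (Q : set 'rV[R]_m.+1) : hausdorff m.+1 (F @` Q) <= (L ^+ m.+1)%:E * hausdorff m.+1 Q.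
  by apply: hausdorff_lipschitz.
apply: le_trans (H _).
apply: le_hausdorff => v [v1 Vv]; exists (2^-1 *: (n%:R^-1 *: (v *m A) + const_mx 1))%R.
  move=> i; rewrite !mxE.
  have := mulmx_bound (ler_coord_eucl v) A1 i; rewrite mxE; set t := (\sum_j _)%R => tb.
  have : (`|n%:R^-1 * t| < 1)%R.
    rewrite normrM ger0_norm ?invr_ge0 ?ltW// mulrC ltr_pdivrMr// mul1r.
    apply: (le_lt_trans tb); rewrite -[ltRHS]mulr1 ltr_pM2l//.
    by move: v1; rewrite /eball/= subr0.
  by rewrite ltr_norml; lra.
rewrite /F scalerA divff ?pnatr_eq0// scale1r addrK -scalemxAl scalerA.
by rewrite divff ?gt_eqF// scale1r -mulmxA -PE.
Qed.

End hausdorff_subspace.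

(** * Nearby pairs split by a set, for a measure with balls of mass [kappa * d ^+ m] about the
    points of [V] *)

Section diagonal.
Variables (R : realType) (n : nat).
Local Open Scope ereal_scope.
Implicit Types (A B : set (Rn R n)) (d : R) (f : Rn R n -> R).

Definition near_diag d : set (Rn R n * Rn R n) :=
  [set z | (eucl ((z.2 : 'rV[R]_n) - z.1) < d)%R].

Lemma measurable_near_diag d : measurable (near_diag d).
Proof.
apply: measurable_lt; apply: measurable_eucl => i; under eq_fun do rewrite !mxE.
apply: measurable_funB.
  exact: (measurableT_comp (measurable_row i) (@measurable_snd _ _ (Rn R n) (Rn R n))).
exact: (measurableT_comp (measurable_row i) (@measurable_fst _ _ (Rn R n) (Rn R n))).
Qed.

Variable H : {sigma_finite_measure set Rn R n -> \bar R}.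
Variables (V : set (Rn R n)) (m : nat) (kappa : R).
Hypotheses (kappa0 : (0 < kappa)%R) (mV : measurable V) (HV : H (~` V) = 0).
Hypothesis Hball : forall u d, V u -> (0 < d)%R ->
  H (eball (u : 'rV[R]_n) d) = (kappa * d ^+ m)%:E.

Hint Resolve measurable_near_diag : core.
Hint Resolve measurable_eball : core.

Let ae_ball d f : (0 < d)%R ->
  {ae H, forall u, setT u -> (f u)%:E * H (eball (u : 'rV[R]_n) d) =
    (kappa * d ^+ m)%:E * (f u)%:E}.
Proof.
move=> d0; exists (~` V); split => //; first exact: measurableC.
by move=> u /= + Vu; apply => _; rewrite Hball// muleC.
Qed.

Let measurable_ball_integral d f : measurable_fun setT f -> (forall u, (0 <= f u)%R) ->
  measurable_fun setT (fun u : Rn R n => (f u)%:E * H (eball (u : 'rV[R]_n) d)).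
Proof.
move=> mf f0; apply: emeasurable_funM; first exact/measurable_EFinP.
rewrite (_ : (fun u => _) = H \o xsection (near_diag d)).
  exact: measurable_fun_xsection.
by apply/funext => u /=; congr (H _); rewrite /xsection; apply/seteqP; split=> v /=; rewrite inE.
Qed.

Lemma ge0_integral_near_fst d f : (0 < d)%R ->
  measurable_fun setT f -> (forall u, (0 <= f u)%R) ->
  \int[H \x H]_(z in near_diag d) (f z.1)%:E = (kappa * d ^+ m)%:E * \int[H]_u (f u)%:E.
Proof.
move=> d0 mf f0.
have mg : measurable_fun setT ((fun z : Rn R n * Rn R n => (f z.1)%:E) \_ (near_diag d)).
  apply/(measurable_restrictT _ (measurable_near_diag d)).
  apply/measurable_EFinP; apply: measurable_funTS.
  exact: (measurableT_comp mf measurable_fst).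
rewrite integral_mkcond fubini_tonelli1//; last first.
  by move=> z; rewrite erestrict_ge0// => t _; rewrite lee_fin.
rewrite -ge0_integralZl//; last 3 first.
- exact/measurable_EFinP.
- by move=> u _; rewrite lee_fin.
- by rewrite lee_fin mulr_ge0 ?exprn_ge0 ?ltW.
transitivity (\int[H]_u ((f u)%:E * H (eball (u : 'rV[R]_n) d))).
  apply: eq_integral => u _; rewrite /fubini_F -(integral_cst _ (measurable_eball _ _)).
  rewrite [RHS]integral_mkcond; apply: eq_integral => v _.
  rewrite /patch; have -> // : ((u, v) \in near_diag d) = (v \in eball (u : 'rV[R]_n) d).
  by apply/idP/idP; rewrite !inE.
apply: ge0_ae_eq_integral => //.
- exact: measurable_ball_integral.
- by apply: measurable_funeM; exact/measurable_EFinP.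
- by move=> u _; rewrite mule_ge0// lee_fin.
- by move=> u _; rewrite mule_ge0// lee_fin// mulr_ge0 ?exprn_ge0 ?ltW.
- exact: ae_ball.
Qed.

Lemma ge0_integral_near_snd d f : (0 < d)%R ->
  measurable_fun setT f -> (forall u, (0 <= f u)%R) ->
  \int[H \x H]_(z in near_diag d) (f z.2)%:E = (kappa * d ^+ m)%:E * \int[H]_u (f u)%:E.
Proof.
move=> d0 mf f0.
have mg : measurable_fun setT ((fun z : Rn R n * Rn R n => (f z.2)%:E) \_ (near_diag d)).
  apply/(measurable_restrictT _ (measurable_near_diag d)).
  apply/measurable_EFinP; apply: measurable_funTS.
  exact: (measurableT_comp mf measurable_snd).
rewrite integral_mkcond fubini_tonelli2//; last first.
  by move=> z; rewrite erestrict_ge0// => t _; rewrite lee_fin.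
rewrite -ge0_integralZl//; last 3 first.
- exact/measurable_EFinP.
- by move=> u _; rewrite lee_fin.
- by rewrite lee_fin mulr_ge0 ?exprn_ge0 ?ltW.
transitivity (\int[H]_u ((f u)%:E * H (eball (u : 'rV[R]_n) d))).
  apply: eq_integral => u _; rewrite /fubini_G -(integral_cst _ (measurable_eball _ _)).
  rewrite [RHS]integral_mkcond; apply: eq_integral => v _.
  rewrite /patch; have -> // : ((v, u) \in near_diag d) = (v \in eball (u : 'rV[R]_n) d).
  by apply/idP/idP; rewrite !inE /near_diag /eball/= eucl_sym.
apply: ge0_ae_eq_integral => //.
- exact: measurable_ball_integral.
- by apply: measurable_funeM; exact/measurable_EFinP.
- by move=> u _; rewrite mule_ge0// lee_fin.
- by move=> u _; rewrite mule_ge0// lee_fin// mulr_ge0 ?exprn_ge0 ?ltW.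
- exact: ae_ball.
Qed.

Lemma near_diag_fst d A : (0 < d)%R -> measurable A ->
  (H \x H) (near_diag d `&` [set z | A z.1]) = (kappa * d ^+ m)%:E * H A.
Proof.
move=> d0 mA; have mA1 : measurable [set z : Rn R n * Rn R n | A z.1].
  by rewrite -[X in measurable X]setTI; exact: (measurable_fst measurableT).
rewrite -[X in _ = _ * H X]setIT -(integral_indic H measurableT mA).
rewrite -(@ge0_integral_near_fst d (\1_A))//.
by rewrite setIC -[LHS]integral_indic.
Qed.

Lemma near_diag_snd d A : (0 < d)%R -> measurable A ->
  (H \x H) (near_diag d `&` [set z | A z.2]) = (kappa * d ^+ m)%:E * H A.
Proof.
move=> d0 mA; have mA1 : measurable [set z : Rn R n * Rn R n | A z.2].
  by rewrite -[X in measurable X]setTI; exact: (measurable_snd measurableT).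
rewrite -[X in _ = _ * H X]setIT -(integral_indic H measurableT mA).
rewrite -(@ge0_integral_near_snd d (\1_A))//.
by rewrite setIC -[LHS]integral_indic.
Qed.

Variable B : set (Rn R n).
Hypotheses (mB : measurable B) (HB : H B < +oo).

(** The window [B] has finite measure, so that [H] is continuous from above on its subsets. *)
Definition split_pairs A : set (Rn R n * Rn R n) :=
  (B `*` B) `&` ((A `*` ~` A) `|` (~` A `*` A)).

Lemma measurable_split_pairs A : measurable A -> measurable (split_pairs A).
Proof.
move=> mA; apply: measurableI; first exact: measurableX.
by apply: measurableU; apply: measurableX => //; exact: measurableC.
Qed.

(** The prefactor is, up to [kappa], the inverse mass of a ball of radius 1/(k+1): with it the rate
    is bounded in [k], and the question is whether it tends to 0. *)
Definition split_rate A (k : nat) : \bar R :=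
  (k.+1%:R ^+ m)%:E * (H \x H) (near_diag k.+1%:R^-1 `&` split_pairs A).

(* The sets such that few nearby pairs are separated by them form a sigma-algebra
   that contains the open sets; this stands in for a Lebesgue density theorem. *)
Definition asymptotically_unsplit A := measurable A /\
  forall e : R, (0 < e)%R -> \forall k \near \oo, split_rate A k <= e%:E.

Lemma unsplitC A : asymptotically_unsplit A -> asymptotically_unsplit (~` A).
Proof.
move=> [mA h]; split=> [|e e0]; first exact: measurableC.
by have := h e e0; rewrite /split_rate /split_pairs setCK [X in _ `&` X]setUC.
Qed.

Let le_split_rate A (S : set (Rn R n * Rn R n)) k : measurable A -> measurable S ->
  near_diag k.+1%:R^-1 `&` split_pairs A `<=` S ->
  split_rate A k <= (k.+1%:R ^+ m)%:E * (H \x H) S.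
Proof.
move=> mA mS AS; rewrite /split_rate lee_pmul2l ?lte_fin ?exprn_gt0//.
apply: le_measure; rewrite ?inE//.
by apply: measurableI => //; exact: measurable_split_pairs.
Qed.

Lemma unsplitU A A' : asymptotically_unsplit A -> asymptotically_unsplit A' ->
  asymptotically_unsplit (A `|` A').
Proof.
move=> [mA h] [mA' h']; split=> [|e e0]; first exact: measurableU.
have e2 : (0 < e / 2)%R by rewrite divr_gt0.
near=> k.
have mN C : measurable C -> measurable (near_diag k.+1%:R^-1 `&` split_pairs C).
  by move=> mC; apply: measurableI => //; exact: measurable_split_pairs.
apply: (@le_trans _ _ (split_rate A k + split_rate A' k)); last first.
  by rewrite (splitr e) EFinD leeD//; near: k; [exact: h|exact: h'].
rewrite /split_rate -ge0_muleDr//.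
apply: le_trans (le_split_rate (S := (near_diag k.+1%:R^-1 `&` split_pairs A) `|`
  (near_diag k.+1%:R^-1 `&` split_pairs A')) _ _ _) _.
- exact: measurableU.
- by apply: measurableU; exact: mN.
- move=> [u v] [/= uv [[Bu Bv] /=]].
  have [Au|nAu] := pselect (A u); have [Av|nAv] := pselect (A v).
  + by move=> [[_ h1]|[h1 _]]; exfalso; apply: h1; left.
  + by move=> _; left; split => //; split => //; left.
  + by move=> _; left; split => //; split => //; right.
  + by move=> [[[//|A'u] h1]|[h1 [//|A'v]]]; right; split => //; split => //; [left|right];
      split => //= A'x; apply: h1; right.
- by rewrite lee_pmul2l ?lte_fin ?exprn_gt0//; apply: measureU2; exact: mN.
Unshelve. all: by end_near. Qed.

Let cancel_rate k (x : \bar R) : 0 <= x ->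
  (k.+1%:R ^+ m)%:E * ((kappa * k.+1%:R^-1 ^+ m)%:E * x) = kappa%:E * x.
Proof.
move=> x0; rewrite muleA -EFinM; congr (_%:E * _).
by rewrite mulrCA -exprMn divff ?pnatr_eq0// expr1n mulr1.
Qed.

(** Replacing [A] by [C] costs only pairs with a point in [S]. The error does not depend on [k], so
    an approximation can be fixed before [k] grows. *)
Let split_rate_near A C k S : measurable A -> measurable C -> measurable S ->
  near_diag k.+1%:R^-1 `&` split_pairs A `<=` (near_diag k.+1%:R^-1 `&` split_pairs C) `|`
    ((near_diag k.+1%:R^-1 `&` [set z | S z.1]) `|` (near_diag k.+1%:R^-1 `&` [set z | S z.2])) ->
  split_rate A k <= split_rate C k + (2 * kappa)%:E * H S.
Proof.
move=> mA mC mS h.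
have d0 : (0 < k.+1%:R^-1 :> R)%R by rewrite invr_gt0.
have m0 : measurable (near_diag k.+1%:R^-1 `&` split_pairs C).
  by apply: measurableI => //; exact: measurable_split_pairs.
have m1 : measurable (near_diag k.+1%:R^-1 `&` [set z | S z.1]).
  apply: measurableI => //.
  by rewrite -[X in measurable X]setTI; exact: (measurable_fst measurableT).
have m2 : measurable (near_diag k.+1%:R^-1 `&` [set z | S z.2]).
  apply: measurableI => //.
  by rewrite -[X in measurable X]setTI; exact: (measurable_snd measurableT).
apply: le_trans (le_split_rate mA _ h) _.
  by apply: measurableU => //; exact: measurableU.
apply: (@le_trans _ _ (split_rate C k + (k.+1%:R ^+ m)%:E * ((kappa * k.+1%:R^-1 ^+ m)%:E * H S +
  (kappa * k.+1%:R^-1 ^+ m)%:E * H S))).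
  rewrite /split_rate -ge0_muleDr//; last first.
    by apply: adde_ge0; rewrite mule_ge0// lee_fin mulr_ge0 ?exprn_ge0 ?ltW.
  rewrite lee_pmul2l ?lte_fin ?exprn_gt0//.
  apply: le_trans (measureU2 _ m0 (measurableU _ _ m1 m2)) _; rewrite leeD2l//.
  apply: le_trans (measureU2 _ m1 m2) _.
  by apply: leeD; [rewrite -near_diag_fst|rewrite -near_diag_snd].
rewrite leeD2l//.
rewrite ge0_muleDr; last 2 first.
- by rewrite mule_ge0// lee_fin mulr_ge0 ?exprn_ge0 ?ltW.
- by rewrite mule_ge0// lee_fin mulr_ge0 ?exprn_ge0 ?ltW.
rewrite cancel_rate// -ge0_muleDl ?lee_fin ?(ltW kappa0)//.
by rewrite -EFinD mulr_natl mulr2n.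
Qed.

Lemma nonincreasing_small (S : nat -> set (Rn R n)) (e : R) :
  (forall k, measurable (S k)) -> (forall k, S k `<=` B) -> nonincreasing_seq S ->
  \bigcap_k S k = set0 -> (0 < e)%R ->
  \forall k \near \oo, (2 * kappa)%:E * H (S k) <= e%:E.
Proof.
move=> mS SB ndS S0 e0.
have c : H (S k) @[k --> \oo] --> 0.
  rewrite -(measure0 H) -S0; apply: nonincreasing_cvg_mu => //.
  - by rewrite (le_lt_trans _ HB)// le_measure ?inE.
  - by rewrite S0.
have e' : (0 < e / (2 * kappa))%R by rewrite divr_gt0// mulr_gt0.
have : \forall k \near \oo, H (S k) < (e / (2 * kappa))%:E.
  apply: (c [set x | x < (e / (2 * kappa))%:E]); apply: open_nbhs_nbhs.
  by split; [exact: open_ereal_lt_ereal|rewrite /= lte_fin].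
apply: filterS => k /ltW.
by rewrite EFinM muleC -lee_pdivlMl ?mulr_gt0.
Qed.

(** A nearby pair split by [O] has a point in the layer of [O] within 1/(k+1) of the complement.
    These layers, cut by [B], decrease to the empty set. The comparison set is [set0], which splits
    nothing. *)
Lemma unsplit_open (O : set 'rV[R]_n) : open O -> asymptotically_unsplit (O : set (Rn R n)).
Proof.
move=> oO; have mO : measurable (O : set (Rn R n)) by exact: measurable_open.
split=> // e e0.
pose S k : set (Rn R n) := O `&` B `&` \bigcup_(y in ~` O) eball y k.+1%:R^-1.
have mS k : measurable (S k).
  apply: measurableI; first exact: measurableI.
  by apply: measurable_open; apply: bigcup_open => y _; exact: open_eucl_ball.
have := @nonincreasing_small S e mS _ _ _ e0; move=> /(_ _ _ _)/wrap[].
- by move=> k u [[]].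
- move=> j k jk; apply/subsetPset => u [OBu [y nOy yu]]; split => //; exists y => //.
  by apply: (lt_le_trans yu); rewrite lef_pV2 ?posrE// ler_nat.
- apply/seteqP; split=> // u Su; have [[Ou _] _] := Su 0%N I.
  have [r r0 hr] := (open_euclP O).1 oO u Ou.
  have [_ [y nOy yu]] := Su (Num.truncn r^-1) I.
  apply: nOy; apply: hr; rewrite eucl_sym (lt_le_trans yu)//.
  by rewrite invf_ple ?posrE// ltW// truncnS_gt.
have W0 : split_pairs set0 = set0.
  by apply/seteqP; split=> // z [_ [[]|[]]].
apply: filterS => k; apply: le_trans.
rewrite -[leRHS]add0e [X in X + _](_ : _ = split_rate set0 k); last first.
  by rewrite /split_rate W0 setI0 measure0 mule0.
apply: split_rate_near => //.
move=> [u v] [uv [[Bu Bv] OO]]; right.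
case: OO => -[/= Ou Ov]; [left|right]; split => //; split => //.
  by exists v => //; rewrite /eball/= eucl_sym.
by exists u.
Qed.

(** Inside [B] the union exceeds a finite partial union by a set of small measure; that partial
    union is fixed before [k] is taken large. *)
Lemma unsplit_bigcup (F : nat -> set (Rn R n)) : (forall i, asymptotically_unsplit (F i)) ->
  asymptotically_unsplit (\bigcup_i F i).
Proof.
move=> hF; have mF i : measurable (F i) by have [] := hF i.
have mU : measurable (\bigcup_i F i) by exact: bigcup_measurable.
split=> // e e0.
pose G N := \big[setU/set0]_(i < N) F i.
have hG N : asymptotically_unsplit (G N).
  elim: N => [|N ih]; rewrite /G; last by rewrite big_ord_recr/=; exact: unsplitU.
  by rewrite big_ord0; apply: unsplit_open; exact: open0.
have mG N : measurable (G N) by have [] := hG N.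
pose S N := (\bigcup_i F i `\` G N) `&` B.
have mS N : measurable (S N) by apply: measurableI => //; exact: measurableD.
have e2 : (0 < e / 2)%R by rewrite divr_gt0.
have := @nonincreasing_small S (e / 2) mS _ _ _ e2; move=> /(_ _ _ _)/wrap[].
- by move=> k u [].
- move=> j k jk; apply/subsetPset => u [[Fu nGu] Bu]; split => //; split => // Gju; apply: nGu.
  by apply: subset_bigsetU Gju.
- apply/seteqP; split=> // u Su; have [[[i _ Fu] _] _] := Su 0%N I.
  have [[_ nG] _] := Su i.+1 I; apply: nG; rewrite /G big_ord_recr/=; by right.
move=> [N _ hN]; have {}hN := hN N (leqnn N).
near=> k.
apply: (@le_trans _ _ (split_rate (G N) k + (2 * kappa)%:E * H (S N))); last first.
  rewrite (splitr e) EFinD leeD//; near: k; exact: (hG N).2.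
have GU u : G N u -> (\bigcup_i F i) u by exact: bigsetU_bigcup.
apply: split_rate_near => // -[u v] [uv [[/= Bu Bv] FF]].
case: FF => -[/= Fu Fv].
- have [Gu|nGu] := pselect (G N u); [left|by right; left].
  by split => //; split => //; left; split => // /GU.
- have [Gv|nGv] := pselect (G N v); [left|by right; right].
  by split => //; split => //; right; split => // /GU.
Unshelve. all: by end_near. Qed.

Lemma measurable_unsplit A : measurable A -> asymptotically_unsplit A.
Proof.
apply: smallest_sub => [|O oO]; last exact: unsplit_open.
split; first by apply: unsplit_open; exact: open0.
  by move=> C hC; rewrite setTD; exact: unsplitC.
exact: unsplit_bigcup.
Qed.

End diagonal.

(** * The quadratic form of nearby pairs *)

Lemma near_sum_le (R : realType) (T : eqType) (r : seq T) (u : T -> (\bar R)^nat) :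
  (forall y e, (0 < e)%R -> \forall k \near \oo, (u y k <= e%:E)%E) ->
  forall e, (0 < e)%R -> \forall k \near \oo, (\sum_(y <- r) u y k <= e%:E)%E.
Proof.
move=> h; elim: r => [|y r ih] e e0; first by apply: nearW => k; rewrite big_nil lee_fin ltW.
have e2 : 0 < e / 2 by rewrite divr_gt0.
near=> k; rewrite big_cons (splitr e) EFinD; apply: leeD; near: k; [exact: h|exact: ih].
Unshelve. all: by end_near. Qed.

Section liminf.
Variable R : realType.
Implicit Types (u : (\bar R)^nat) (a : \bar R).
Local Open Scope ereal_scope.

Lemma limn_einfE u : limn_einf u = ereal_sup (range (einfs u)).
Proof. by rewrite limn_einf_lim; apply/cvg_lim => //; exact: cvg_einfs_sup. Qed.

Lemma near_le_limn_einf u a : (\forall k \near \oo, a <= u k) -> a <= limn_einf u.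
Proof.
move=> [N _ hN]; rewrite limn_einfE; apply: (@le_trans _ _ (einfs u N)).
  by apply: le_ereal_inf_tmp => _ [k /= Nk <-]; exact: hN.
by apply: ereal_sup_ubound; exists N.
Qed.

End liminf.

Section diagonal_form.
Variables (R : realType) (n : nat).
Local Open Scope ereal_scope.
Implicit Types (A B : set (Rn R n)) (d : R) (f g : Rn R n -> R).
Variable H : {sigma_finite_measure set Rn R n -> \bar R}.
Variables (V : set (Rn R n)) (m : nat) (kappa : R).
Hypotheses (kappa0 : (0 < kappa)%R) (mV : measurable V) (HV : H (~` V) = 0).
Hypothesis Hball : forall u d, V u -> (0 < d)%R ->
  H (eball (u : 'rV[R]_n) d) = (kappa * d ^+ m)%:E.
Hypothesis V0 : V (0%R : 'rV[R]_n).

Let mnear d : measurable (@near_diag R n d).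
Proof. exact: measurable_near_diag. Qed.
Hint Resolve mnear : core.

Definition diag_form f g (k : nat) : \bar R :=
  (k.+1%:R ^+ m)%:E * \int[H \x H]_(z in near_diag k.+1%:R^-1) (f z.1 * g z.2)%:E.

Let mfst f d : measurable_fun setT f ->
  measurable_fun (near_diag d) (fun z : Rn R n * Rn R n => f z.1).
Proof. by move=> mf; apply: measurable_funTS; exact: (measurableT_comp mf measurable_fst). Qed.

Let msnd f d : measurable_fun setT f ->
  measurable_fun (near_diag d) (fun z : Rn R n * Rn R n => f z.2).
Proof. by move=> mf; apply: measurable_funTS; exact: (measurableT_comp mf measurable_snd). Qed.

Let d0 k : (0 < k.+1%:R^-1 :> R)%R. Proof. by rewrite invr_gt0. Qed.

Let cancel_rate k (x : \bar R) :
  (k.+1%:R ^+ m)%:E * ((kappa * k.+1%:R^-1 ^+ m)%:E * x) = kappa%:E * x.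
Proof.
rewrite muleA -EFinM; congr (_%:E * _).
by rewrite mulrCA -exprMn divff ?pnatr_eq0// expr1n mulr1.
Qed.

Lemma diag_form_ge0 f g k : (forall u, (0 <= f u)%R) -> (forall u, (0 <= g u)%R) ->
  0 <= diag_form f g k.
Proof.
move=> f0 g0; rewrite mule_ge0 ?lee_fin ?exprn_ge0//.
by apply: integral_ge0 => z _; rewrite lee_fin mulr_ge0.
Qed.

(** Pointwise 2ab <= a^2 + b^2; each square then depends on one variable, and the other integrates
    to the mass of a ball. *)
Lemma diag_form_schur f g k : measurable_fun setT f -> measurable_fun setT g ->
  (forall u, (0 <= f u)%R) -> (forall u, (0 <= g u)%R) ->
  diag_form f g k <= (kappa / 2)%:E * (\int[H]_u (f u ^+ 2)%:E + \int[H]_u (g u ^+ 2)%:E).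
Proof.
move=> mf mg f0 g0.
have mf2 : measurable_fun setT (fun u => f u ^+ 2)%R by exact: measurable_funX.
have mg2 : measurable_fun setT (fun u => g u ^+ 2)%R by exact: measurable_funX.
pose J := \int[H \x H]_(z in near_diag k.+1%:R^-1)
  (2^-1%:E * ((f z.1 ^+ 2)%:E + (g z.2 ^+ 2)%:E)).
apply: (@le_trans _ _ ((k.+1%:R ^+ m)%:E * J)).
  rewrite /diag_form lee_pmul2l ?lte_fin ?exprn_gt0//.
  apply: ge0_le_integral => //.
  - by move=> z _; rewrite lee_fin mulr_ge0.
  - by apply/measurable_EFinP; apply: measurable_funM; [exact: mfst|exact: msnd].
  - apply: measurable_funeM; apply: emeasurable_funD; apply/measurable_EFinP.
      by apply: measurable_funX; exact: mfst.
    by apply: measurable_funX; exact: msnd.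
  - move=> z _; rewrite -EFinD -EFinM lee_fin.
    have : (0 <= (f z.1 - g z.2) ^+ 2)%R by exact: sqr_ge0.
    rewrite sqrrB; move: (f z.1) (g z.2) => a b; rewrite !expr2; lra.
rewrite /J ge0_integralZl//; last 2 first.
- apply: emeasurable_funD; apply/measurable_EFinP; first by apply: measurable_funX; exact: mfst.
  by apply: measurable_funX; exact: msnd.
- by move=> z _; rewrite adde_ge0// lee_fin sqr_ge0.
rewrite ge0_integralD//; last 4 first.
- by move=> z _; rewrite lee_fin sqr_ge0.
- by apply/measurable_EFinP; apply: measurable_funX; exact: mfst.
- by move=> z _; rewrite lee_fin sqr_ge0.
- by apply/measurable_EFinP; apply: measurable_funX; exact: msnd.
rewrite (ge0_integral_near_fst kappa0 mV HV Hball (d0 k) mf2); last by move=> u; exact: sqr_ge0.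
rewrite (ge0_integral_near_snd kappa0 mV HV Hball (d0 k) mg2); last by move=> u; exact: sqr_ge0.
rewrite -ge0_muleDr; last 2 first.
- by apply: integral_ge0 => u _; rewrite lee_fin sqr_ge0.
- by apply: integral_ge0 => u _; rewrite lee_fin sqr_ge0.
by rewrite muleCA cancel_rate muleA -EFinM mulrC.
Qed.

Import HBNNSimple.

(** A nearby pair on which [h] agrees contributes h(u)^2 <= f(u) f(v). Any other pair is split by
    the level set of h(u); there are finitely many level sets, each asymptotically unsplit, and h^2
    is bounded, so these pairs contribute at most [e] in the limit. *)
Let diag_form_simple f (h : {nnsfun Rn R n >-> R}) (j : nat) (e : R) :
  measurable_fun setT f -> (forall u, (h u <= f u)%R) -> (0 < e)%R ->
  \forall k \near \oo, kappa%:E * \int[H]_u (\1_(eball (0%R : 'rV[R]_n) j.+1%:R) u * h u ^+ 2)%:E <=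
    diag_form f f k + e%:E.
Proof.
move=> mf hf e0; set Bj := eball _ _.
have mBj : measurable Bj by exact: measurable_eball.
(* One unit wider than [Bj], to contain the partner of a point of [Bj]. *)
pose B : set (Rn R n) := eball (0%R : 'rV[R]_n) j.+2%:R.
have mB : measurable B by exact: measurable_eball.
have HB : H B < +oo by rewrite /B Hball// ltry.
have [r hr] : exists r : seq R, range h = [set` r].
  by apply/finite_seqP; exact: (@fimfunP _ _ h).
have rh u : h u \in r by have : range h (h u) by []; rewrite hr.
pose M : R := (\sum_(y <- r) `|y|)%R.
have hM u : (h u ^+ 2 <= M ^+ 2)%R.
  have h0 : (0 <= h u)%R by [].
  have : (h u <= M)%R.
    rewrite /M (big_rem (h u))//= ger0_norm// lerDl.
    by apply: sumr_ge0.
  by move=> hMu; rewrite lerXn2r ?nnegrE// (le_trans h0).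
pose W y := split_pairs B (h @^-1` [set y]).
have mW y : measurable (W y).
  by apply: measurable_split_pairs => //; rewrite -[X in measurable X]setTI; exact: measurable_funP.
have mh2 : measurable_fun setT (fun u => \1_Bj u * h u ^+ 2 : R)%R.
  by apply: measurable_funM => //; apply: measurable_funX.
have h20 u : (0 <= \1_Bj u * h u ^+ 2 :> R)%R by rewrite mulr_ge0// sqr_ge0.
have f0 u : (0 <= f u)%R by apply: le_trans (hf u).
have rate : \forall k \near \oo, \sum_(y <- r) ((M ^+ 2)%:E * split_rate H m B (h @^-1` [set y]) k) <= e%:E.
  apply: near_sum_le => // y e1 e10.
  have e2 : (0 < e1 / (M ^+ 2 + 1))%R by rewrite divr_gt0// ltr_wpDl// sqr_ge0.
  have mhy : measurable (h @^-1` [set y]).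
    by rewrite -[X in measurable X]setTI; exact: measurable_funP.
  have [_ /(_ _ e2)] := measurable_unsplit kappa0 mV HV Hball mB HB mhy.
  apply: filterS => k hk; apply: (@le_trans _ _ ((M ^+ 2)%:E * (e1 / (M ^+ 2 + 1))%:E)).
    by rewrite lee_wpmul2l// lee_fin sqr_ge0.
  rewrite -EFinM lee_fin mulrCA ler_piMr ?(ltW e10)// ler_pdivrMr ?mul1r ?lerDl//.
  by rewrite ltr_wpDl// sqr_ge0.
near=> k.
apply: (@le_trans _ _ (diag_form f f k +
    \sum_(y <- r) ((M ^+ 2)%:E * split_rate H m B (h @^-1` [set y]) k))); last first.
  by rewrite leeD2l//; near: k.
rewrite -(cancel_rate k) -(ge0_integral_near_fst kappa0 mV HV Hball (d0 k) mh2 h20).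
have km : (0 < k.+1%:R ^+ m :> R)%R by rewrite exprn_gt0.
have mWi y : measurable_fun (near_diag k.+1%:R^-1)
    (fun z : Rn R n * Rn R n => (M ^+ 2)%:E * (\1_(W y) z)%:E : \bar R).
  by apply: measurable_funeM; apply/measurable_EFinP; exact: measurable_indic.
have W0 y (z : Rn R n * Rn R n) : 0 <= (M ^+ 2)%:E * (\1_(W y) z)%:E :> \bar R.
  by rewrite mule_ge0// lee_fin sqr_ge0.
have -> : \sum_(y <- r) ((M ^+ 2)%:E * split_rate H m B (h @^-1` [set y]) k) =
    (k.+1%:R ^+ m)%:E * \int[H \x H]_(z in near_diag k.+1%:R^-1)
      \sum_(y <- r) ((M ^+ 2)%:E * (\1_(W y) z)%:E).
  rewrite ge0_integral_sum// ge0_sume_distrr; last by move=> y _; apply: integral_ge0 => z _.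
  apply: eq_bigr => y _; rewrite ge0_integralZl//; last 2 first.
  - by apply/measurable_EFinP; exact: measurable_indic.
  - by rewrite lee_fin sqr_ge0.
  by rewrite integral_indic// setIC /split_rate muleCA.
rewrite /diag_form -ge0_muleDr; last 2 first.
- by apply: integral_ge0 => z _; rewrite lee_fin mulr_ge0.
- by apply: integral_ge0 => z _; apply: sume_ge0.
rewrite lee_pmul2l ?lte_fin//.
rewrite -ge0_integralD//; last 4 first.
- by move=> z _; rewrite lee_fin mulr_ge0.
- by apply/measurable_EFinP; apply: measurable_funM; [exact: mfst|exact: msnd].
- by move=> z _; apply: sume_ge0.
- exact: emeasurable_sum.
apply: ge0_le_integral => //.
- by move=> z _; rewrite lee_fin.
- by apply/measurable_EFinP; exact: (@mfst _ _ mh2).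
- apply: emeasurable_funD; last exact: emeasurable_sum.
  by apply/measurable_EFinP; apply: measurable_funM; [exact: mfst|exact: msnd].
move=> [u v] /= uv.
have S0 : 0 <= \sum_(y <- r) ((M ^+ 2)%:E * (\1_(W y) (u, v))%:E) :> \bar R by apply: sume_ge0.
have [Bu|nBu] := boolP (u \in Bj); last first.
  by rewrite indicE (negbTE nBu) mul0r adde_ge0// lee_fin mulr_ge0.
rewrite indicE Bu mul1r.
have [huv|huv] := eqVneq (h u) (h v).
  rewrite -[leLHS]adde0 leeD// lee_fin expr2 {2}huv.
  by apply: ler_pM.
rewrite -[leLHS]add0e leeD// ?lee_fin ?mulr_ge0//.
rewrite (big_rem (h u))//= -[leLHS]adde0 leeD//; last by apply: sume_ge0.
rewrite indicE mem_set ?mule1 ?lee_fin//.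
move: Bu; rewrite inE /Bj /B /eball /W/= !subr0 => Bu.
split; last by left; split => //= hvu; move: huv; rewrite hvu eqxx.
have k1 : (k.+1%:R^-1 <= 1 :> R)%R by rewrite invf_le1// ler1n.
split; rewrite /= /B /eball/= subr0; first by apply: (lt_trans Bu); rewrite ltr_nat.
rewrite -[v](subrK u) (le_lt_trans (ler_euclD _ _))// -natr1 addrC ltrD//.
by move: uv; rewrite /near_diag/= => /lt_le_trans; apply.
Unshelve. all: by end_near. Qed.

(** Simple functions below [f], cut to growing balls, have squared norms increasing to that of [f].
    One of them already exceeds the strict bound, and the slack absorbs the error of
    [diag_form_simple]. *)
Lemma diag_form_lower f (a : R) : measurable_fun setT f -> (forall u, (0 <= f u)%R) ->
  a%:E < kappa%:E * \int[H]_u (f u ^+ 2)%:E ->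
  \forall k \near \oo, a%:E <= diag_form f f k.
Proof.
move=> mf f0 af.
have mEf : measurable_fun setT (EFin \o f) by exact/measurable_EFinP.
pose h := nnsfun_approx measurableT mEf.
have hf j u : (h j u <= f u)%R.
  by rewrite -lee_fin /h nnsfun_approxE; apply: (@le_approx _ _ _ setT (EFin \o f)) => // v _; rewrite lee_fin.
have hc u : h j u @[j --> \oo] --> f u.
  have := @cvg_nnsfun_approx _ _ _ _ measurableT _ mEf (fun v _ => f0 v) u I.
  by move/fine_cvgP => [].
have hnd u : {homo (fun j => h j u) : i j / (i <= j)%N >-> (i <= j)%R}.
  by move=> i j ij; exact/lefP/nd_nnsfun_approx.
pose G j u : R := (\1_(eball (0%R : 'rV[R]_n) j.+1%:R) u * h j u ^+ 2)%R.
have mG j : measurable_fun setT (G j).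
  apply: measurable_funM; last exact: measurable_funX.
  by apply: measurable_indic; exact: measurable_eball.
have G0 j u : (0 <= G j u)%R by rewrite mulr_ge0// sqr_ge0.
have eball_nd i j u : (i <= j)%N -> (u \in eball (0%R : 'rV[R]_n) i.+1%:R) ->
    (u \in eball (0%R : 'rV[R]_n) j.+1%:R).
  by rewrite !inE => ij ui; apply: (lt_le_trans ui); rewrite ler_nat.
have cG : \int[H]_u (G j u)%:E @[j --> \oo] --> \int[H]_u (f u ^+ 2)%:E.
  rewrite [X in _ --> X](_ : _ = \int[H]_u limn (fun j => (G j u)%:E)).
    apply: cvg_monotone_convergence => //.
    - by move=> j; exact/measurable_EFinP.
    - by move=> j u _; rewrite lee_fin.
    - move=> u _ i j ij; rewrite lee_fin /G; apply: ler_pM; rewrite ?sqr_ge0//.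
        rewrite !indicE; case: (boolP (u \in eball _ i.+1%:R)) => // ui.
        by rewrite (eball_nd i j).
      by rewrite lerXn2r ?nnegrE// hnd.
  apply: eq_integral => u _; apply/esym/cvg_lim => //.
  apply: cvg_EFin; first by apply: nearW.
  rewrite -[X in _ --> X]mul1r; apply: cvgM; last first.
    rewrite expr2; under eq_fun do rewrite expr2.
    by apply: cvgM.
  apply: cvg_near_cst; exists (Num.truncn (eucl (u : 'rV[R]_n))) => // j /= uj.
  rewrite indicE mem_set// /eball/= subr0 (lt_le_trans (truncnS_gt _))//.
  by rewrite ler_nat ltnS.
have : \forall j \near \oo, a%:E < kappa%:E * \int[H]_u (G j u)%:E.
  have cG' : kappa%:E * \int[H]_u (G j u)%:E @[j --> \oo] -->
      kappa%:E * \int[H]_u (f u ^+ 2)%:E by exact: cvgeZl.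
  apply: (cG' [set x | a%:E < x]); apply: open_nbhs_nbhs.
  by split => //; exact: open_ereal_gt_ereal.
move=> [j _ /(_ j (leqnn j))/=]; set X := kappa%:E * _ => aX.
have [e e0 aeX] : exists2 e : R, (0 < e)%R & a%:E + e%:E <= X.
  case: X aX => [x| |//]; last by move=> _; exists 1%R => //; rewrite leey.
  by rewrite lte_fin => ax; exists (x - a)%R; rewrite ?subr_gt0// -EFinD lee_fin subrKC.
have := diag_form_simple j mf (hf j) e0.
by apply: filterS => k /(le_trans aeX); rewrite leeD2rE.
Qed.

Lemma diag_form_liminf f : measurable_fun setT f -> (forall u, (0 <= f u)%R) ->
  kappa%:E * \int[H]_u (f u ^+ 2)%:E <= limn_einf (diag_form f f).
Proof.
move=> mf f0; set x := leLHS; set y := limn_einf _.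
have y0 : 0 <= y by apply: near_le_limn_einf; apply: nearW => k; exact: diag_form_ge0.
rewrite leNgt; apply/negP => yx.
have [a ax ya] : exists2 a : R, a%:E < x & y < a%:E.
  case: y y0 yx => [r| |//] r0; last by case: x.
  case: x => [x| |//]; last by move=> _; exists (r + 1)%R; rewrite ?ltry// lte_fin ltrDl.
  by rewrite lte_fin => rx; exists ((r + x) / 2)%R; rewrite lte_fin; lra.
by have := near_le_limn_einf (diag_form_lower mf f0 ax); rewrite leNgt ya.
Qed.

(* Polarisation: the form of [f + g] is at most [kappa] times the squared norm of
   [f + g], while those of [f] and of [g] are asymptotically at least
   [kappa] times the squared norms. *)
Lemma diag_form_limsup f g : measurable_fun setT f -> measurable_fun setT g ->
  (forall u, (0 <= f u)%R) -> (forall u, (0 <= g u)%R) ->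
  \int[H]_u (f u ^+ 2)%:E < +oo -> \int[H]_u (g u ^+ 2)%:E < +oo ->
  forall e : R, (0 < e)%R -> \forall k \near \oo,
    diag_form f g k <= (2 * kappa)%:E * \int[H]_u (f u * g u)%:E + e%:E.
Proof.
move=> mf mg f0 g0 Ff Fg e e0.
pose F := fine (\int[H]_u (f u ^+ 2)%:E).
pose G := fine (\int[H]_u (g u ^+ 2)%:E).
have FE : \int[H]_u (f u ^+ 2)%:E = F%:E.
  by rewrite fineK// ge0_fin_numE//; apply: integral_ge0 => u _; rewrite lee_fin sqr_ge0.
have GE : \int[H]_u (g u ^+ 2)%:E = G%:E.
  by rewrite fineK// ge0_fin_numE//; apply: integral_ge0 => u _; rewrite lee_fin sqr_ge0.
have mfg : measurable_fun setT (fun u => f u + g u)%R by exact: measurable_funD.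
have fg0 u : (0 <= f u + g u)%R by rewrite addr_ge0.
have e2 : (0 < e / 2)%R by rewrite divr_gt0.
have lf : \forall k \near \oo, (kappa * F - e / 2)%:E <= diag_form f f k.
  by apply: diag_form_lower => //; rewrite FE -EFinM lte_fin gtrBl.
have lg : \forall k \near \oo, (kappa * G - e / 2)%:E <= diag_form g g k.
  by apply: diag_form_lower => //; rewrite GE -EFinM lte_fin gtrBl.
near=> k.
set I := \int[H]_u (f u * g u)%:E.
have I0 : 0 <= I by apply: integral_ge0 => u _; rewrite lee_fin mulr_ge0.
have mE (p q : Rn R n -> R) : measurable_fun setT p -> measurable_fun setT q ->
    measurable_fun setT (fun u => (p u * q u)%:E : \bar R).
  by move=> mp mq; apply/measurable_EFinP; exact: measurable_funM.
have sq : \int[H]_u ((f u + g u) ^+ 2)%:E = F%:E + G%:E + 2%:E * I.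
  rewrite -FE -GE /I -ge0_integralZl//; last 2 first.
  - exact: mE.
  - by move=> u _; rewrite lee_fin mulr_ge0.
  rewrite -ge0_integralD//; last 4 first.
  - by move=> u _; rewrite lee_fin sqr_ge0.
  - exact: mE.
  - by move=> u _; rewrite lee_fin sqr_ge0.
  - exact: mE.
  rewrite -ge0_integralD//; last 4 first.
  - by move=> u _; rewrite adde_ge0// lee_fin sqr_ge0.
  - by apply: emeasurable_funD; exact: mE.
  - by move=> u _; rewrite mule_ge0// lee_fin mulr_ge0.
  - by apply: measurable_funeM; exact: mE.
  apply: eq_integral => u _; rewrite -EFinM -!EFinD; congr EFin.
  by rewrite sqrrD mulr_natl addrAC.
(* The mixed term with [g] in the first variable is dropped; this accounts for the factor 2 before
   [kappa] in the conclusion. *)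
have diagD : diag_form (fun u => f u + g u)%R (fun u => f u + g u)%R k >=
    diag_form f f k + diag_form g g k + diag_form f g k.
  have mD (p q : Rn R n -> R) : measurable_fun setT p -> measurable_fun setT q ->
      measurable_fun (near_diag k.+1%:R^-1)
        (fun z : Rn R n * Rn R n => (p z.1 * q z.2)%:E : \bar R).
    by move=> mp mq; apply/measurable_EFinP; apply: measurable_funM; [exact: mfst|exact: msnd].
  have D0 (p q : Rn R n -> R) : (forall u, (0 <= p u)%R) -> (forall u, (0 <= q u)%R) ->
      0 <= \int[H \x H]_(z in near_diag k.+1%:R^-1) (p z.1 * q z.2)%:E.
    by move=> p0 q0; apply: integral_ge0 => z _; rewrite lee_fin mulr_ge0.
  rewrite /diag_form -ge0_muleDr ?D0// -ge0_muleDr; [|by apply: adde_ge0; exact: D0|exact: D0].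
  rewrite lee_pmul2l ?lte_fin ?exprn_gt0//.
  rewrite -ge0_integralD//; last 4 first.
  - by move=> z _; rewrite lee_fin mulr_ge0.
  - exact: mD.
  - by move=> z _; rewrite lee_fin mulr_ge0.
  - exact: mD.
  rewrite -ge0_integralD//; last 4 first.
  - by move=> z _; rewrite adde_ge0// lee_fin mulr_ge0.
  - by apply: emeasurable_funD; exact: mD.
  - by move=> z _; rewrite lee_fin mulr_ge0.
  - exact: mD.
  apply: ge0_le_integral => //.
  - by move=> z _; rewrite !adde_ge0// lee_fin mulr_ge0.
  - by apply: emeasurable_funD; [apply: emeasurable_funD|]; exact: mD.
  - exact: (mD _ _ mfg mfg).
  - move=> z _; rewrite -!EFinD lee_fin mulrDl !mulrDr.
    by have := mulr_ge0 (g0 z.1) (f0 z.2); lra.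
have schur := diag_form_schur k mfg mfg fg0 fg0.
have := le_trans diagD schur; rewrite sq => H1.
have H2 : (kappa * F - e / 2)%:E + (kappa * G - e / 2)%:E + diag_form f g k <=
    (kappa / 2)%:E * (F%:E + G%:E + 2%:E * I + (F%:E + G%:E + 2%:E * I)).
  apply: le_trans H1; rewrite leeD2r//; apply: leeD; near: k; [exact: lf|exact: lg].
clear sq H1; move: I0 H2; case: I => [i| |//] _; last by move=> _; rewrite gt0_muley ?lte_fin ?mulr_gt0// addye// leey.
have := diag_form_ge0 k f0 g0; case: (diag_form f g k) => [x| |//] _ //.
by rewrite -?EFinM -?EFinD -?EFinM -?EFinD !lee_fin; lra.
Unshelve. all: by end_near. Qed.

End diagonal_form.

(** * Projected densities on a fibre *)

Section density.
Local Open Scope ereal_scope.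
Context d (T : measurableType d) (R : realType).
Variables (mu nu : {measure set T -> \bar R}).

Import HBNNSimple.

Lemma ge0_integral_density (D : set T) (w : T -> \bar R) : measurable D ->
  measurable_fun setT w -> (forall x, 0 <= w x) -> (forall x, w x \is a fin_num) ->
  (forall A, measurable A -> nu A = \int[mu]_(x in A `&` D) w x) ->
  forall phi : T -> \bar R, measurable_fun setT phi -> (forall x, 0 <= phi x) ->
  \int[nu]_x phi x = \int[mu]_(x in D) (phi x * w x).
Proof.
move=> mD mw w0 wfin nuE phi mphi phi0.
have mwD : measurable_fun D w by exact: measurable_funTS.
have simple (h : {nnsfun T >-> R}) :
    \int[nu]_x (h x)%:E = \int[mu]_(x in D) ((h x)%:E * w x).
  have [r0 hr0] : exists r : seq R, range h = [set` r].
    by apply/finite_seqP; exact: (@fimfunP _ _ h).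
  pose r := undup r0.
  have rh x : h x \in r by rewrite mem_undup; have : range h (h x) by []; rewrite hr0.
  have mhy y : measurable (h @^-1` [set y]).
    by rewrite -[X in measurable X]setTI; exact: measurable_funP.
  (* Since [h] is nonnegative, [|y|] may replace [y], which makes every summand nonnegative; [undup]
     ensures that each value counts once. *)
  have hE x : (h x)%:E = \sum_(y <- r) (`|y|)%:E * (\1_(h @^-1` [set y]) x)%:E.
    rewrite (bigD1_seq (h x)) ?undup_uniq//= big1_seq ?adde0; last first.
      move=> y /andP[yx _]; rewrite indicE memNset ?mule0//= => xy.
      by rewrite xy eqxx in yx.
    by rewrite indicE mem_set// mule1 ger0_norm.
  under eq_integral do rewrite hE.
  have mi y : measurable_fun setT (fun x => (`|y|)%:E * (\1_(h @^-1` [set y]) x)%:E : \bar R).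
    by apply: measurable_funeM; apply/measurable_EFinP; exact: measurable_indic.
  have i0 y x : 0 <= (`|y|)%:E * (\1_(h @^-1` [set y]) x)%:E :> \bar R by rewrite mule_ge0.
  rewrite ge0_integral_sum//.
  under [RHS]eq_integral => x _.
    rewrite hE ge0_sume_distrl; last by move=> y _; exact: i0.
    over.
  rewrite [RHS]ge0_integral_sum//; last 2 first.
  - by move=> y; apply: emeasurable_funM => //; exact: measurable_funTS.
  - by move=> y x _; rewrite mule_ge0.
  apply: eq_bigr => y _; rewrite ge0_integralZl//; last first.
    by apply/measurable_EFinP; exact: measurable_indic.
  under [RHS]eq_integral do rewrite -muleA.
  rewrite [RHS]ge0_integralZl//; last 2 first.
  - apply: emeasurable_funM => //.
    by apply/measurable_EFinP; apply: measurable_funTS; exact: measurable_indic.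
  - by move=> x _; rewrite mule_ge0.
  congr (_ * _); rewrite integral_indic// setIT nuE// integral_mkcondl.
  apply: eq_integral => x _; rewrite patchE indicE.
  by case: ifP; rewrite ?mul1e ?mul0e.
pose h := nnsfun_approx measurableT mphi.
have hnd x : {homo (fun j => h j x) : i j / (i <= j)%N >-> (i <= j)%R}.
  by move=> i j ij; exact/lefP/nd_nnsfun_approx.
have hc x : (h j x)%:E @[j --> \oo] --> phi x by exact: cvg_nnsfun_approx.
transitivity (limn (fun j => \int[nu]_x (h j x)%:E)).
  rewrite -monotone_convergence//.
  - by apply: eq_integral => x _; apply/esym/cvg_lim => //; exact: hc.
  - by move=> j; exact/measurable_EFinP.
  - by move=> j x _; rewrite lee_fin.
  - by move=> x _ i j ij; rewrite lee_fin hnd.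
rewrite (_ : (fun j => _) = fun j => \int[mu]_(x in D) ((h j x)%:E * w x)); last first.
  by apply/funext => j; exact: simple.
rewrite -monotone_convergence//.
- apply: eq_integral => x _; apply/cvg_lim => //; by apply: cvgeZr; [exact: wfin|exact: hc].
- by move=> j; apply: emeasurable_funM => //; exact/measurable_EFinP/measurable_funTS.
- by move=> j x _; rewrite mule_ge0// lee_fin.
- by move=> x _ i j ij; rewrite lee_wpmul2r// lee_fin hnd.
Qed.

(** The density formula with weight 1. Both signs are treated because [is_proj_density] does not ask
    for a nonnegative density. *)
Lemma integral_restricted_measure (D : set T) : measurable D ->
  (forall A, measurable A -> nu A = mu (A `&` D)) ->
  forall A (phi : T -> \bar R), measurable A -> measurable_fun setT phi ->
  \int[nu]_(x in A) phi x = \int[mu]_(x in A `&` D) phi x.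
Proof.
move=> mD nuE A phi mA mphi.
have ge0 (p : T -> \bar R) : measurable_fun setT p -> (forall x, 0 <= p x) ->
    \int[nu]_(x in A) p x = \int[mu]_(x in A `&` D) p x.
  move=> mp p0; rewrite integral_mkcond integral_mkcondl.
  rewrite (@ge0_integral_density D (cst 1)) //.
  - by apply: eq_integral => x _; rewrite mule1.

  - by move=> B mB; rewrite integral_cst ?mul1e ?nuE//; exact: measurableI.
  - by apply/(measurable_restrictT _ mA); exact: measurable_funTS mp.
  - by move=> x; apply: erestrict_ge0.
rewrite integralE [RHS]integralE; congr (_ - _); apply: ge0.
- exact: measurable_funepos.
- by [].
- exact: measurable_funeneg.
- by [].
Qed.

End density.

Section subspace_measure.
Variables (R : realType) (n m : nat).
Local Open Scope ereal_scope.

(** In dimension below n the Hausdorff measure of the whole space is not sigma-finite; its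
    restriction to V is, by bounded balls, and Tonelli's theorem is applied to that. *)
Lemma exists_subspace_measure (P : 'M[R]_n) : grassmannian m.+1 P ->
  exists H : {sigma_finite_measure set Rn R n -> \bar R},
    forall A, H A = hausdorff m.+1 (A `&` subspace_of P).
Proof.
move=> GP; pose H0 := mrestr (@hausdorff R n m.+1) (measurable_subspace P).
have [C C0 HC] := hausdorff_eball_bound R n m.
have V0 : subspace_of P (0%R : 'rV[R]_n) by rewrite /subspace_of/= mul0mx.
have sf : sigma_finite setT H0.
  exists (fun k => eball (0%R : 'rV[R]_n) k.+1%:R).
    apply/seteqP; split=> // v _; exists (Num.truncn (eucl (v : 'rV[R]_n))) => //.
    by rewrite /eball/= subr0 truncnS_gt.
  move=> k; split; first exact: measurable_eball.
  rewrite /H0 /mrestr hausdorff_eball_scale//.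
  apply: (@le_lt_trans _ _ ((k.+1%:R ^+ m.+1)%:E * C%:E)); last by rewrite -EFinM ltry.
  by rewrite lee_pmul2l ?lte_fin ?exprn_gt0//; exact: HC.
pose mix := Measure_isSigmaFinite.Build _ _ _ H0 sf.
pose H : {sigma_finite_measure set Rn R n -> \bar R} := HB.pack H0 mix.
by exists H.
Qed.

End subspace_measure.

Section projection_density.
Variables (R : realType) (n m : nat) (P : 'M[R]_n).
Local Open Scope ereal_scope.
Hypothesis GP : grassmannian m.+1 P.
Variable H : {sigma_finite_measure set Rn R n -> \bar R}.
Hypothesis HE : forall A, H A = hausdorff m.+1 (A `&` subspace_of P).

Let mV : measurable (subspace_of P). Proof. exact: measurable_subspace. Qed.

Lemma measurable_projV : measurable_fun [set: Rn R n] (projV P : Rn R n -> Rn R n).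
Proof.
apply: (@measurable_lipschitz R n n (projV P) (n%:R * n%:R)%R) => x y.
rewrite /projV -mulmxBl -mulrA; apply: ler_eucl_bound.
have [PT [PP _]] := GP.
by apply: mulmx_bound => [i|i j]; [exact: ler_coord_eucl|exact: proj_coef_le1].
Qed.

(** The integral of [f] over the set where f < 0 is a value of a measure, hence nonnegative, so that
    set is null and [f] may be replaced by its positive part. *)
Lemma proj_density_nneg (mu : {measure set Rn R n -> \bar R}) (f : 'rV[R]_n -> R) :
  is_proj_density m.+1 mu P f ->
  exists fp : Rn R n -> R, [/\ measurable_fun setT fp, (forall v, (0 <= fp v)%R),
    (forall A : set (Rn R n), measurable A -> mu (projV P @^-1` A) = \int[H]_(v in A) (fp v)%:E) &
    {ae H, forall v, setT v -> f v = fp v}].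
Proof.
move=> [mf fE].
have mEf : measurable_fun [set: Rn R n] (fun v => (f v)%:E : \bar R) by exact/measurable_EFinP.
have fH (A : set (Rn R n)) : measurable A -> mu (projV P @^-1` A) = \int[H]_(v in A) (f v)%:E.
  move=> mA; rewrite fE//; apply: esym.
  apply: (@integral_restricted_measure _ (Rn R n) R (hausdorff m.+1) H) => // B _; exact: HE.
pose N : set (Rn R n) := [set v | (f v < 0)%R].
have mN : measurable N by exact: measurable_lt.
have HN : H N = 0.
  have I0 : \int[H]_(v in N) (- f v)%:E = 0.
    apply/eqP; rewrite eq_le; apply/andP; split; last first.
      by apply: integral_ge0 => v; rewrite /N/= lee_fin oppr_ge0 => /ltW.
    rewrite -leeN2 oppe0 -integral_ge0N; last first.
      by move=> v; rewrite /N/= lee_fin oppr_ge0 => /ltW.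
    under eq_integral do rewrite EFinN oppeK.
    by rewrite -fH.
  have mNf : measurable_fun N (fun v => (- f v)%:E : \bar R).
    by apply/measurable_EFinP; apply: measurableT_comp => //; exact: measurable_funTS.
  have : \int[H]_(v in N) `|(- f v)%:E| = 0.
    rewrite -[RHS]I0; apply: eq_integral => v; rewrite inE => Nv.
    by rewrite gee0_abs// lee_fin oppr_ge0 ltW.
  move/(ae_eq_integral_abs H mN mNf) => [Z [mZ HZ subZ]].
  apply/eqP; rewrite eq_le measure_ge0 andbT -HZ; apply: le_measure; rewrite ?inE// => v Nv.
  apply: subZ => /= /(_ Nv) []; apply/eqP; rewrite oppr_eq0 lt_eqF//.
pose fp (v : Rn R n) : R := Num.max (f v) 0%R.
have ffp : {ae H, forall v, setT v -> f v = fp v}.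
  exists N; split => // v /=; apply: contra_notP => /negP; rewrite -leNgt => f0 _.
  by rewrite /fp; apply/esym/max_idPl.
have mfp : measurable_fun setT fp by exact: measurable_maxr.
exists fp; split => //; first by move=> v; rewrite /fp le_max lexx orbT.
move=> A mA; rewrite fH//; apply: ae_eq_integral => //.
- exact: measurable_funTS.
- by apply/measurable_EFinP; exact: measurable_funTS.
- move: ffp => [Z [mZ HZ sZ]]; exists Z; split => // v /= h.
  by apply: sZ => /= h'; apply: h => _; rewrite h'.
Qed.

Lemma integral_projV (mu : {measure set Rn R n -> \bar R}) (fp : Rn R n -> R) :
  measurable_fun setT fp -> (forall v, (0 <= fp v)%R) ->
  (forall A : set (Rn R n), measurable A -> mu (projV P @^-1` A) = \int[H]_(v in A) (fp v)%:E) ->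
  forall phi : Rn R n -> \bar R, measurable_fun setT phi -> (forall v, 0 <= phi v) ->
  \int[mu]_x phi (projV P x) = \int[H]_v (phi v * (fp v)%:E).
Proof.
move=> mfp fp0 fpE phi mphi phi0.
have := @ge0_integral_pushforward _ _ _ _ R _ measurable_projV mu setT phi measurableT mphi
  (fun v _ => phi0 v).
rewrite preimage_setT => <-.
apply: (@ge0_integral_density _ _ _ H _ setT (EFin \o fp)) => //.
- exact: measurable_projV.
- exact/measurable_EFinP.
- by move=> ? A mA; rewrite setIT -fpE.
Qed.

(** The condition |(y - x)P| < d places yP in a ball about xP, so the inner measure is a function of
    xP alone, namely the integral of [gp] over that ball. *)
Lemma integral_proj_near (mu nu : {measure set Rn R n -> \bar R}) (fp gp : Rn R n -> R) d :
  measurable_fun setT fp -> (forall v, (0 <= fp v)%R) ->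
  measurable_fun setT gp -> (forall v, (0 <= gp v)%R) ->
  (forall A : set (Rn R n), measurable A -> mu (projV P @^-1` A) = \int[H]_(v in A) (fp v)%:E) ->
  (forall A : set (Rn R n), measurable A -> nu (projV P @^-1` A) = \int[H]_(v in A) (gp v)%:E) ->
  \int[mu]_x nu [set y : Rn R n | (eucl (((y : 'rV[R]_n) - x) *m P) < d)%R] =
  \int[H \x H]_(z in near_diag d) (fp z.1 * gp z.2)%:E.
Proof.
move=> mfp fp0 mgp gp0 fpE gpE.
have mnear : measurable (@near_diag R n d) by exact: measurable_near_diag.
pose psi (u : Rn R n) : \bar R := \int[H]_(v in eball (u : 'rV[R]_n) d) (gp v)%:E.
have mg : measurable_fun setT
    ((fun z : Rn R n * Rn R n => (gp z.2)%:E) \_ (near_diag d)).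
  apply/(measurable_restrictT _ mnear); apply/measurable_EFinP; apply: measurable_funTS.
  exact: (measurableT_comp mgp measurable_snd).
have psiE u : psi u = fubini_F H ((fun z : Rn R n * Rn R n => (gp z.2)%:E) \_ (near_diag d)) u.
  rewrite /psi /fubini_F [LHS]integral_mkcond; apply: eq_integral => v _.
  rewrite !patchE; have -> // : ((u, v) \in near_diag d) = (v \in eball (u : 'rV[R]_n) d).
  by apply/idP/idP; rewrite !inE.
have mpsi : measurable_fun setT psi.
  rewrite (_ : psi = fubini_F H ((fun z => (gp z.2)%:E) \_ (near_diag d))).
    apply: measurable_fun_fubini_tonelli_F => // z.
    by apply: erestrict_ge0 => t _; rewrite lee_fin.
  by apply/funext => u; exact: psiE.
have psi0 u : 0 <= psi u by apply: integral_ge0 => v _; rewrite lee_fin.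
transitivity (\int[mu]_x psi (projV P x)).
  apply: eq_integral => x _; rewrite /psi -gpE; last exact: measurable_eball.
  by congr (nu _); apply/seteqP; split=> y; rewrite /eball /projV/= mulmxBl.
rewrite (integral_projV mfp fp0 fpE)//.
rewrite [RHS]integral_mkcond fubini_tonelli1; last 2 first.
- apply/(measurable_restrictT _ mnear); apply/measurable_EFinP; apply: measurable_funTS.
  apply: measurable_funM; first exact: (measurableT_comp mfp measurable_fst).
  exact: (measurableT_comp mgp measurable_snd).
- by move=> z; apply: erestrict_ge0 => t _; rewrite lee_fin mulr_ge0.
apply: eq_integral => u _; rewrite psiE /fubini_F muleC -ge0_integralZl//; last 2 first.
- by move=> v _; apply: erestrict_ge0 => t _; rewrite lee_fin.
- by rewrite lee_fin.
  by apply: eq_integral => v _; rewrite !patchE; case: ifP => _; rewrite ?mule0.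
exact: (measurableT_comp mg (pair1_measurable u)).
Qed.

Lemma integral_density_product (f g : 'rV[R]_n -> R) (fp gp : Rn R n -> R) :
  measurable_fun [set: Rn R n] (f : Rn R n -> R) ->
  measurable_fun [set: Rn R n] (g : Rn R n -> R) ->
  measurable_fun setT fp -> measurable_fun setT gp ->
  {ae H, forall v, setT v -> f v = fp v} -> {ae H, forall v, setT v -> g v = gp v} ->
  \int[hausdorff m.+1]_(v in subspace_of P) (f v * g v)%:E = \int[H]_v (fp v * gp v)%:E.
Proof.
move=> mf mg mfp mgp ffp ggp.
have mfg : measurable_fun [set: Rn R n] (fun v : Rn R n => (f v * g v)%:E : \bar R).
  by apply/measurable_EFinP; exact: measurable_funM.
transitivity (\int[H]_v (f v * g v)%:E).
  rewrite -[X in \int[_]_(v in X) _]setTI; apply: esym.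
  by apply: (@integral_restricted_measure _ (Rn R n) R (hausdorff m.+1) H) => // B _; exact: HE.
apply: ae_eq_integral => //; first by apply/measurable_EFinP; exact: measurable_funM.
move: ffp ggp => [Z1 [mZ1 HZ1 sZ1]] [Z2 [mZ2 HZ2 sZ2]].
exists (Z1 `|` Z2); split; first exact: measurableU.
  by rewrite null_set_setU.
move=> v /=; apply: contra_notP => /not_orP[nZ1 nZ2] _.
have -> : f v = fp v by apply: contrapT => h; apply: nZ1; apply: sZ1 => /= /(_ I).
by have -> : g v = gp v by apply: contrapT => h; apply: nZ2; apply: sZ2 => /= /(_ I).
Qed.

End projection_density.

Section fibre_form.
Variables (R : realType) (n m : nat).
Local Open Scope ereal_scope.

(** The F_k(P) of the overview, with k + 1 for k and m + 1 for m. No density occurs in it, which is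
    why it is measurable in P. *)
Definition proj_near (mu nu : set (Rn R n) -> \bar R) (k : nat) (P : 'M[R]_n) : \bar R :=
  (k.+1%:R ^+ m.+1)%:E *
  \int[mu]_x nu [set y : Rn R n | (eucl (((y : 'rV[R]_n) - x) *m P) < k.+1%:R^-1)%R].

Variables (mu nu : {measure set Rn R n -> \bar R}) (P : 'M[R]_n) (C : R).
Hypothesis GP : grassmannian m.+1 P.
Hypothesis HC : hausdorff m.+1 (eball (0%R : 'rV[R]_n) 1%R `&` subspace_of P) <= C%:E.
Variables f g : 'rV[R]_n -> R.
Hypotheses (muf : is_proj_density m.+1 mu P f) (nug : is_proj_density m.+1 nu P g).
Hypothesis mu_gt0 : 0 < mu setT.

(** The bounds are phrased with the lower limits of [proj_near] instead of the L^2 norms of the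
    densities, and with [C] instead of the mass of the unit ball: the former are measurable in P,
    the latter is uniform. *)
Lemma fibre_estimates :
  [/\ 0 <= \int[hausdorff m.+1]_(v in subspace_of P) (f v * g v)%:E,
   (forall k, proj_near mu nu k P <=
     2^-1%:E * (limn_einf (proj_near mu mu ^~ P) + limn_einf (proj_near nu nu ^~ P))) &
   (limn_einf (proj_near mu mu ^~ P) < +oo -> limn_einf (proj_near nu nu ^~ P) < +oo ->
    forall e : R, (0 < e)%R -> \forall k \near \oo, proj_near mu nu k P <=
      (2 * C)%:E * \int[hausdorff m.+1]_(v in subspace_of P) (f v * g v)%:E + e%:E)].
Proof.
have mV : measurable (subspace_of P) by exact: measurable_subspace.
have [H HE] := exists_subspace_measure GP.
have [fp [mfp fp0 fpE ffp]] := proj_density_nneg HE muf.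
have [gp [mgp gp0 gpE ggp]] := proj_density_nneg HE nug.
have V0 : subspace_of P (0%R : 'rV[R]_n) by rewrite /subspace_of/= mul0mx.
pose k0 := fine (hausdorff m.+1 (eball (0%R : 'rV[R]_n) 1%R `&` subspace_of P)).
have k0E : hausdorff m.+1 (eball (0%R : 'rV[R]_n) 1%R `&` subspace_of P) = k0%:E.
  by rewrite fineK// ge0_fin_numE ?hausdorff_ge0// (le_lt_trans HC)// ltry.
have Hball (u : Rn R n) d : subspace_of P u -> (0 < d)%R ->
    H (eball (u : 'rV[R]_n) d) = (k0 * d ^+ m.+1)%:E.
  by move=> Vu d0; rewrite HE hausdorff_eball_scale// k0E -EFinM mulrC.
have HV : H (~` (subspace_of P)) = 0 by rewrite HE setICl hausdorff_set0.
have k0_ge0 : (0 <= k0)%R by rewrite -lee_fin -k0E hausdorff_ge0.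
(* If the unit ball were null, scaling would make every ball null, hence all of V, and the
   projection of [mu], having a density, would vanish. *)
have k0_gt0 : (0 < k0)%R.
  rewrite lt_neqAle k0_ge0 andbT eq_sym; apply/negP => /eqP k00.
  have HT : H setT = 0.
    apply/eqP; rewrite eq_le measure_ge0 andbT.
    have -> : setT = \bigcup_k eball (0%R : 'rV[R]_n) k.+1%:R.
      apply/seteqP; split=> // v _; exists (Num.truncn (eucl (v : 'rV[R]_n))) => //.
      by rewrite /eball/= subr0 truncnS_gt.
    apply: le_trans (measure_sigma_subadditive H _ _ (@subset_refl _ _)) _.
    - by move=> k; exact: measurable_eball.
    - by apply: bigcup_measurable => k _; exact: measurable_eball.
    - by rewrite eseries0// => k _ _; rewrite /= Hball// k00 mul0r.
  have := fpE setT measurableT; rewrite preimage_setT => muT.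
  move: mu_gt0; rewrite muT null_set_integral ?ltxx//.
  by apply/measurable_EFinP.
have k0C : (k0 <= C)%R by rewrite -lee_fin -k0E.
have fgE := integral_density_product HE muf.1 nug.1 mfp mgp ffp ggp.
have formE (mu1 mu2 : {measure set Rn R n -> \bar R}) (p q : Rn R n -> R) k :
    measurable_fun setT p -> (forall v, (0 <= p v)%R) ->
    measurable_fun setT q -> (forall v, (0 <= q v)%R) ->
    (forall A : set (Rn R n), measurable A -> mu1 (projV P @^-1` A) = \int[H]_(v in A) (p v)%:E) ->
    (forall A : set (Rn R n), measurable A -> mu2 (projV P @^-1` A) = \int[H]_(v in A) (q v)%:E) ->
    proj_near mu1 mu2 k P = diag_form H m.+1 p q k.
  move=> mp p0 mq q0 pE qE.
  by rewrite /proj_near /diag_form (integral_proj_near GP _ mp p0 mq q0 pE qE).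
have limE (mu1 : {measure set Rn R n -> \bar R}) (p : Rn R n -> R) :
    measurable_fun setT p -> (forall v, (0 <= p v)%R) ->
    (forall A : set (Rn R n), measurable A -> mu1 (projV P @^-1` A) = \int[H]_(v in A) (p v)%:E) ->
    k0%:E * \int[H]_u (p u ^+ 2)%:E <= limn_einf (proj_near mu1 mu1 ^~ P).
  move=> mp p0 pE.
  rewrite (_ : proj_near mu1 mu1 ^~ P = diag_form H m.+1 p p); last first.
    by apply/funext => k; exact: formE.
  exact: (diag_form_liminf k0_gt0 mV HV Hball V0).
have L1 := limE _ _ mfp fp0 fpE; have L2 := limE _ _ mgp gp0 gpE.
have sq0 (p : Rn R n -> R) : 0 <= \int[H]_u (p u ^+ 2)%:E.
  by apply: integral_ge0 => u _; rewrite lee_fin sqr_ge0.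
split.
- by rewrite fgE; apply: integral_ge0 => v _; rewrite lee_fin mulr_ge0.
- move=> k; rewrite (formE _ _ _ _ _ mfp fp0 mgp gp0 fpE gpE).
  apply: le_trans (diag_form_schur k0_gt0 mV HV Hball _ mfp mgp fp0 gp0) _.
  rewrite mulrC EFinM -muleA lee_pmul2l ?lte_fin ?invr_gt0//.
  by rewrite ge0_muleDr ?sq0//; exact: leeD.
- move=> E1 E2 e e0.
  have fin p : k0%:E * \int[H]_u (p u ^+ 2)%:E < +oo -> \int[H]_u (p u ^+ 2)%:E < +oo.
    case: (\int[H]_u (p u ^+ 2)%:E) => [r _|//|//]; first exact: ltry.
    by rewrite gt0_muley ?lte_fin.
  have := diag_form_limsup k0_gt0 mV HV Hball V0 mfp mgp fp0 gp0
    (fin _ (le_lt_trans L1 E1)) (fin _ (le_lt_trans L2 E2)) e0.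
  apply: filterS => k; rewrite -(formE _ _ _ _ _ mfp fp0 mgp gp0 fpE gpE) fgE.
  move=> /le_trans; apply; rewrite leeD2r// lee_wpmul2r//.
    by apply: integral_ge0 => v _; rewrite lee_fin mulr_ge0.
  by rewrite lee_fin ler_pM2l.
Qed.

End fibre_form.

(** * Supports *)

Section support.
Variables (R : realType) (n : nat).
Local Open Scope ereal_scope.

Lemma rV_hausdorff : hausdorff_space 'rV[R]_n.
Proof.
rewrite open_hausdorff => x y xy; pose r : R := (eucl (x - y) / 2)%R.
have r0 : (0 < r)%R by rewrite divr_gt0// eucl_gt0 subr_eq0.
exists (eball x r, eball y r); first by rewrite !inE /eball/= !subrr !eucl0.
split; [exact: open_eucl_ball|exact: open_eucl_ball|apply/eqP/seteqP]; split=> // z [/= zx zy].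
have := ler_eucl_distD z x y; rewrite (eucl_sym x z) leNgt => /negP; apply.
by rewrite [ltRHS](splitr (eucl (x - y))) ltrD.
Qed.

Lemma closed_projV_image (P : 'M[R]_n) (K : set 'rV[R]_n) :
  compact K -> closed (projV P @` K).
Proof.
move=> cK; apply: compact_closed; first exact: rV_hausdorff.
apply: continuous_compact => //; apply: continuous_subspaceT.
apply/continuousP => O oO; apply/open_euclP => x Ox.
have [r r0 hr] := (open_euclP O).1 oO _ Ox.
pose L : R := (1 + n%:R * \sum_i \sum_j `|P i j|)%R.
have L0 : (0 < L)%R.
  by rewrite ltr_pwDl// mulr_ge0//; apply: sumr_ge0 => i _; exact: sumr_ge0.
exists (r / L)%R; first by rewrite divr_gt0.
move=> y; rewrite ltr_pdivlMr// => yx; apply: hr; apply: le_lt_trans yx.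
rewrite /projV -mulmxBl mulrC /L mulrDl mul1r ler_wpDl ?eucl_ge0// -mulrA.
apply: ler_eucl_bound => j; rewrite mxE (le_trans (ler_norm_sum _ _ _))// mulr_suml.
apply: ler_sum => i _; rewrite normrM [leLHS]mulrC; apply: ler_pM => //.
  by rewrite (bigD1 j)//= lerDl sumr_ge0.
exact: ler_coord_eucl.
Qed.

(** A point off the support lies in a null ball with rational centre and radius 1/(k+1), and there
    are countably many of these. The measurable superset [U] stands in for the complement of the
    support. *)
Lemma spt_null (mu : {measure set Rn R n -> \bar R}) :
  exists2 U : set (Rn R n), measurable U & ~` (spt mu) `<=` U /\ mu U = 0.
Proof.
pose c (i : 'rV[int]_n * nat * nat) : 'rV[R]_n := (i.1.2.+1%:R^-1 *: map_mx intr i.1.1)%R.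
pose U (j : nat) : set (Rn R n) :=
  if unpickle j is Some i then
    if mu (eball (c i) i.2.+1%:R^-1) == 0 then eball (c i) i.2.+1%:R^-1 else set0
  else set0.
have mU j : measurable (U j).
  rewrite /U; case: (unpickle j) => [i|//]; case: ifP => // _; exact: measurable_eball.
have U0 j : mu (U j) = 0.
  by rewrite /U; case: (unpickle j) => [i|//]; case: ifP => // /eqP.
exists (\bigcup_j U j); first exact: bigcup_measurable.
split; last first.
  apply/eqP; rewrite eq_le measure_ge0 andbT.
  apply: le_trans (measure_sigma_subadditive mu mU _ (@subset_refl _ _)) _.
    exact: bigcup_measurable.
  by rewrite eseries0// => k _ _ /=; rewrite U0.
move=> x /existsNP[r /not_implyP[r0 /negP]]; rewrite -leNgt => mur.
(* With 2/(k+1) < r, a ball of radius 1/(k+1) whose centre is that close to [x] lies in the null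
   ball about [x]; [N] makes the grid fine enough to provide such a centre. *)
pose k := Num.truncn (2 / r)%R.
have k2 : (2 * k.+1%:R^-1 < r)%R.
  by rewrite ltr_pdivrMr// mulrC -ltr_pdivrMr// truncnS_gt.
pose N := Num.truncn (n%:R / k.+1%:R^-1 : R)%R.
have Nk : (n%:R * N.+1%:R^-1 < k.+1%:R^-1 :> R)%R.
  by rewrite ltr_pdivrMr// mulrC -ltr_pdivrMr ?invr_gt0// truncnS_gt.
pose z : 'rV[int]_n := (\row_i Num.floor (N.+1%:R * x ord0 i))%R.
pose i0 : 'rV[int]_n * nat * nat := (z, N, k).
have cx : (eucl (c i0 - x) < k.+1%:R^-1)%R.
  apply: le_lt_trans Nk; apply: ler_eucl_bound => i; rewrite !mxE/=.
  set t := x ord0 i.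
  have N0 : (0 < N.+1%:R :> R)%R by rewrite ltr0n.
  rewrite -(ler_pM2l N0) divff ?gt_eqF// -{1}(gtr0_norm N0) -normrM mulrBr.
  rewrite mulVKf ?gt_eqF// distrC ger0_norm ?subr_ge0 ?real_floor_le ?num_real//.
  rewrite lerBlDl -[X in (_ <= _ + X)%R]/(1%:~R) -rmorphD/= ltW// floorD1_gt//.
exists (pickle i0); [exact: I|rewrite /U pickleK].
have sub : eball (c i0) k.+1%:R^-1 `<=` [set y | (eucl (y - x) < r)%R].
  move=> y yc; apply: le_lt_trans (ler_eucl_distD (c i0) y x) _.
  by apply: lt_trans k2; rewrite mulr_natl mulr2n ltrD.
have -> : mu (eball (c i0) k.+1%:R^-1) == 0.
  rewrite eq_le measure_ge0 andbT (le_trans _ mur)//; apply: le_measure; rewrite ?inE//.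
    exact: measurable_eball.
  exact: (measurable_eball x r).
by rewrite /eball/= eucl_sym.
Qed.

End support.

Section fibre_support.
Variables (R : realType) (n m : nat).
Local Open Scope ereal_scope.
Variables (mu nu : {measure set Rn R n -> \bar R}) (P : 'M[R]_n).
Hypothesis GP : grassmannian m.+1 P.
Variables f g : 'rV[R]_n -> R.
Hypotheses (muf : is_proj_density m.+1 mu P f) (nug : is_proj_density m.+1 nu P g).
Hypotheses (cmu : compact (spt mu)) (cnu : compact (spt nu)).

Lemma proj_spt_null (mu0 : {measure set Rn R n -> \bar R}) : compact (spt mu0) ->
  mu0 (projV P @^-1` (~` (projV P @` spt mu0))) = 0.
Proof.
move=> c0; have [U mU [sU U0]] := spt_null mu0.
apply/eqP; rewrite eq_le measure_ge0 andbT -U0; apply: le_measure; rewrite ?inE//.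
  rewrite -[X in measurable X]setTI; apply: (measurable_projV GP) => //.
  by apply: measurableC; apply: measurable_closed; exact: closed_projV_image.
by move=> x nx; apply: sU => sx; apply: nx; exists x.
Qed.

Lemma fibre_support_gt0 :
  0 < \int[hausdorff m.+1]_(v in subspace_of P) (f v * g v)%:E ->
  0 < hausdorff m.+1 (projV P @` spt mu `&` projV P @` spt nu).
Proof.
move=> I0; rewrite lt_neqAle hausdorff_ge0 andbT eq_sym; apply/negP => /eqP h0.
have mV : measurable (subspace_of P) by exact: measurable_subspace.
have [H HE] := exists_subspace_measure GP.
have [fp [mfp fp0 fpE ffp]] := proj_density_nneg HE muf.
have [gp [mgp gp0 gpE ggp]] := proj_density_nneg HE nug.
move: I0; rewrite (integral_density_product HE muf.1 nug.1 mfp mgp ffp ggp).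
set A := projV P @` spt mu; set B := projV P @` spt nu.
have mA : measurable (A : set (Rn R n)).
  by apply: measurable_closed; exact: closed_projV_image.
have mB : measurable (B : set (Rn R n)).
  by apply: measurable_closed; exact: closed_projV_image.
have HAB : H (A `&` B) = 0.
  apply/eqP; rewrite eq_le measure_ge0 andbT HE -h0.
  by apply: le_hausdorff; exact: subIsetl.
have mE (p : Rn R n -> R) (D : set (Rn R n)) : measurable_fun setT p ->
    measurable_fun D (fun v => (p v)%:E : \bar R).
  by move=> mp; apply/measurable_EFinP; exact: measurable_funTS.
have ae0 (p : Rn R n -> R) (D : set (Rn R n)) : measurable D -> measurable_fun setT p ->
    (forall v, (0 <= p v)%R) -> \int[H]_(v in D) (p v)%:E = 0 ->
    exists2 Z : set (Rn R n), measurable Z & H Z = 0 /\ forall v, D v -> p v != 0%R -> Z v.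
  move=> mD mp p0 I0; have := ae_eq_integral_abs H mD (mE p D mp).
  case=> + _; have -> : \int[H]_(v in D) `|(p v)%:E| = 0.
    by rewrite -[RHS]I0; apply: eq_integral => v _; rewrite gee0_abs// lee_fin.
  move=> /(_ erefl)[Z [mZ HZ sZ]]; exists Z => //; split => // v Dv pv.
  by apply: sZ => /= /(_ Dv)[]; apply/eqP.
have [Z1 mZ1 [HZ1 sZ1]] := ae0 fp (~` A) (measurableC mA) mfp fp0
  (etrans (esym (fpE _ (measurableC mA))) (proj_spt_null cmu)).
have [Z2 mZ2 [HZ2 sZ2]] := ae0 gp (~` B) (measurableC mB) mgp gp0
  (etrans (esym (gpE _ (measurableC mB))) (proj_spt_null cnu)).
have -> : \int[H]_v (fp v * gp v)%:E = 0; last by rewrite ltxx.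
rewrite -[RHS](integral0 H setT); apply: ae_eq_integral => //.
  by apply/measurable_EFinP; exact: measurable_funM.
exists (A `&` B `|` (Z1 `|` Z2)); split.
- by apply: measurableU; [exact: measurableI|exact: measurableU].
- rewrite null_set_setU//; first exact: measurableI.
    exact: measurableU.
  by rewrite null_set_setU.
move=> v /=; apply: contra_notP => /not_orP[nAB /not_orP[nZ1 nZ2]] _.
have [Av|nAv] := pselect (A v).
  have nBv : ~ B v by move=> Bv; apply: nAB.
  have -> : gp v = 0%R by apply/eqP/negP => /negP h; apply: nZ2; exact: sZ2.
  by rewrite mulr0.
have -> : fp v = 0%R by apply/eqP/negP => /negP h; apply: nZ1; exact: sZ1.
by rewrite mul0r.
Qed.

End fibre_support.

(** * Averaging over the Grassmannian *)

Section integral_nonmeasurable.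
Local Open Scope ereal_scope.
Context d (T : measurableType d) (R : realType) (mu : {measure set T -> \bar R}).

(* The integral of a nonnegative function is a supremum over the simple
   functions below it, so monotonicity needs no measurability. *)
Lemma ge0_le_integral_sup (f g : T -> \bar R) : (forall x, 0 <= f x) ->
  (forall x, f x <= g x) -> \int[mu]_x f x <= \int[mu]_x g x.
Proof.
move=> f0 fg; rewrite !ge0_integralTE//; last by move=> x; exact: le_trans (fg x).
by apply: le_ereal_sup => _ [h hf <-]; exists h => // x; exact: le_trans (hf x) (fg x).
Qed.

Lemma integral_gt0_minorant (phi psi : T -> \bar R) (Z B : set T) :
  measurable Z -> mu Z = 0 -> (forall x, ~ Z x -> 0 <= phi x) ->
  measurable B -> 0 < mu B -> measurable_fun setT psi -> (forall x, 0 <= psi x) ->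
  (forall x, B x -> ~ Z x -> 0 < psi x <= phi x) ->
  0 < \int[mu]_x phi x.
Proof.
move=> mZ Z0 phi0 mB B0 mpsi psi0 hB.
rewrite integralE.
have neg : \int[mu]_x phi^\- x = 0.
  apply/eqP; rewrite eq_le; apply/andP; split; last by apply: integral_ge0.
  (* The negative part lives on [Z], where [+oo] dominates it and still integrates to 0. *)
  apply: le_trans (ge0_le_integral_sup (g := (cst +oo) \_ Z) _ _) _ => //.
    move=> x; rewrite patchE; case: ifPn => [_|xZ]; first by rewrite leey.
    rewrite funenegE ge_max lexx andbT leeNl oppe0 phi0//.
    by move=> Zx; move: xZ; rewrite mem_set.
  by rewrite -integral_mkcond null_set_integral.
rewrite neg sube0.
have mC : measurable (B `\` Z) by exact: measurableD.
apply: (@lt_le_trans _ _ (\int[mu]_(x in B `\` Z) psi x)); last first.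
  rewrite integral_mkcond; apply: ge0_le_integral_sup.
    by move=> x; exact: erestrict_ge0.
  move=> x; rewrite patchE; case: ifPn => [|_]; last by rewrite funeposE le_max lexx orbT.
  rewrite inE => -[Bx nZx]; have /andP[_] := hB x Bx nZx.
  by rewrite funeposE => /le_trans; apply; rewrite le_max lexx.
rewrite lt_neqAle integral_ge0 ?andbT//; apply/negP; rewrite eq_sym => /eqP I0.
have mpC : measurable_fun (B `\` Z) psi by exact: measurable_funTS.
have [+ _] := ae_eq_integral_abs mu mC mpC.
have -> : \int[mu]_(x in B `\` Z) `|psi x| = 0.
  by rewrite -[RHS]I0; apply: eq_integral => x _; rewrite gee0_abs.
move=> /(_ erefl)[W [mW W0 sW]].
have : mu B <= mu (W `|` Z).
  apply: le_measure; rewrite ?inE//; first exact: measurableU.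
  move=> x Bx; have [Zx|nZx] := pselect (Z x); [by right|left].
  apply: sW => /= /(_ (conj Bx nZx)) p0; have := hB x Bx nZx.
  by rewrite p0 ltxx.
by rewrite null_set_setU// leNgt B0.
Qed.

End integral_nonmeasurable.

Section sections.
Local Open Scope ereal_scope.
Context d1 d2 (T1 : measurableType d1) (T2 : measurableType d2) (R : realType).

Lemma measurable_measure_section (m2 : {sigma_finite_measure set T2 -> \bar R})
  (S : set (T1 * T2)) : measurable S ->
  measurable_fun setT (fun x => m2 [set y | S (x, y)]).
Proof.
move=> mS; rewrite (_ : (fun x => _) = m2 \o xsection S).
  exact: measurable_fun_xsection.
by apply/funext => x /=; congr (m2 _); apply/seteqP; split=> y; rewrite /xsection/= inE.
Qed.

Lemma measure_section_swap (m1 : {sigma_finite_measure set T1 -> \bar R})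
  (m2 : {sigma_finite_measure set T2 -> \bar R}) (S : set (T1 * T2)) : measurable S ->
  \int[m1]_x m2 [set y | S (x, y)] = \int[m2]_y m1 [set x | S (x, y)].
Proof.
move=> mS.
have sec2 x : measurable [set y | S (x, y)].
  by rewrite -[X in measurable X]setTI; exact: (pair1_measurable x).
have sec1 y : measurable [set x | S (x, y)].
  by rewrite -[X in measurable X]setTI; exact: (pair2_measurable y).
transitivity (\int[m1]_x \int[m2]_y (\1_S (x, y))%:E).
  apply: eq_integral => x _; rewrite -[X in m2 X]setIT -integral_indic//.
rewrite (fubini_tonelli (fun z => (\1_S z)%:E)) //; last first.
  by apply/measurable_EFinP; exact: measurable_indic.
apply: eq_integral => y _; rewrite -[X in m1 X]setIT -integral_indic//.
Qed.

End sections.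

Section gamma_average.
Variables (R : realType) (n m : nat).
Local Open Scope ereal_scope.
Variable gamma : {finite_measure set Mn R n -> \bar R}.
Hypothesis gammaP : grassmann_measure m.+1 gamma.
Hypothesis mn : (m.+1 < n)%N.

Definition proj_triples (d : R) : set ((Mn R n * Rn R n) * Rn R n) :=
  [set z | (eucl (((z.2 : 'rV[R]_n) - z.1.2) *m (z.1.1 : 'M[R]_n)) < d)%R].

Lemma measurable_proj_triples d : measurable (proj_triples d).
Proof.
apply: measurable_lt; apply: measurable_eucl => j; under eq_fun do rewrite mxE.
apply: measurable_sum => i; apply: measurable_funM.
  under eq_fun do rewrite !mxE; apply: measurable_funB.
    exact: (measurableT_comp (measurable_row i) measurable_snd).
  apply: (measurableT_comp (measurable_row i)).
  exact: (measurableT_comp measurable_snd measurable_fst).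
apply: (measurableT_comp (measurable_mat i j)).
exact: (measurableT_comp measurable_fst measurable_fst).
Qed.

(** The same triples with the projection last: its sections over the pairs of points are the sets
    measured by [gamma_near]. *)
Definition proj_triples' (d : R) : set ((Rn R n * Rn R n) * Mn R n) :=
  [set z | (eucl (((z.1.2 : 'rV[R]_n) - z.1.1) *m (z.2 : 'M[R]_n)) < d)%R].

Lemma measurable_proj_triples' d : measurable (proj_triples' d).
Proof.
apply: measurable_lt; apply: measurable_eucl => j; under eq_fun do rewrite mxE.
apply: measurable_sum => i; apply: measurable_funM.
  under eq_fun do rewrite !mxE; apply: measurable_funB.
    apply: (measurableT_comp (measurable_row i)).
    exact: (measurableT_comp measurable_snd measurable_fst).
  apply: (measurableT_comp (measurable_row i)).
  exact: (measurableT_comp measurable_fst measurable_fst).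
exact: (measurableT_comp (measurable_mat i j) measurable_snd).
Qed.

Section two_measures.
Variables mu nu : {finite_measure set Rn R n -> \bar R}.

Let q d (z : Mn R n * Rn R n) : \bar R := nu [set y | proj_triples d (z, y)].

Let mq d : measurable_fun setT (q d).
Proof. by apply: measurable_measure_section; exact: measurable_proj_triples. Qed.

Let q0 d z : 0 <= q d z. Proof. exact: measure_ge0. Qed.

Lemma measurable_proj_near k :
  measurable_fun setT (fun P : Mn R n => proj_near m mu nu k (P : 'M[R]_n)).
Proof.
apply: measurable_funeM.
exact: (measurable_fun_fubini_tonelli_F (q k.+1%:R^-1) (mq _) (q0 _)).
Qed.

Definition gamma_near (k : nat) (x y : Rn R n) : \bar R :=
  gamma (proj_lt ((y : 'rV[R]_n) - x) k.+1%:R^-1).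

Lemma measurable_gamma_near k :
  measurable_fun setT (fun z : Rn R n * Rn R n => gamma_near k z.1 z.2).
Proof.
rewrite (_ : (fun z => _) = fun z => gamma [set P | proj_triples' k.+1%:R^-1 (z, P)]).
  by apply: measurable_measure_section; exact: measurable_proj_triples'.
by [].
Qed.

Lemma measurable_gamma_near_snd k x : measurable_fun setT (gamma_near k x).
Proof. exact: (measurableT_comp (measurable_gamma_near k) (pair1_measurable x)). Qed.

Lemma measurable_gamma_near_int k :
  measurable_fun setT (fun x => \int[nu]_y gamma_near k x y).
Proof.
by apply: (measurable_fun_fubini_tonelli_F (fun z : Rn R n * Rn R n => gamma_near k z.1 z.2)
  (measurable_gamma_near k)) => z; exact: measure_ge0.
Qed.

(** Tonelli twice: P is exchanged with x, then with y for fixed x. Afterwards the bounds on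
    [gamma (proj_lt z d)] apply under the integral. *)
Lemma integral_proj_near_gamma k :
  \int[gamma]_P proj_near m mu nu k (P : 'M[R]_n) =
  (k.+1%:R ^+ m.+1)%:E * \int[mu]_x \int[nu]_y gamma_near k x y.
Proof.
rewrite /proj_near ge0_integralZl//; last 2 first.
- exact: (measurable_fun_fubini_tonelli_F (q k.+1%:R^-1) (mq _) (q0 _)).
- by move=> P _; apply: integral_ge0.
congr (_ * _); rewrite (fubini_tonelli (q k.+1%:R^-1) (mq _) (q0 _)).
apply: eq_integral => x _.
have mS : measurable [set z : Mn R n * Rn R n | proj_triples k.+1%:R^-1 ((z.1, x), z.2)].
  apply: measurable_lt; apply: measurable_eucl => j; under eq_fun do rewrite mxE.
  apply: measurable_sum => i; apply: measurable_funM.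
    under eq_fun do rewrite !mxE; apply: measurable_funB => //.
    exact: (measurableT_comp (measurable_row i) measurable_snd).
  exact: (measurableT_comp (measurable_mat i j) measurable_fst).
exact: (measure_section_swap gamma nu mS).
Qed.

End two_measures.

(** The normalising power of k + 1 cancels against the bound on [gamma], leaving the Riesz kernel.
    The constant is moved to the left, where measurability allows it to pass through the integrals;
    on the side of [energy] only monotonicity is used. *)
Lemma gamma_average_upper : exists2 C : R, (0 < C)%R &
  forall (mu : {finite_measure set Rn R n -> \bar R}) k,
    \int[gamma]_P proj_near m mu mu k (P : 'M[R]_n) <= C%:E * energy mu m.+1.
Proof.
have [C C0 HC] := gamma_proj_lt_upper gammaP mn.
exists C => // mu k; rewrite integral_proj_near_gamma -lee_pdivrMl//.
have ck0 : (0 <= k.+1%:R ^+ m.+1 :> R)%R by rewrite exprn_ge0.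
have Ck0 : 0 <= (C^-1 * k.+1%:R ^+ m.+1)%:E by rewrite lee_fin mulr_ge0// invr_ge0 ltW.
have gn0 x y : 0 <= gamma_near k x y by exact: measure_ge0.
rewrite muleA -EFinM -ge0_integralZl//; last 2 first.
- exact: measurable_gamma_near_int.
- by move=> x _; exact: integral_ge0.
apply: ge0_le_integral_sup => [x|x].
  by rewrite mule_ge0//; exact: integral_ge0.
rewrite -ge0_integralZl//; last exact: measurable_gamma_near_snd.
apply: ge0_le_integral_sup => [y|y]; first by rewrite mule_ge0.
rewrite /riesz_kernel; case: eqP => [_|/eqP xy]; first exact: leey.
have yx0 : ((y : 'rV[R]_n) - x != 0)%R by rewrite subr_eq0 eq_sym.
have k0 : (0 < k.+1%:R^-1 :> R)%R by rewrite invr_gt0.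
apply: (@le_trans _ _ ((C^-1 * k.+1%:R ^+ m.+1)%:E *
   (C * (k.+1%:R^-1 / eucl ((y : 'rV[R]_n) - x)) ^+ m.+1)%:E)).
  by rewrite lee_wpmul2l//; exact: HC.
rewrite -EFinM lee_fin eucl_sym mulrACA mulVf ?gt_eqF// mul1r -exprMn.
by rewrite mulVKf ?pnatr_eq0.
Qed.

Lemma eball_gt0 (mu : {finite_measure set Rn R n -> \bar R}) : 0 < mu setT ->
  exists j, forall i, (j <= i)%N -> 0 < mu (eball (0%R : 'rV[R]_n) i.+1%:R).
Proof.
move=> mu0; have [j muj] : exists j, 0 < mu (eball (0%R : 'rV[R]_n) j.+1%:R).
  apply/not_existsP => h; move: mu0; apply/negP; rewrite -leNgt.
  have -> : setT = \bigcup_k eball (0%R : 'rV[R]_n) k.+1%:R.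
    apply/seteqP; split=> // v _; exists (Num.truncn (eucl (v : 'rV[R]_n))) => //.
    by rewrite /eball/= subr0 truncnS_gt.
  apply: le_trans (measure_sigma_subadditive mu _ _ (@subset_refl _ _)) _.
  - by move=> k; exact: measurable_eball.
  - by apply: bigcup_measurable => k _; exact: measurable_eball.
  - rewrite eseries0// => k _ _ /=; apply/eqP; rewrite eq_le measure_ge0 andbT leNgt.
    exact/negP.
exists j => i ji; apply: (lt_le_trans muj); apply: le_measure; rewrite ?inE//.
- exact: measurable_eball.
- exact: measurable_eball.
- by move=> x /lt_le_trans; apply; rewrite ler_nat.
Qed.

(** Both measures charge a common ball [B], on which |x - y| <= r. If |x - y| exceeds 1/(k+1), the
    lower bound for [gamma] gives at least c r^(-m-1) after normalisation; closer pairs, including x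
    = y, already have [gamma] at least min(c, 1). *)
Lemma gamma_average_lower (mu nu : {finite_measure set Rn R n -> \bar R}) :
  0 < mu setT -> 0 < nu setT -> exists2 c : \bar R, 0 < c &
    forall k, c <= \int[gamma]_P proj_near m mu nu k (P : 'M[R]_n).
Proof.
move=> /eball_gt0[j1 h1] /eball_gt0[j2 h2]; pose j := maxn j1 j2.
have mu0 := h1 j (leq_maxl _ _); have nu0 := h2 j (leq_maxr _ _).
have [c c0 hc] := gamma_proj_lt_lower gammaP mn.
pose B := eball (0%R : 'rV[R]_n) j.+1%:R.
have mB : measurable B by exact: measurable_eball.
pose r : R := (2 * j.+1%:R)%R.
have r1 : (1 <= r)%R by rewrite /r -natrM ler1n.
have r0 : (0 < r)%R by exact: lt_le_trans r1.
pose c' : R := (Num.min c 1 * r ^- m.+1)%R.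
have c'0 : (0 < c')%R by rewrite mulr_gt0 ?invr_gt0 ?exprn_gt0// lt_min c0 ltr01.
exists (c'%:E * (mu B * nu B)); first by apply: mule_gt0; rewrite ?lte_fin//; exact: mule_gt0.
move=> k; rewrite integral_proj_near_gamma.
have k0 : (0 < k.+1%:R^-1 :> R)%R by rewrite invr_gt0.
have ck0 : (0 < k.+1%:R ^+ m.+1 :> R)%R by rewrite exprn_gt0.
have ck1 : (1 <= k.+1%:R ^+ m.+1 :> R)%R by rewrite exprn_ege1// ler1n.
have gn0 x y : 0 <= gamma_near k x y by exact: measure_ge0.
have rm1 : (r ^- m.+1 <= 1)%R by rewrite invf_le1 ?exprn_gt0// exprn_ege1.
have key x y : B x -> B y -> c'%:E <= (k.+1%:R ^+ m.+1)%:E * gamma_near k x y.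
  move=> Bx By.
  have yxr : (eucl ((y : 'rV[R]_n) - x) <= r)%R.
    apply: le_trans (ler_eucl_distD 0%R _ _) _; rewrite sub0r euclN subr0.
    move: Bx By; rewrite /B /eball/= !subr0 => Bx By.
    by rewrite /r mulr_natl mulr2n lerD// ltW.
  (* When |y - x| <= d, monotonicity reduces to d = |y - x|, where the lower bound is [c]; for y = x
     every projection qualifies and the measure is 1. *)
  have far : forall d : R, (0 < d)%R -> (eucl ((y : 'rV[R]_n) - x) <= d)%R ->
      (Num.min c 1)%:E <= gamma (proj_lt ((y : 'rV[R]_n) - x) d).
    move=> d d0 yxd; have [yx0|yx0] := eqVneq ((y : 'rV[R]_n) - x)%R 0%R.
      rewrite yx0 (_ : proj_lt _ _ = setT) ?gammaP.1.
        by rewrite lee_fin ge_min lexx orbT.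
      by apply/seteqP; split=> // P _; rewrite /proj_lt/= mul0mx eucl0.
    have e0 : (0 < eucl ((y : 'rV[R]_n) - x))%R by rewrite eucl_gt0.
    have A : gamma (proj_lt ((y : 'rV[R]_n) - x) (eucl ((y : 'rV[R]_n) - x))) <=
        gamma (proj_lt ((y : 'rV[R]_n) - x) d).
      by apply: (gamma_proj_lt_anti gammaP) => //; rewrite ler_pM2r.
    apply: le_trans A; apply: le_trans (hc _ _ yx0 e0 (lexx _)).
    by rewrite divff ?gt_eqF// expr1n mulr1 lee_fin ge_min lexx.
  have [yk|ky] := leP (eucl ((y : 'rV[R]_n) - x)) (k.+1%:R^-1)%R.
    apply: (@le_trans _ _ (1%:E * (Num.min c 1)%:E)).
      rewrite mul1e lee_fin /c' ler_piMr// le_min ler01 andbT; exact: ltW.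
    by apply: lee_pmul => //; rewrite ?lee_fin ?le_min ?(ltW c0) ?ler01//; exact: far.
  have e0 : (0 < eucl ((y : 'rV[R]_n) - x))%R by exact: lt_trans ky.
  have yx0 : ((y : 'rV[R]_n) - x != 0)%R by rewrite -eucl_gt0.
  rewrite muleC -lee_pdivrMr ?exprn_gt0//.
  apply: le_trans (hc _ _ yx0 k0 (ltW ky)).
  rewrite -EFinM lee_fin /c' [in leRHS]exprMn [in leRHS]exprVn mulrA [leRHS]mulrAC ler_pM2r ?invr_gt0//.
  apply: ler_pM; rewrite ?le_min ?(ltW c0) ?ler01 ?invr_ge0 ?exprn_ge0 ?(ltW r0)//.
    by rewrite ge_min lexx.
  rewrite exprVn lef_pV2 ?posrE ?exprn_gt0//.
  by rewrite lerXn2r ?nnegrE ?eucl_ge0 ?(ltW r0).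
rewrite -ge0_integralZl//; last 2 first.
- exact: measurable_gamma_near_int.
- by move=> x _; exact: integral_ge0.
have -> : c'%:E * (mu B * nu B) = \int[mu]_(x in B) (c'%:E * nu B).
  rewrite (eq_integral (cst ((fine (c'%:E * nu B))%:E))); last first.
    by move=> x _; rewrite fineK// fin_numM// fin_num_measure.
  rewrite integral_cst//= fineK ?fin_numM ?fin_num_measure//.
  by rewrite -muleA (muleC (nu B)).
rewrite [leLHS]integral_mkcond; apply: ge0_le_integral_sup.
  by move=> x; apply: erestrict_ge0 => z _; rewrite mule_ge0// lee_fin ltW.
move=> x; rewrite patchE; case: ifPn => [|_]; last first.
  by rewrite mule_ge0 ?lee_fin ?(ltW ck0)//; exact: integral_ge0.
rewrite inE => Bx; rewrite -ge0_integralZl//; last exact: measurable_gamma_near_snd.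
rewrite -(integral_cst nu mB) [leLHS]integral_mkcond; apply: ge0_le_integral_sup.
  by move=> y; apply: erestrict_ge0 => z _; rewrite lee_fin ltW.
move=> y; rewrite patchE; case: ifPn => [|_]; last by rewrite mule_ge0 ?lee_fin ?(ltW ck0).
by rewrite inE => By; exact: key.
Qed.

End gamma_average.

Section limsup.
Variable R : realType.
Local Open Scope ereal_scope.

Lemma limn_esup_le_near (u : (\bar R)^nat) (a : \bar R) :
  (\forall k \near \oo, u k <= a) -> limn_esup u <= a.
Proof.
move=> h; rewrite -leeN2 -limn_einfN; apply: near_le_limn_einf.
by apply: filterS h => k; rewrite /= leeN2.
Qed.

Lemma limn_einf_le (u : (\bar R)^nat) (a : \bar R) : (forall k, u k <= a) -> limn_einf u <= a.
Proof.
move=> h; rewrite limn_einfE; apply: ge_ereal_sup => _ [N _ <-].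
by apply: le_trans (h N); apply: ereal_inf_lbound; exists N => /=.
Qed.

Lemma measurable_limn_einf d (T : measurableType d) (u : (T -> \bar R)^nat) :
  (forall k, measurable_fun setT (u k)) -> measurable_fun setT (fun x => limn_einf (u ^~ x)).
Proof.
move=> mu; rewrite /limn_einf; apply: measurableT_comp => //.
apply: (@measurable_fun_limn_esup _ _ _ setT (fun k x => - u k x)) => k.
exact: measurableT_comp.
Qed.

End limsup.

(** * Projections on which the two densities overlap *)

Section overlap.
Variables (R : realType) (n m : nat).
Local Open Scope ereal_scope.
Variable gamma : {finite_measure set Mn R n -> \bar R}.
Variables mu nu : {finite_measure set Rn R n -> \bar R}.
Variables f g : 'M[R]_n -> 'rV[R]_n -> R.
Hypotheses (gammaP : grassmann_measure m.+1 gamma) (mn : (m.+1 < n)%N).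
Hypotheses (mu0 : 0 < mu setT) (nu0 : 0 < nu setT).
Hypotheses (cmu : compact (spt mu)) (cnu : compact (spt nu)).
Hypotheses (Imu : energy mu m.+1 < +oo) (Inu : energy nu m.+1 < +oo).
Hypothesis muf : {ae gamma, forall P : Mn R n, is_proj_density m.+1 mu P (f P)}.
Hypothesis nug : {ae gamma, forall P : Mn R n, is_proj_density m.+1 nu P (g P)}.

Let F k (P : Mn R n) := proj_near m mu nu k (P : 'M[R]_n).
Let limE (mu1 : {finite_measure set Rn R n -> \bar R}) (P : Mn R n) :=
  limn_einf (proj_near m mu1 mu1 ^~ (P : 'M[R]_n)).
Let L P := limn_esup (F ^~ P).

Let proj_near_ge0 (mu1 mu2 : {finite_measure set Rn R n -> \bar R}) k (P : 'M[R]_n) :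
  0 <= proj_near m mu1 mu2 k P.
Proof. by rewrite mule_ge0 ?lee_fin ?exprn_ge0//; exact: integral_ge0. Qed.

Let mlimE mu1 : measurable_fun setT (limE mu1).
Proof. by apply: measurable_limn_einf => k; exact: measurable_proj_near. Qed.

Let limE_ge0 mu1 P : 0 <= limE mu1 P.
Proof. by apply: near_le_limn_einf; apply: nearW => k; exact: proj_near_ge0. Qed.

Let mL : measurable_fun setT L.
Proof. by apply: measurable_fun_limn_esup => k; exact: measurable_proj_near. Qed.

(** Fatou's lemma, with averages bounded by a multiple of the energy. This provides the dominating
    function of the limit argument. *)
Let limE_integrable (mu1 : {finite_measure set Rn R n -> \bar R}) :
  energy mu1 m.+1 < +oo -> gamma.-integrable setT (limE mu1).
Proof.
move=> I1; apply/integrableP; split; first exact: mlimE.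
have [C C0 HC] := gamma_average_upper gammaP mn.
under eq_integral do rewrite gee0_abs//.
apply: (@le_lt_trans _ _ (C%:E * energy mu1 m.+1)); last first.
  case: (energy _ _) I1 => [r| |] //.
  - by move=> _; rewrite -EFinM ltry.
  - by rewrite gt0_muleNy ?lte_fin.
have mf k : measurable_fun setT (fun P : Mn R n => proj_near m mu1 mu1 k (P : 'M[R]_n)).
  exact: measurable_proj_near.
have f0 k (P : Mn R n) : setT P -> 0 <= proj_near m mu1 mu1 k (P : 'M[R]_n).
  by move=> _; exact: proj_near_ge0.
apply: le_trans (@fatou _ _ R gamma setT measurableT _ mf f0) _.
by apply: limn_einf_le => k; exact: HC.
Qed.

Lemma projection_densities_overlap :
  0 < \int[gamma]_P \int[hausdorff m.+1]_(v in subspace_of P) (f P v * g P v)%:E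
  /\
  exists B : set (Mn R n), measurable B /\
    B `<=` [set P | grassmannian m.+1 P /\
       0 < hausdorff m.+1 (projV P @` spt mu `&` projV P @` spt nu)] /\
    0 < gamma B.
Proof.
have [C C0 HC] := hausdorff_eball_bound R n m.
have [N1 [mN1 N10 sN1]] := muf; have [N2 [mN2 N20 sN2]] := nug.
have mG : measurable (grassmannian m.+1 : set (Mn R n)) by exact: measurable_grassmannian.
pose Z := N1 `|` N2 `|` ~` (grassmannian m.+1 : set (Mn R n)).
have mZ : measurable Z by apply: measurableU; [exact: measurableU|exact: measurableC].
have Z0 : gamma Z = 0.
  rewrite null_set_setU//; [exact: measurableU|exact: measurableC|by rewrite null_set_setU|].
  rewrite -(gamma_grassmannianI gammaP); last exact: measurableC.
  by rewrite setICl measure0.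
have good P : ~ Z P -> [/\ grassmannian m.+1 P, is_proj_density m.+1 mu P (f P) &
    is_proj_density m.+1 nu P (g P)].
  move=> /not_orP[/not_orP[nN1 nN2] GP]; split.
  - exact: contrapT.
  - by apply: contrapT => h; apply: nN1; apply: sN1.
  - by apply: contrapT => h; apply: nN2; apply: sN2.
(* Defined through [L] and not through [phi], so that [B] is measurable; off [Z], [phi] is at least
   L / (2 C) on it. *)
pose B := [set P | 0 < L P] `&` [set P | limE mu P < +oo] `&` [set P | limE nu P < +oo].
have mB : measurable B.
  have mlt mu1 : measurable [set P | limE mu1 P < +oo].
    by rewrite -[X in measurable X]setTI; apply: emeasurable_fun_infty_o => //; exact: mlimE.
  apply: measurableI => //; apply: measurableI => //.
  by rewrite -[X in measurable X]setTI; exact: emeasurable_fun_o_infty.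
pose phi P := \int[hausdorff m.+1]_(v in subspace_of P) (f P v * g P v)%:E.
have est P : ~ Z P -> 0 <= phi P /\ (B P -> 0 < (2 * C)^-1%:E * L P <= phi P).
  move=> /good[GP mufP nugP].
  have [p0 _ p2] := fibre_estimates GP (HC _ GP) mufP nugP mu0.
  split => // -[[/= LP E1] E2].
  have C2 : (0 < 2 * C)%R by rewrite mulr_gt0.
  rewrite mule_gt0 ?lte_fin ?invr_gt0//= lee_pdivrMl//.
  apply/lee_addgt0Pr => e e0; apply: limn_esup_le_near.
  exact: p2.
have L0 P : 0 <= L P.
  apply: le_trans (limn_einf_sup _); apply: near_le_limn_einf; apply: nearW => k.
  exact: proj_near_ge0.
(* Otherwise [L] vanishes almost everywhere, as both lower limits are finite almost everywhere; the
   F_k, being nonnegative, then tend to 0, although their averages stay above [c]. *)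
have gB : 0 < gamma B.
  rewrite lt_neqAle measure_ge0 andbT eq_sym; apply/negP => /eqP gB0.
  have [c c0 hc] := gamma_average_lower gammaP mn mu0 nu0.
  have i1 := limE_integrable Imu; have i2 := limE_integrable Inu.
  pose G P := 2^-1%:E * (limE mu P + limE nu P).
  have iG : gamma.-integrable setT G by apply: integrableZl => //; exact: integrableD.
  have [W1 [mW1 W10 sW1]] := integrable_ae measurableT i1.
  have [W2 [mW2 W20 sW2]] := integrable_ae measurableT i2.
  have cF : {ae gamma, forall P, setT P -> F ^~ P @ \oo --> (cst 0 : Mn R n -> \bar R) P}.
    exists (Z `|` B `|` (W1 `|` W2)); split.
    - by do 2 apply: measurableU => //; exact: measurableU.
    - rewrite null_set_setU//; last by rewrite null_set_setU.
      + exact: measurableU.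
      + exact: measurableU.
      + by rewrite null_set_setU.
    - move=> P /=; apply: contra_notP => /not_orP[/not_orP[nZ nB] /not_orP[nW1 nW2]] _.
      have E1 : limE mu P < +oo.
        have : limE mu P \is a fin_num by apply: contrapT => h; apply: nW1; apply: sW1 => /= /(_ I).
        by rewrite ge0_fin_numE.
      have E2 : limE nu P < +oo.
        have : limE nu P \is a fin_num by apply: contrapT => h; apply: nW2; apply: sW2 => /= /(_ I).
        by rewrite ge0_fin_numE.
      apply: limn_esup_le_cvg; last by move=> k; exact: proj_near_ge0.
      by rewrite leNgt; apply/negP => LP; apply: nB.
  have FG : {ae gamma, forall P k, setT P -> `|F k P| <= G P}.
    exists Z; split => // P /=; apply: contra_notP => /good[GP mufP nugP] k _.
    have [_ p1 _] := fibre_estimates GP (HC _ GP) mufP nugP mu0.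
    by rewrite gee0_abs; [exact: p1|exact: proj_near_ge0].
  have [_ _] := dominated_convergence measurableT (fun k => measurable_proj_near m mu nu k)
    (measurable_cst _) cF iG FG.
  rewrite integral0 => lim0.
  have : c <= 0 by apply: cvge_ge lim0; apply: nearW => k; exact: hc.
  by rewrite leNgt c0.
have gBZ : 0 < gamma (B `\` Z).
  rewrite (lt_le_trans gB)// (measureDI gamma mB mZ) [X in _ + X](_ : _ = 0) ?adde0//.
  apply/eqP; rewrite eq_le measure_ge0 andbT -Z0; apply: le_measure; rewrite ?inE//.
  exact: measurableI.
split.
  apply: (@integral_gt0_minorant _ _ _ gamma phi (fun P => (2 * C)^-1%:E * L P) Z B) => //.
  - by move=> P /est[].
  - by apply: measurable_funeM.
  - by move=> P; rewrite mule_ge0 ?lee_fin ?invr_ge0 ?mulr_ge0 ?(ltW C0).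
  - by move=> P BP nZP; exact: (est P nZP).2.
exists (B `\` Z); split; first exact: measurableD.
split => // P [BP nZP]; have [GP mufP nugP] := good P nZP.
split => //; apply: (fibre_support_gt0 GP mufP nugP) => //.
by have /andP[h1 h2] := (est P nZP).2 BP; exact: lt_le_trans h2.
Qed.

End overlap.

Lemma exists_finite_measure d (T : measurableType d) (R : realType)
    (mu : {measure set T -> \bar R}) :
  (mu setT < +oo)%E -> exists nu : {finite_measure set T -> \bar R}, nu = mu :> (set T -> \bar R).
Proof.
move=> fin; exists (mfrestr measurableT fin).
by apply/funext => A; rewrite /= /mfrestr /mrestr setIT.
Qed.

(** The second conclusion is stated by means of a measurable subset of positive measure, so that it
    is meaningful without measurability of the set of projections itself. The proof passes to finite
    measures with the same values, which the arguments by Tonelli's theorem require. *)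
Theorem theorem3p2 (R : realType) (n m : nat)
  (mu nu : {measure set Rn R n -> \bar R})
  (gamma : {measure set Mn R n -> \bar R})
  (f g : 'M[R]_n -> 'rV[R]_n -> R) :
  (1 <= m < n)%N ->
  (0 < mu setT < +oo)%E -> (0 < nu setT < +oo)%E ->
  compact (spt mu) -> compact (spt nu) ->
  (energy mu m < +oo)%E -> (energy nu m < +oo)%E ->
  grassmann_measure m gamma ->
  {ae gamma, forall P : Mn R n, is_proj_density m mu P (f P)} ->
  {ae gamma, forall P : Mn R n, is_proj_density m nu P (g P)} ->
  (0 < \int[gamma]_P
         \int[hausdorff m]_(v in subspace_of P) (f P v * g P v)%:E)%E
  /\
  exists B : set (Mn R n), measurable B /\
    B `<=` [set P | grassmannian m P /\
       (0 < hausdorff m (projV P @` spt mu `&` projV P @` spt nu))%E] /\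
    (0 < gamma B)%E.
Proof.
case: m => [//|m] /andP[_ mn] /andP[mu0 muoo] /andP[nu0 nuoo] cmu cnu Imu Inu gammaP muf nug.
have goo : (gamma setT < +oo)%E by rewrite gammaP.1 ltry.
have [mu' emu] := exists_finite_measure muoo.
have [nu' enu] := exists_finite_measure nuoo.
have [gamma' egamma] := exists_finite_measure goo.
move: mu0 nu0 cmu cnu Imu Inu gammaP muf nug.
rewrite -emu -enu -egamma => mu0 nu0 cmu cnu Imu Inu gammaP muf nug.
exact: projection_densities_overlap.
Qed.
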